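(* Let $\Phi_k$ denote the set of graphs in $\Phi$ with exactly $k$ vertices. Then the sequence $\eta(\Phi_0),\eta(\Phi_1),\eta(\Phi_2),\eta(\Phi_3),\dots$ is non-increasing, and $\xi_k=\eta(\Phi_k)$ for every $k=0,1,2,\dots$.
   Context: All graphs are finite and undirected, possibly with loops and parallel edges; the degree $d(x)$ of a vertex counts each loop at $x$ twice. The flow polynomial $F(G,\lambda)$ is determined by: $F(G,\lambda)=1$ if $E(G)=\emptyset$; $F(G,\lambda)=0$ if $G$ has a bridge; $F(G_1\cup G_2,\lambda)=F(G_1,\lambda)F(G_2,\lambda)$ for a disjoint union; $F(G,\lambda)=(\lambda-1)F(G-e,\lambda)$ if $e$ is a loop; otherwise $F(G,\lambda)=F(G/e,\lambda)-F(G-e,\lambda)$, where $G/e$ is obtained by contracting $e$. Its roots are the flow roots of $G$. For vertices $u_1,u_2$, $G/u_1u_2$ denotes the graph obtained by identifying $u_1$ and $u_2$ (edges joining them become loops). A graph is non-separable if it is connected, has no cut-vertex, and either has no loops or has exactly one vertex and one edge; a block is a maximal non-separable subgraph, and $b(G)$ is the number of blocks of $G$ having at least one edge. Let $W(G)$ be the set of vertices of degree larger than $3$, and $\Psi_k$ the set of bridgeless connected graphs $G$ with $|W(G)|\le k$. Let $\xi_k$ be the supremum of the numbers $\beta\in(1,2]$ such that no graph in $\Psi_k$ has a flow root in $(1,\beta)$. For a bridgeless graph $G$, $\eta(G)$ is the smallest flow root of $G$ in $(1,2]$ if one exists and $\eta(G)=2$ otherwise; for a set $\mathcal S$ of bridgeless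 graphs, $\eta(\mathcal S)=\inf\{\eta(G):G\in\mathcal S\}$ if $\mathcal S\neq\emptyset$ and $\eta(\emptyset)=2$. $\Phi$ is the set of non-separable graphs $G$ with $|V(G)|\ge 2$ such that: (a') $G-e$ is non-separable for every edge $e$; (b') $b(G/e)$ is even for every edge $e$; (c') whenever $G_1,G_2$ are subgraphs of $G$ with $|E(G_1)|\ge2$, $|E(G_2)|\ge 2$, $V(G_1)\cap V(G_2)=\{u_1,u_2\}$ (two distinct vertices), $V(G_1)\cup V(G_2)=V(G)$, $E(G_1)\cap E(G_2)=\emptyset$ and $E(G_1)\cup E(G_2)=E(G)$, the three integers $b(G_1/u_1u_2)$, $b(G_1)-1$ and $b(G_2)$ all have the same parity. *)

(* Defs.v *)
From HB Require Import structures.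
From mathcomp Require Import all_boot all_order all_algebra.
From mathcomp Require Import boolp classical_sets reals.
Set Implicit Arguments. Unset Strict Implicit. Unset Printing Implicit Defensive.
Import Order.TTheory GRing.Theory Num.Theory.

(* A finite multigraph (loops and parallel edges allowed): a finite vertex
   type, a finite edge type, and the (unordered) pair of ends of each edge.
   An edge e is a loop iff (ends e).1 = (ends e).2. *)
Record graph := Graph { V : finType; E : finType; ends : E -> V * V }.

Section Basic.
Variable G : graph.

Definition is_loop (e : E G) : bool := (ends e).1 == (ends e).2.

(* degree: a loop at x counts twice *)
Definition deg (x : V G) : nat :=
  #|[set e : E G | (ends e).1 == x]| + #|[set e : E G | (ends e).2 == x]|.

Definition Wset : {set V G} := [set x | 3 < deg x].

Definition adjF (F : {set E G}) : rel (V G) :=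
  fun x y => [exists e in F, (ends e == (x, y)) || (ends e == (y, x))].

Definition issub (S : {set V G}) (F : {set E G}) : bool :=
  [forall e in F, ((ends e).1 \in S) && ((ends e).2 \in S)].

Definition conn_sub (S : {set V G}) (F : {set E G}) : bool :=
  (S != finset.set0) && [forall x in S, forall y in S, connect (adjF F) x y].

(* x is a cut-vertex of the connected subgraph (S,F): removing x (and its
   incident edges) leaves two vertices of S that are no longer connected,
   i.e. the number of components increases. *)
Definition cutv_sub (S : {set V G}) (F : {set E G}) (x : V G) : bool :=
  (x \in S) && [exists y in S, exists z in S,
    [&& y != x, z != x &
      ~~ connect (fun a b => [&& adjF F a b, a != x & b != x]) y z]].

Definition hasloop (F : {set E G}) : bool := [exists e in F, is_loop e].

Definition nonsep_sub (S : {set V G}) (F : {set E G}) : bool :=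
  [&& issub S F, conn_sub S F, ~~ [exists x, cutv_sub S F x] &
      ~~ hasloop F || ((#|S| == 1) && (#|F| == 1))].

Definition is_block (S : {set V G}) (F : {set E G}) : bool :=
  nonsep_sub S F &&
  [forall S' : {set V G}, forall F' : {set E G},
     [&& nonsep_sub S' F', S \subset S' & F \subset F'] ==>
     (S' == S) && (F' == F)].

Definition bnum : nat :=
  #|[set p : {set V G} * {set E G} | is_block p.1 p.2 && (p.2 != finset.set0)]|.

Definition nonsep : bool := nonsep_sub finset.setT finset.setT.
Definition connected : bool := conn_sub finset.setT finset.setT.

Definition is_bridge (e : E G) : bool :=
  ~~ is_loop e && ~~ connect (adjF (finset.setT :\ e)) (ends e).1 (ends e).2.
Definition has_bridge : bool := [exists e, is_bridge e].
Definition bridgeless : bool := ~~ has_bridge.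

End Basic.

Definition delete (G : graph) (e : E G) : graph :=
  @Graph (V G) ({f : E G | f != e} : finType) (fun f => ends (val f)).

(* G / u1u2 : identify u1 and u2 (u2 is merged into u1); identity if u1 = u2 *)
Definition idmap (T : finType) (u1 u2 : T) (h : u1 != u2) (x : T)
  : {y : T | y != u2} := insubd (exist (fun y => y != u2) u1 h) x.

Definition identify (G : graph) (u1 u2 : V G) : graph :=
  match u1 =P u2 with
  | ReflectT _ => G
  | ReflectF h =>
      @Graph ({y : V G | y != u2} : finType) (E G)
        (fun e => (idmap (introN eqP h) (ends e).1,
                   idmap (introN eqP h) (ends e).2))
  end.

Definition contract (G : graph) (e : E G) : graph :=
  @identify (delete e) (ends e).1 (ends e).2.

Section Subg.
Variables (G : graph) (S : {set V G}) (F : {set E G}).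
Definition subE := {e : E G | [&& e \in F, (ends e).1 \in S & (ends e).2 \in S]}.
Lemma subE_end1 (e : subE) : (ends (val e)).1 \in S.
Proof. by case/and3P: (valP e). Qed.
Lemma subE_end2 (e : subE) : (ends (val e)).2 \in S.
Proof. by case/and3P: (valP e). Qed.
Definition subg : graph :=
  @Graph ({x : V G | x \in S} : finType) (subE : finType)
    (fun e => (exist _ (ends (val e)).1 (subE_end1 e),
               exist _ (ends (val e)).2 (subE_end2 e))).
Definition identify_sub (u1 u2 : V G) : graph :=
  match (insub u1 : option (V subg)), (insub u2 : option (V subg)) with
  | Some a, Some b => @identify subg a b
  | _, _ => subg
  end.
End Subg.

Local Open Scope ring_scope.

(* The flow polynomial, computed by the deletion-contraction rules of the
   paper (F = 1 without edges, 0 with a bridge, loop rule, and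
   F(G) = F(G/e) - F(G-e) for a non-loop edge e); the fuel is #|E|+1. *)
Fixpoint flowp_fuel (n : nat) (G : graph) : {poly int} :=
  match n with
  | 0 => 1
  | n'.+1 =>
      if has_bridge G then 0 else
      match [pick e : E G] with
      | None => 1
      | Some e =>
          if is_loop e then ('X - 1) * flowp_fuel n' (delete e)
          else flowp_fuel n' (contract e) - flowp_fuel n' (delete e)
      end
  end.

Definition flowpoly (G : graph) : {poly int} := flowp_fuel #|E G|.+1 G.

Section Real.
Variable R : realType.

Definition flow_root (G : graph) (x : R) : Prop :=
  root (map_poly (fun z : int => z%:~R) (flowpoly G)) x.

Definition eta (G : graph) : R :=
  xget 2 [set r : R | (1 < r <= 2) /\ flow_root G r /\
          forall s : R, 1 < s <= 2 -> flow_root G s -> r <= s].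

(* (sets of graphs are predicates graph -> Prop, since graph lives in a
   universe above the one of classical_sets.set) *)
Definition etaS (S : graph -> Prop) : R :=
  if `[< exists G, S G >] then inf [set r : R | exists2 G, S G & r = eta G]
  else 2.

Definition Psi (k : nat) (G : graph) : Prop :=
  bridgeless G /\ connected G /\ (#|Wset G| <= k)%N.

Definition xi (k : nat) : R :=
  sup [set beta : R | (1 < beta <= 2) /\
        forall G, Psi k G -> forall x : R, 1 < x < beta -> ~ flow_root G x].

End Real.

Definition inPhi (G : graph) : Prop :=
  [/\ nonsep G, (2 <= #|V G|)%N,
      (* (a') *) forall e : E G, nonsep (delete e),
      (* (b') *) forall e : E G, ~~ odd (bnum (contract e)) &
      (* (c') *) forall (S1 S2 : {set V G}) (F1 F2 : {set E G}) (u1 u2 : V G),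
         issub S1 F1 -> issub S2 F2 ->
         (2 <= #|F1|)%N -> (2 <= #|F2|)%N -> u1 != u2 ->
         S1 :&: S2 = [set u1; u2] -> S1 :|: S2 = finset.setT ->
         F1 :&: F2 = finset.set0 -> F1 :|: F2 = finset.setT ->
         (* parity of b(G1/u1u2) = parity of b(G1)-1 = parity of b(G2) *)
         odd (bnum (identify_sub S1 F1 u1 u2)) = ~~ odd (bnum (subg S1 F1)) /\
         ~~ odd (bnum (subg S1 F1)) = odd (bnum (subg S2 F2))].

Definition PhiK (k : nat) (G : graph) : Prop := inPhi G /\ #|V G| = k.

(* Main.v *)
Require Import Defs.
From mathcomp Require Import boolp classical_sets reals.
From mathcomp Require Import all_boot all_order all_algebra zify ring lra.
Set Implicit Arguments. Unset Strict Implicit. Unset Printing Implicit Defensive.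
Import Order.TTheory GRing.Theory Num.Theory.

(** Fix [1 < x < 2] and call [G] well signed at [x] when
    [(-1)^(#E + #V + 1 + b(G)) F(G, x) > 0].  In a class [Psi k] with [k >= 1], a
    graph that is not well signed at [x] and has fewest edges lies in [Phi] and has
    at most [k] vertices: cut vertices, vertices of degree 2, edges with [G - e]
    separable, 2-separations violating (c'), vertices of degree 3 and edges with
    [b(G/e)] odd are excluded in turn, since each lets [F(G, x)] be written in terms
    of smaller graphs of [Psi k] with signs that add up.  On the other hand every
    graph of [Phi] is well signed just to the right of 1 (the derivative of [F] at 1
    is, up to sign, Crapo's beta invariant), so one that is not well signed at [x]
    has a root in [(1, x]].

    Only finitely many polynomials occur as flow polynomials in [Phi_k], so they have
    a smallest root [u_k] in [(1, 2)], or [u_k = 2].  By induction on [k], everything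
    in [Psi k] is well signed on [(1, u_k)]: if [u_k < 2], take a minimal graph that
    is not well signed at [u_k] and replace one of its edges by a path of length 2
    with doubled edges; the result lies in [Psi (k + 1)] and has a root smaller than
    [u_k].  Below [u_k] a minimal graph of [Psi (k + 1)] that is not well signed
    cannot lie in [Psi k], so it has exactly [k + 1] vertices. *)

(** * Cuts, connectivity and 1-separations *)

(** The exponent in the sign is forced by products over blocks. In a connected graph the numbers of
    vertices of the blocks add up to #V + b(G) - 1, so if every block has the sign (-1)^(#E + #V)
    just to the right of 1, then F(G, x) has the sign (-1)^(#E + #V + 1 + b(G)). The parities in
    (b') and (c') are thus statements about signs: each fails exactly when known terms for smaller
    graphs can be made to add up. The flow polynomial is given by a recursion that picks an
    arbitrary edge, so its identities cannot be read off. They are obtained by evaluation at primes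
    p, where it counts nowhere-zero flows over ['F_p]. Cutting a graph at two vertices u, v leaves
    chains whose excess is a multiple of the difference of the indicators of u and v, so chains with
    an arbitrary excess are counted, not only flows. The delicate exclusion is a 2-separation where
    b(G1) and b(G2) differ in parity but b(G1/uv) agrees with b(G1): the two terms of F(G, x) then
    have opposite signs and their sizes have to be compared. *)

Section Structure.
Variable G : graph.
Implicit Types (x y u v w : V G) (e f : E G) (S A : {set V G}) (F : {set E G}).

Definition inc x e := ((ends e).1 == x) || ((ends e).2 == x).
Definition cut S e := ((ends e).1 \in S) != ((ends e).2 \in S).

Definition sep1 F1 F2 w :=
  [/\ F1 != set0, F2 != set0, forall e, e \in F1 -> e \notin F2 &
      forall x e f, e \in F1 -> f \in F2 -> inc x e -> inc x f -> x = w].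

(** Connectivity is phrased by cuts instead of walks because vertex sets pull back along maps of
    vertices; connectivity and absence of bridges then pass to quotients, sides of separations and
    graphs with added edges by the same argument. *)
Definition cutconn S F :=
  forall A x y, x \in S -> y \in S -> x \in A -> y \notin A ->
  exists2 e, e \in F & cut A e.

Lemma incE1 e : inc (ends e).1 e. Proof. by rewrite /inc eqxx. Qed.
Lemma incE2 e : inc (ends e).2 e. Proof. by rewrite /inc eqxx orbT. Qed.

Lemma adjFP F x y :
  reflect (exists2 e, e \in F & ends e = (x, y) \/ ends e = (y, x)) (adjF F x y).
Proof.
apply: (iffP existsP) => -[e].
  by move=> /andP[eF /orP[] /eqP]; exists e; auto.
by move=> eF H; exists e; rewrite eF /=; case: H => ->; rewrite eqxx ?orbT.
Qed.

Lemma adjF_sym F : symmetric (adjF F).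
Proof. by move=> x y; apply/adjFP/adjFP=> -[e eF [] H]; exists e; auto. Qed.

Lemma cut_adj F S x y : connect (adjF F) x y -> x \in S -> y \notin S ->
  exists2 e, e \in F & cut S e.
Proof.
move=> cxy xS yS; apply: contrapT => H; case/negP: yS.
rewrite -(@closed_connect _ (adjF F) (mem S) _ x y) //.
move=> a b /adjFP[e eF eab]; apply/eqP; apply: contraT => nab.
case: H; exists e => //; rewrite /cut.
by case: eab => ->; rewrite //= eq_sym.
Qed.

Lemma cut_conn F x y :
  (forall S, x \in S -> y \notin S -> exists2 e, e \in F & cut S e) ->
  connect (adjF F) x y.
Proof.
move=> H; apply: contraT => nc.
have [||e eF] := H [set z | connect (adjF F) x z]; rewrite ?inE ?connect0 //.
rewrite /cut !inE; have ad : adjF F (ends e).1 (ends e).2.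
  by apply/adjFP; exists e => //; left; case: (ends e).
suff -> : connect (adjF F) x (ends e).1 = connect (adjF F) x (ends e).2.
  by rewrite eqxx.
apply/idP/idP => /connect_trans; apply; apply: connect1 => //.
by rewrite adjF_sym.
Qed.

Lemma conn_subP S F : reflect (S != set0 /\ cutconn S F) (conn_sub S F).
Proof.
apply: (iffP andP) => -[S0 H]; split=> //.
  move=> A x y xS yS; apply: cut_adj.
  by move/forall_inP: H => /(_ _ xS)/forall_inP/(_ _ yS).
apply/forall_inP=> x xS; apply/forall_inP=> y yS; apply: cut_conn => A.
exact: H.
Qed.

Lemma connectedP :
  reflect ((exists x : V G, True) /\ forall S x y, x \in S -> y \notin S ->
    exists e, cut S e) (connected G).
Proof.
apply: (iffP (conn_subP _ _)) => -[].
  move=> /set0Pn[x _] H; split; first by exists x.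
  by move=> S a b aS bS; have [e] := H S a b (in_setT a) (in_setT b) aS bS; exists e.
move=> [x _] H; split; first by apply/set0Pn; exists x; rewrite inE.
by move=> A a b _ _ aS bS; have [e] := H A a b aS bS; exists e.
Qed.

Lemma cut_loop S e : is_loop e -> cut S e = false.
Proof. by rewrite /is_loop /cut => /eqP ->; rewrite eqxx. Qed.

Lemma is_bridgeP e :
  reflect (exists S, forall f, cut S f = (f == e)) (is_bridge e).
Proof.
apply: (iffP andP) => [[nl nc]|[S H]].
  have : ~ forall S, (ends e).1 \in S -> (ends e).2 \notin S ->
      exists2 f, f \in setT :\ e & cut S f.
    by move=> /cut_conn; apply/negP.
  move=> /existsNP[S /not_implyP[e1 /not_implyP[e2 H]]]; exists S => f.
  apply/idP/eqP => [cf|->]; last by rewrite /cut e1 (negbTE e2).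
  apply: contrapT => /eqP fe; case: H; exists f => //.
  by rewrite !inE fe.
split.
  by apply/negP => /(cut_loop S); rewrite H eqxx.
apply/negP => c.
wlog [e1 e2] : S H / (ends e).1 \in S /\ (ends e).2 \notin S => [wl|].
  have := H e; rewrite eqxx /cut.
  case e1: (_ \in S); case e2: (_ \in S) => // _.
    by apply: (wl S) => //; rewrite e1 e2.
  apply: (wl (~: S)) => [f|]; last by rewrite !inE e1 e2.
  by rewrite -H /cut !inE; case: (_ \in S); case: (_ \in S).
by have [f] := cut_adj c e1 e2; rewrite H !inE => /andP[/negbTE ->].
Qed.

Lemma bridgelessP :
  reflect (forall S e, cut S e -> exists2 f, f != e & cut S f) (bridgeless G).
Proof.
rewrite /bridgeless /has_bridge negb_exists.
apply: (iffP forallP) => [H S e ce|H e].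
  apply: contrapT => Hn; have /negP := H e; apply; apply/is_bridgeP; exists S => f.
  apply/idP/eqP => [cf|-> //]; apply: contrapT => /eqP fe.
  by apply: Hn; exists f.
apply/negP => /is_bridgeP[S HS].
by have [|f fe] := H S e; rewrite HS // (negbTE fe).
Qed.

(** Non-separability in terms of bipartitions of the edges. The last clause absorbs both the
    condition on cut-vertices and the one on loops: a loop next to any other edge is a 1-separation
    at the vertex of the loop. *)
Definition nsub S F :=
  [/\ issub S F, S != set0, cutconn S F &
      forall F1 F2 w, F1 :|: F2 = F -> ~ sep1 F1 F2 w].

Lemma issubP S F :
  reflect (forall e x, e \in F -> inc x e -> x \in S) (issub S F).
Proof.
apply: (iffP forall_inP) => [H e x eF|H e eF].
  by case/andP: (H e eF) => a b /orP[] /eqP <-.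
by rewrite !(H e) // ?incE1 ?incE2.
Qed.

Lemma hasloopP F : reflect (exists2 e, e \in F & is_loop e) (hasloop F).
Proof.
apply: (iffP existsP) => -[e]; first by move=> /andP[]; exists e.
by move=> eF l; exists e; rewrite eF.
Qed.

Lemma cut1 x e : cut [set x] e -> inc x e.
Proof. by rewrite /cut /inc !inE; case: (_ == x); case: (_ == x). Qed.

Lemma nonloop_other e w : ~~ is_loop e -> exists2 y, inc y e & y != w.
Proof.
rewrite /is_loop => l; case: (eqVneq (ends e).1 w) => [ew|].
  by exists (ends e).2; rewrite ?incE2 // -ew eq_sym.
by exists (ends e).1; rewrite ?incE1.
Qed.

Definition radj F w : rel (V G) := fun a b => [&& adjF F a b, a != w & b != w].

Lemma radj_sym F w : symmetric (radj F w).
Proof. by move=> a b; rewrite /radj adjF_sym (andbC (a != w)). Qed.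

Lemma nonsep_sub_nsub S F : nonsep_sub S F -> nsub S F.
Proof.
move=> /and4P[iSF /conn_subP[S0 cS] ncut lp]; split=> // F1 F2 w F12 [F10 F20 dis sh].
have {}lp : ~~ hasloop F.
  case/orP: lp => // /andP[_ /cards1P[e Fe]].
  case/set0Pn: F10 => a aF; case/set0Pn: F20 => b bF.
  have : a \in F by rewrite -F12 inE aF.
  have : b \in F by rewrite -F12 inE bF orbT.
  rewrite Fe !inE => /eqP be /eqP ae.
  by have := dis a aF; rewrite ae -be bF.
case/set0Pn: F10 => a aF; case/set0Pn: F20 => b bF.
have nl e : e \in F -> ~~ is_loop e.
  by move=> eF; apply: contra lp => l; apply/hasloopP; exists e.
have aFF : a \in F by rewrite -F12 inE aF.
have bFF : b \in F by rewrite -F12 inE bF orbT.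
have [y ya yw] := nonloop_other w (nl a aFF).
have [z zb zw] := nonloop_other w (nl b bFF).
move/issubP: iSF => iSF.
have yS := iSF _ _ aFF ya; have zS := iSF _ _ bFF zb.
(* The [F1] side without [w] is closed under adjacency avoiding [w], so [w] separates [y] from
   [z]. *)
pose A := [set v | [exists e in F1, inc v e] && (v != w)].
have yA : y \in A by rewrite inE yw andbT; apply/existsP; exists a; rewrite aF.
have zA : z \notin A.
  rewrite inE zw andbT; apply/existsP => -[e /andP[eF ze]].
  by have /eqP := sh _ _ _ eF bF ze zb; rewrite (negbTE zw).
have clos : closed (radj F w) (mem A).
  move=> p q; suff H: forall p q, radj F w p q -> p \in A -> q \in A.
    by move=> pq; apply/idP/idP; apply: H; rewrite // radj_sym.
  move=> {}p {}q /and3P[/adjFP[e eF epq] pw qw].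
  rewrite !inE qw andbT => /andP[/existsP[f /andP[fF pf]] _].
  have ipe : inc p e by case: epq => H; rewrite /inc H eqxx ?orbT.
  have iqe : inc q e by case: epq => H; rewrite /inc H eqxx ?orbT.
  apply/existsP; exists e; rewrite iqe andbT.
  move: eF; rewrite -F12 inE => /orP[// | eF2].
  by have /eqP := sh _ _ _ fF eF2 pf ipe; rewrite (negbTE pw).
have nc : ~~ connect (radj F w) y z.
  by apply/negP => /(closed_connect clos); rewrite yA (negbTE zA).
(* If [w] were outside [S], no edge of [F] would leave [A], against connectivity. *)
have wS : w \in S.
  apply: contraT => wS.
  have [e eF] := cS A y z yS zS yA zA.
  rewrite /cut (clos (ends e).1 (ends e).2) ?eqxx // /radj.
  have ad : adjF F (ends e).1 (ends e).2.
    by apply/adjFP; exists e => //; left; case: (ends e).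
  rewrite ad /=; apply/andP; split; apply: contraNneq wS => <-.
    exact: iSF (incE1 e).
  exact: iSF (incE2 e).
case/existsP: ncut; exists w; rewrite /cutv_sub wS /=.
apply/existsP; exists y; rewrite yS; apply/existsP; exists z; rewrite zS yw zw.
exact: nc.
Qed.

Lemma nsub_nonsep_sub S F : nsub S F -> nonsep_sub S F.
Proof.
move=> [iSF S0 cS nosep].
have sepF F1 w : F1 \subset F -> F1 != set0 -> F :\: F1 != set0 ->
    (forall x e f, e \in F1 -> f \in F -> f \notin F1 -> inc x e -> inc x f -> x = w) ->
    False.
  move=> sF F10 F20 sh; case: (nosep F1 (F :\: F1) w).
    by rewrite -{1}(setIidPr sF) setID.
  split=> //; first by move=> e eF; rewrite inE eF.
  by move=> x e f eF; rewrite inE => /andP[fF1 fF]; apply: sh.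
move/issubP: (iSF) => iS.
have edge_at z y : z \in S -> y \in S -> y != z -> exists2 e, e \in F & cut [set z] e.
  by move=> zS yS yz; apply: (cS [set z] z y) => //; rewrite !inE.
apply/and4P; split=> //.
- by apply/conn_subP.
- apply/existsP => -[w /andP[wS /existsP[y /andP[yS /existsP[z]]]]].
  move=> /and4P[zS yw zw nc].
  (* The component of [y] after removal of [w]. The edges meeting it, against all the others, form a
     1-separation at [w]. *)
  pose A := [set v | connect (radj F w) y v].
  have Aw v : v \in A -> v != w.
    rewrite inE => /connectP[p]; elim/last_ind: p => [_ ->//|p q _].
    by rewrite rcons_path last_rcons => /andP[_ /and3P[_ _ H]] ->.
  pose F1 := [set e in F | [exists v in A, inc v e]].
  have key v e a : e \in F -> a \in A -> inc a e -> inc v e -> v \in A \/ v = w.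
    move=> eF aA ae ve; case: (eqVneq v w) => [|vw]; [by right|left].
    case: (eqVneq v a) => [->//|va].
    move: (aA); rewrite !inE => /connect_trans; apply; apply: connect1.
    rewrite /radj (Aw a) // vw !andbT; apply/adjFP; exists e => //.
    move: ae ve va; rewrite /inc; case: (ends e) => p q /=.
    by move=> /orP[]/eqP -> /orP[]/eqP ->; rewrite ?eqxx //; auto.
  have yA : y \in A by rewrite inE connect0.
  have zA : z \notin A by rewrite inE.
  have zy : z != y by apply: contraNneq zA => ->.
  apply: (sepF F1 w).
  + by apply/subsetP => e; rewrite inE => /andP[].
  + have [e eF /cut1 ye] := edge_at y z yS zS zy.
    apply/set0Pn; exists e; rewrite inE eF /=; apply/existsP; exists y.
    by rewrite yA.
  + have [e eF /cut1 ze] := edge_at z y zS yS (ltac:(by rewrite eq_sym)).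
    apply/set0Pn; exists e; rewrite !inE eF andbT /=; apply/existsP => -[v /andP[vA ve]].
    by case: (key z e v) => //; [rewrite (negbTE zA)|move/eqP; rewrite (negbTE zw)].
  + move=> x e f; rewrite !inE => /andP[eF /existsP[a /andP[aA ae]]] fF.
    rewrite fF /= => /existsP fA xe xf.
    by case: (key x e a) => // xA; case: fA; exists x; rewrite xA.
case: (boolP (hasloop F)) => //= /hasloopP[e eF le].
have Fe : F = [set e].
  apply/eqP; rewrite eqEsubset sub1set eF andbT; apply: contraT => /subsetPn[f fF].
  rewrite inE => fe; case: (sepF [set e] (ends e).1).
  + by rewrite sub1set.
  + by apply/set0Pn; exists e; rewrite inE.
  + by apply/set0Pn; exists f; rewrite !inE fe.
  + move=> x a b /set1P -> _ _; move: le; rewrite /is_loop /inc => /eqP <-.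
    by rewrite orbb => /eqP.
rewrite Fe cards1 eqxx andbT.
have e1 := iS _ _ eF (incE1 e).
apply/cards1P; exists (ends e).1; apply/eqP; rewrite eqEsubset sub1set e1 andbT.
apply/subsetP => x xS; rewrite inE; apply: contraT => xe.
have [f] := edge_at _ x e1 xS xe; rewrite Fe => /set1P ->.
by rewrite cut_loop.
Qed.

Lemma nonsep_subP S F : reflect (nsub S F) (nonsep_sub S F).
Proof. by apply: (iffP idP); [apply: nonsep_sub_nsub|apply: nsub_nonsep_sub]. Qed.

Lemma nonsepP : reflect (connected G /\ forall F1 F2 w, F1 :|: F2 = setT ->
   ~ sep1 F1 F2 w) (nonsep G).
Proof.
apply: (iffP (nonsep_subP _ _)) => [[_ S0 cS ns]|[/conn_subP[S0 cS] ns]].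
  by split=> //; apply/conn_subP.
by split=> //; apply/issubP.
Qed.

End Structure.

Lemma setI0_notin (T : finType) (A B : {set T}) x : A :&: B = set0 -> x \in A -> x \notin B.
Proof. by move=> AB xA; apply/negP => xB; have := in_set0 x; rewrite -AB inE xA xB. Qed.

(** * Blocks, embeddings and splits at a vertex *)

Section Blocks.
Variable G : graph.
Implicit Types (x y u v w : V G) (e f : E G) (S A : {set V G}) (F : {set E G}).

Lemma nsub_inc S F x : nsub S F -> F != set0 -> x \in S ->
  exists2 e, e \in F & inc x e.
Proof.
move=> [/issubP iS _ cS _] /set0Pn[e eF] xS.
case: (boolP (inc x e)) => xe; first by exists e.
have e1 := iS _ _ eF (incE1 e).
have [||f fF /cut1 xf] := cS [set x] x _ xS e1; last by exists f.
  by rewrite inE.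
by rewrite inE; apply: contraNneq xe => <-; rewrite incE1.
Qed.

Lemma is_blockP S F : reflect (nsub S F /\ forall S' F', nsub S' F' ->
  S \subset S' -> F \subset F' -> S' = S /\ F' = F) (is_block S F).
Proof.
apply: (iffP andP) => -[/nonsep_subP nSF H].
  split=> // S' F' /nonsep_subP n' sS sF.
  move/forallP: H => /(_ S')/forallP/(_ F'); rewrite n' sS sF /=.
  by move=> /andP[/eqP -> /eqP ->].
split=> //; apply/forallP => S'; apply/forallP => F'; apply/implyP.
by move=> /and3P[/nonsep_subP n' sS sF]; have [-> ->] := H _ _ n' sS sF; rewrite !eqxx.
Qed.

Lemma bnum_nonsep : nonsep G -> [set: E G] != set0 -> bnum G = 1.
Proof.
move=> /nonsep_subP nG E0; rewrite /bnum.
rewrite -(cards1 ([set: V G], [set: E G])); congr #|pred_of_set _|.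
apply/setP => -[S F]; rewrite !inE /=.
apply/andP/eqP => [[/is_blockP[nSF mx] F0]|[-> ->]].
  by have [] := mx _ _ nG (finset.subsetT _) (finset.subsetT _) => -> ->.
split=> //; apply/is_blockP; split=> // S' F' _.
by rewrite !finset.subTset => /eqP -> /eqP ->.
Qed.

Definition vertex_split S1 S2 F1 F2 w :=
  [/\ issub S1 F1, issub S2 F2, S1 :&: S2 = [set w] & S1 :|: S2 = setT] /\
  [/\ F1 :&: F2 = set0, F1 :|: F2 = setT, F1 != set0 & F2 != set0].

Lemma vsplit_sym S1 S2 F1 F2 w : vertex_split S1 S2 F1 F2 w -> vertex_split S2 S1 F2 F1 w.
Proof.
by move=> [[a b c d] [e f g h]]; split; split=> //; rewrite finset.setIC || rewrite finset.setUC.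
Qed.


(** Otherwise the parts of [F] in the two sides would be a 1-separation at [w]. The edges decide
    about the vertices, since each vertex of [S] lies on an edge of [F]. *)
Lemma vsplit_nsub S1 S2 F1 F2 w S F : vertex_split S1 S2 F1 F2 w -> nsub S F -> F != set0 ->
  (F \subset F1 /\ S \subset S1) \/ (F \subset F2 /\ S \subset S2).
Proof.
move=> [[/issubP i1 /issubP i2 S12 _] [F12 FT _ _]] nSF F0.
have FF e : e \in F1 \/ e \in F2.
  by apply/orP; rewrite -in_setU FT inE.
have SS F' S' : F \subset F' -> (forall e x, e \in F' -> inc x e -> x \in S') -> S \subset S'.
  move=> sF iF; apply/fintype.subsetP => x xS.
  by have [e /(fintype.subsetP sF) eF xe] := nsub_inc nSF F0 xS; apply: iF xe.
have [_ _ _ ns] := nSF.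
case: (eqVneq (F :&: F1) set0) => H1.
  have sF: F \subset F2.
    apply/fintype.subsetP => e eF; case: (FF e) => // e1.
    by have := in_set0 e; rewrite -H1 inE eF e1.
  by right; split=> //; apply: SS sF i2.
case: (eqVneq (F :&: F2) set0) => H2.
  have sF: F \subset F1.
    apply/fintype.subsetP => e eF; case: (FF e) => // e1.
    by have := in_set0 e; rewrite -H2 inE eF e1.
  by left; split=> //; apply: SS sF i1.
case: (ns (F :&: F1) (F :&: F2) w).
  by rewrite -finset.setIUr FT finset.setIT.
split=> // [e|x e f].
  by rewrite !inE => /andP[-> /(setI0_notin F12)/negbTE ->].
rewrite !inE => /andP[_ e1] /andP[_ f2] xe xf; apply/eqP.
by rewrite -in_set1 -S12 inE (i1 _ _ e1 xe) (i2 _ _ f2 xf).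
Qed.

End Blocks.

Section Embedding.
Variables (H G : graph) (phi : V H -> V G) (psi : E H -> E G).
Hypotheses (phi_inj : injective phi) (psi_inj : injective psi).
Hypothesis ends_emb : forall e, ends (psi e) = (phi (ends e).1, phi (ends e).2).

Lemma inc_emb x e : inc (phi x) (psi e) = inc x e.
Proof. by rewrite /inc ends_emb /= !(inj_eq phi_inj). Qed.

Lemma cut_emb (A : {set V H}) e : cut (phi @: A) (psi e) = cut A e.
Proof. by rewrite /cut ends_emb /= !mem_imset. Qed.

Lemma cut_preemb (A : {set V G}) e : cut (phi @^-1: A) e = cut A (psi e).
Proof. by rewrite /cut ends_emb /= !inE. Qed.

Lemma nsub_emb S F : nsub S F <-> nsub (phi @: S) (psi @: F).
Proof.
split=> -[/issubP iS S0 cS ns].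
  split.
  - apply/issubP => _ x /imsetP[e eF ->]; rewrite /inc ends_emb /=.
    by move=> /orP[] /eqP <-; rewrite mem_imset //; apply: iS eF _; rewrite ?incE1 ?incE2.
  - by case/set0Pn: S0 => x xS; apply/set0Pn; exists (phi x); rewrite mem_imset.
  - move=> A _ _ /imsetP[x xS ->] /imsetP[y yS ->] xA yA.
    have [||e eF] := cS (phi @^-1: A) x y xS yS; rewrite ?inE //.
    by rewrite cut_preemb; exists (psi e); rewrite ?mem_imset.
  - move=> F1 F2 w F12 [F10 F20 dis sh].
    have pull F' : F' != set0 -> F' \subset psi @: F -> psi @^-1: F' != set0.
      move=> /set0Pn[e eF] /fintype.subsetP/(_ e eF) /imsetP[e' _ ee'].
      by apply/set0Pn; exists e'; rewrite inE -ee'.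
    have F1' : psi @^-1: F1 != set0 by apply: pull => //; rewrite -F12 finset.subsetUl.
    have F2' : psi @^-1: F2 != set0 by apply: pull => //; rewrite -F12 finset.subsetUr.
    (* [w] may lie outside the image of [phi]; then any vertex of [H] serves as [w']. *)
    have [w' ww'] : exists w', forall x, phi x = w -> x = w'.
      case: (pickP (fun x => phi x == w)) => [w' /eqP ww'|no].
        by exists w' => x; rewrite -ww' => /phi_inj.
      case/set0Pn: F1' => e _; exists (ends e).1 => x xw.
      by have := no x; rewrite xw eqxx.
    apply: (ns (psi @^-1: F1) (psi @^-1: F2) w').
      by apply/setP => e; rewrite !inE -in_setU F12 mem_imset.
    split=> // [e|x e f]; rewrite !inE => eF; first exact: dis.
    move=> fF xe xf; apply: ww'.
    by apply: (sh _ _ _ eF fF); rewrite inc_emb.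
split.
- apply/issubP => e x eF xe; rewrite -(mem_imset _ _ phi_inj).
  by apply: (iS (psi e)); rewrite ?mem_imset ?inc_emb.
- by case/set0Pn: S0 => _ /imsetP[x xS _]; apply/set0Pn; exists x.
- move=> A x y xS yS xA yA.
  have [||||f] := cS (phi @: A) (phi x) (phi y); rewrite ?mem_imset //.
  by move=> /imsetP[e eF ->]; rewrite cut_emb; exists e.
- move=> F1 F2 w F12 [F10 F20 dis sh].
  apply: (ns (psi @: F1) (psi @: F2) (phi w)); first by rewrite -imsetU F12.
  split.
  + by case/set0Pn: F10 => e eF; apply/set0Pn; exists (psi e); rewrite mem_imset.
  + by case/set0Pn: F20 => e eF; apply/set0Pn; exists (psi e); rewrite mem_imset.
  + by move=> _ /imsetP[e eF ->]; rewrite mem_imset //; apply: dis.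
  + move=> x _ _ /imsetP[e eF ->] /imsetP[f fF ->] xe xf.
    move: (xe); rewrite /inc ends_emb /= => /orP[] /eqP xx; subst x;
    move: xe xf; rewrite !inc_emb => xe xf; congr phi; exact: sh xe xf.
Qed.
End Embedding.

Section SubgFacts.
Variables (G : graph) (S : {set V G}) (F : {set E G}).
Hypothesis iSF : issub S F.
Let H := subg S F.
Let phi : V H -> V G := val.
Let psi : E H -> E G := val.

Lemma subg_ends (e : E H) : ends (psi e) = (phi (ends e).1, phi (ends e).2).
Proof. exact: surjective_pairing. Qed.

Lemma subg_vset (A : {set V G}) : A \subset S -> phi @: (phi @^-1: A) = A.
Proof.
move=> sA; apply/setP => x; apply/imsetP/idP => [[y]|xA]; first by rewrite inE => yA ->.
by exists (exist _ x (fintype.subsetP sA x xA)); rewrite ?inE.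
Qed.

Lemma subE_in (e : E G) : e \in F -> [&& e \in F, (ends e).1 \in S & (ends e).2 \in S].
Proof.
move=> eF; have iS e' x : e' \in F -> inc x e' -> x \in S by apply/issubP.
by rewrite eF /= (iS e _ eF (incE1 e)) (iS e _ eF (incE2 e)).
Qed.

Lemma psi_in (e : E H) : psi e \in F.
Proof. by case/and3P: (valP e). Qed.

Lemma subg_eset (A : {set E G}) : A \subset F -> psi @: (psi @^-1: A) = A.
Proof.
move=> sA; apply/setP => x; apply/imsetP/idP => [[y]|xA]; first by rewrite inE => yA ->.
by exists (exist _ x (subE_in (fintype.subsetP sA x xA))); rewrite ?inE.
Qed.

Lemma card_subgV : #|V H| = #|S|.
Proof. by rewrite card_sig; apply: eq_card. Qed.

Lemma card_subgE : #|E H| = #|F|.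
Proof.
rewrite card_sig; apply: eq_card => e; rewrite inE.
by apply/idP/idP => [/and3P[]|/subE_in].
Qed.
End SubgFacts.

(** Maximality is the only issue: a non-separable subgraph of [G] that contains a block of one side
    cannot leave that side, by [vsplit_nsub], so it already competes inside the side. *)
Lemma bnum_vsplit_half (G : graph) S1 S2 F1 F2 (w : V G) : vertex_split S1 S2 F1 F2 w ->
  #|[set p : {set V G} * {set E G} | [&& is_block p.1 p.2, p.2 != finset.set0 & p.2 \subset F1]]|
  = bnum (subg S1 F1).
Proof.
move=> sp; have [[i1 i2 _ _] [F12 _ _ _]] := sp.
set H := subg S1 F1.
pose m (p : {set V H} * {set E H}) := (val @: p.1 : {set V G}, val @: p.2 : {set E G}).
have m_inj : injective m.
  move=> [a b] [c d] [/(imset_inj val_inj) -> /(imset_inj val_inj) ->] //.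
rewrite /bnum -(card_imset _ m_inj); congr #|pred_of_set _|; apply/setP => -[S F].
have emb := @nsub_emb H G val val val_inj val_inj (@subg_ends _ S1 F1).
have nz (B : {set E H}) : (val @: B == set0 :> {set E G}) = (B == set0).
  by rewrite -!cards_eq0 card_imset //; apply: val_inj.
apply/idP/imsetP.
  rewrite inE /= => /and3P[/is_blockP[nSF mx] F0 sF].
  have sS : S \subset S1.
    have [[]//|[sF2 _]] := vsplit_nsub sp nSF F0.
    case/set0Pn: F0 => e eF; have := setI0_notin F12 (fintype.subsetP sF e eF).
    by rewrite (fintype.subsetP sF2 e eF).
  have eS := subg_vset F1 sS; have eF := subg_eset i1 sF.
  exists (val @^-1: S, val @^-1: F); last by rewrite /m /= eS eF.
  rewrite inE /= -nz eF F0 andbT; apply/is_blockP; split.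
    by apply/emb; rewrite eS eF.
  move=> S' F' /emb n' sS' sF'.
  have [|| a b] := mx _ _ n'.
  - by rewrite -eS imsetS.
  - by rewrite -eF imsetS.
  by split; apply: (imset_inj val_inj); rewrite ?eS ?eF.
move=> [[A B]]; rewrite inE /=. move=> /andP[/is_blockP[/emb nAB mx] B0] [-> ->].
have sB : val @: B \subset F1.
  by apply/fintype.subsetP => _ /imsetP[e _ ->]; apply: psi_in.
rewrite inE /= nz B0 sB !andbT; apply/is_blockP; split=> // S' F' n' sS sF.
have F'0 : F' != set0.
  by apply: contraNneq B0 => F0; move: sF; rewrite F0 subset0 nz.
have [[sF1 sS1]|[sF2 _]] := vsplit_nsub sp n' F'0; last first.
  case/set0Pn: B0 => e eB; have eB' : val e \in val @: B by rewrite mem_imset //; apply: val_inj.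
  have := setI0_notin F12 (fintype.subsetP sB _ eB').
  by rewrite (fintype.subsetP sF2) // (fintype.subsetP sF).
have eS := subg_vset F1 sS1; have eF := subg_eset i1 sF1.
move: n'; rewrite -eS -eF => /emb n'.
have [||-> ->] // := mx _ _ n'.
  apply/fintype.subsetP => x xA; rewrite inE; apply: (fintype.subsetP sS).
  by rewrite mem_imset //; apply: val_inj.
apply/fintype.subsetP => x xA; rewrite inE; apply: (fintype.subsetP sF).
by rewrite mem_imset //; apply: val_inj.
Qed.

Lemma bnum_vsplit (G : graph) S1 S2 F1 F2 (w : V G) : vertex_split S1 S2 F1 F2 w ->
  bnum G = bnum (subg S1 F1) + bnum (subg S2 F2).
Proof.
move=> sp; rewrite -(bnum_vsplit_half sp) -(bnum_vsplit_half (vsplit_sym sp)).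
have [_ [F12 _ _ _]] := sp.
rewrite -cardsUI [X in _ + X](_ : _ = 0) ?addn0; last first.
  apply: eq_card0 => -[S F]; rewrite !inE /=; apply/negP.
  move=> /andP[/and3P[_ /set0Pn[e eF] /fintype.subsetP s1] /and3P[_ _ /fintype.subsetP s2]].
  by have := setI0_notin F12 (s1 e eF); rewrite s2.
congr #|pred_of_set _|; apply/setP => -[S F]; rewrite !inE /=.
case: (boolP (is_block S F)) => //= /is_blockP[nSF _]; case: eqP => //= /eqP F0.
by have [[->]|[->]] := vsplit_nsub sp nSF F0; rewrite ?orbT.
Qed.

Local Open Scope ring_scope.

(** * Counting nowhere-zero flows over finite fields *)

Section Chains.
Variables (K : finFieldType).

Definition sc (T : finType) (c : K) (b : {ffun T -> K}) : {ffun T -> K} := [ffun x => c * b x].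
Definition dd (T : finType) (u v : T) : {ffun T -> K} := [ffun x => (x == u)%:R - (x == v)%:R].
Definition push (T T' : finType) (phi : T -> T') (b : {ffun T -> K}) : {ffun T' -> K} :=
  [ffun y => \sum_(x | phi x == y) b x].

Lemma sc_inj T c : c != 0 -> injective (@sc T c).
Proof.
move=> c0 a b /ffunP ab; apply/ffunP => x; have := ab x; rewrite !ffunE.
exact: (mulfI c0).
Qed.

Lemma sc0 T b : @sc T 0 b = 0.
Proof. by apply/ffunP => x; rewrite !ffunE mul0r. Qed.
Lemma scx0 T c : @sc T c 0 = 0.
Proof. by apply/ffunP => x; rewrite !ffunE mulr0. Qed.
Lemma sc1 T b : @sc T 1 b = b.
Proof. by apply/ffunP => x; rewrite !ffunE mul1r. Qed.
Lemma scN T c b : @sc T (- c) b = - sc c b.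
Proof. by apply/ffunP => x; rewrite !ffunE mulNr. Qed.
Lemma scD T c c' b : @sc T (c + c') b = sc c b + sc c' b.
Proof. by apply/ffunP => x; rewrite !ffunE mulrDl. Qed.
Lemma ddxx (T : finType) (u : T) : dd u u = 0.
Proof. by apply/ffunP => x; rewrite !ffunE subrr. Qed.

Variable G : graph.
Implicit Types (b c : {ffun V G -> K}) (f g : {ffun E G -> K}) (F : {set E G}).

Definition bd (e : E G) := dd (ends e).1 (ends e).2.
Definition excess f : {ffun V G -> K} := [ffun x => \sum_e f e * bd e x].
Definition suppE F f := [forall e, (f e != 0) == (e \in F)].
(** Nowhere-zero flows on [F] are the case [b = 0]. Prescribing the support keeps the chains of all
    subgraphs in one type, and a general [b] records what the two sides of a separation exchange. *)
Definition flow_count F b : nat := \sum_(f | suppE F f) (excess f == b).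

Lemma excD f g : excess (f + g) = excess f + excess g.
Proof.
by apply/ffunP => x; rewrite !ffunE -big_split /=; apply: eq_bigr => e _; rewrite ffunE mulrDl.
Qed.

Lemma excess_sc t f : excess (sc t f) = sc t (excess f).
Proof.
by apply/ffunP => x; rewrite !ffunE mulr_sumr; apply: eq_bigr => e _; rewrite ffunE mulrA.
Qed.

Lemma excess_sum f (S : {set V G}) : \sum_(x in S) excess f x =
  \sum_e f e * (((ends e).1 \in S)%:R - ((ends e).2 \in S)%:R).
Proof.
under eq_bigr do rewrite ffunE.
rewrite exchange_big /=; apply: eq_bigr => e _; rewrite -mulr_sumr; congr (_ * _).
under eq_bigr do rewrite ffunE.
have one z : \sum_(x in S) ((x == z)%:R : K) = (z \in S)%:R.
  case: (boolP (z \in S)) => zS.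
    rewrite (bigD1 z) //= eqxx big1 ?addr0 // => x /andP[_ /negbTE ->] //.
  by rewrite big1 // => x xS; case: eqP => // xz; rewrite -xz xS in zS.
by rewrite sumrB !one.
Qed.

Lemma suppEP F f : reflect (forall e, (f e != 0) = (e \in F)) (suppE F f).
Proof. by apply: (iffP forallP) => H e; [exact: (eqP (H e))|rewrite H]. Qed.

(** A chain on a disjoint union is the sum of its two restrictions, and excesses add. *)
Lemma flow_count_conv F1 F2 b : F1 :&: F2 = finset.set0 ->
  flow_count (F1 :|: F2) b = (\sum_c flow_count F1 c * flow_count F2 (b - c)%R)%N.
Proof.
move=> F12.
have RHS : (\sum_c flow_count F1 c * flow_count F2 (b - c)%R =
  \sum_(fg : {ffun E G -> K} * {ffun E G -> K} | suppE F1 fg.1 && suppE F2 fg.2)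
    ((excess fg.1 + excess fg.2)%R == b))%N.
  rewrite -(pair_big (suppE F1) (suppE F2) (fun f g => ((excess f + excess g)%R == b) : nat)) /=.
  under eq_bigr do rewrite /flow_count big_distrlr /=.
  rewrite exchange_big /=; apply: eq_bigr => f _.
  rewrite exchange_big /=; apply: eq_bigr => g _.
  rewrite (bigD1 (excess f)) //= eqxx mul1n big1 ?addn0.
    by congr nat_of_bool; rewrite eq_sym subr_eq eq_sym addrC.
  by move=> c; rewrite eq_sym => /negbTE ->.
rewrite RHS /flow_count.
pose r F (h : {ffun E G -> K}) := [ffun e => if e \in F then h e else 0] : {ffun E G -> K}.
rewrite (reindex_onto (fun fg : {ffun E G -> K} * {ffun E G -> K} => fg.1 + fg.2)
   (fun h => (r F1 h, r F2 h))) /=; last first.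
  move=> h /suppEP sh; apply/ffunP => e; rewrite !ffunE.
  have := sh e; rewrite inE; case: (boolP (e \in F1)) => e1 /=.
    by rewrite (negbTE (setI0_notin F12 e1)) addr0.
  by case: (e \in F2); rewrite add0r // => /negbFE/eqP.
apply: eq_big => [[f g]|[f g] _] /=; last by rewrite excD.
apply/andP/andP.
  move=> [/suppEP sh /eqP[hf hg]]; split; apply/suppEP => e.
    have := sh e; move/ffunP/(_ e): hf; move/ffunP/(_ e): hg; rewrite !ffunE inE.
    case: (boolP (e \in F1)) => e1 /=; last by move=> _ <-; rewrite eqxx.
    by rewrite (negbTE (setI0_notin F12 e1)) => <- _; rewrite addr0.
  have := sh e; move/ffunP/(_ e): hf; move/ffunP/(_ e): hg; rewrite !ffunE inE.
  case: (boolP (e \in F1)) => e1 /=; last first.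
    by case: (e \in F2) => [_ <-|<- _]; rewrite ?add0r ?eqxx.
  by rewrite (negbTE (setI0_notin F12 e1)) => <-; rewrite eqxx.
move=> [/suppEP sf /suppEP flow_sign].
have f0 e : e \notin F1 -> f e = 0 by rewrite -sf => /negbNE/eqP.
have g0 e : e \notin F2 -> g e = 0 by rewrite -flow_sign => /negbNE/eqP.
split.
  apply/suppEP => e; rewrite ffunE inE; case: (boolP (e \in F1)) => e1 /=.
    by rewrite (g0 e) ?addr0 ?sf // (setI0_notin F12).
  by rewrite (f0 e) // add0r flow_sign.
apply/eqP; congr pair; apply/ffunP => e; rewrite !ffunE.
  case: ifPn => e1; last by rewrite f0.
  by rewrite (g0 e) ?addr0 // (setI0_notin F12).
case: ifPn => e2; last by rewrite g0.
rewrite f0 ?add0r //; apply: contraL e2; exact: setI0_notin.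
Qed.

(** Multiplication by [t] permutes the chains supported on [F]. All non-zero multiples of a given
    excess therefore have the same count, which is the source of the factors [#|K|.-1] below. *)
Lemma flow_count_scale F t b : t != 0 -> flow_count F (sc t b) = flow_count F b.
Proof.
move=> t0; rewrite /flow_count (reindex_inj (sc_inj t0)) /=.
apply: eq_big => [f|f _]; last by rewrite excess_sc (inj_eq (sc_inj t0)).
apply/suppEP/suppEP => H e; rewrite -H !ffunE mulf_eq0 (negbTE t0) //.
Qed.

Lemma flow_count_set1 e b : flow_count [set e] b = (\sum_(t : K | t != 0%R) (sc t (bd e) == b))%N.
Proof.
rewrite /flow_count (reindex_onto (fun t => [ffun e' => if e' == e then t else 0] : {ffun E G -> K})
   (fun f => f e)) /=; last first.
  move=> f /suppEP sf; apply/ffunP => e'; rewrite ffunE; case: eqP => [->//|/eqP ne].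
  by apply/esym/eqP; apply/negPn; rewrite sf inE.
apply: eq_big => [t|t _].
  rewrite ffunE eqxx eqxx andbT; apply/suppEP/idP => [/(_ e)|t0 e'].
    by rewrite ffunE inE eqxx.
  by rewrite ffunE inE; case: (e' == e); rewrite ?t0 ?eqxx.
congr (nat_of_bool (_ == _)); apply/ffunP => x; rewrite !ffunE (bigD1 e) //= ffunE eqxx.
by rewrite big1 ?addr0 ?ffunE // => e' /negbTE ne; rewrite !ffunE ne mul0r.
Qed.

Lemma flow_count_edge e F b : e \notin F ->
  flow_count (e |: F) b = (\sum_(t : K | t != 0%R) flow_count F (b - sc t (bd e))%R)%N.
Proof.
move=> eF; rewrite flow_count_conv; last first.
  by apply/setP => x; rewrite !inE; case: eqP => // ->; rewrite (negbTE eF).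
under eq_bigr do rewrite flow_count_set1 big_distrl /=.
rewrite exchange_big /=; apply: eq_bigr => t _.
rewrite (bigD1 (sc t (bd e))) //= eqxx mul1n big1 ?addn0 // => c.
by rewrite eq_sym => /negbTE ->.
Qed.

Lemma sum_nz (n : nat) : (\sum_(t : K | t != 0%R) n = #|K|.-1 * n)%N.
Proof.
rewrite sum_nat_const; congr (_ * _)%N.
have := cardC (pred1 (0 : K)); rewrite card1 add1n => <-.
by rewrite succnK; apply: eq_card => x; rewrite !inE.
Qed.

Lemma flow_count_edge0 e F : e \notin F -> flow_count (e |: F) 0 = (#|K|.-1 * flow_count F (bd e))%N.
Proof.
move=> eF; rewrite flow_count_edge // -sum_nz; apply: eq_bigr => t t0.
by rewrite sub0r -scN flow_count_scale // oppr_eq0.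
Qed.

(** Only the total [s] through the parallel pair matters. With q elements in the field, 0 is a sum
    of two non-zero elements in q - 1 ways, and any other [s] in q - 2 ways. *)
Lemma flow_count_par e e' F b : e \notin F -> e' \notin F -> e != e' -> bd e' = bd e ->
  flow_count (e |: (e' |: F)) b =
  (\sum_(s : K) (if s == 0%R then #|K|.-1 else #|K|.-2) * flow_count F (b - sc s (bd e))%R)%N.
Proof.
move=> eF eF' ne bb; rewrite flow_count_edge ?inE ?(negbTE ne) //.
under eq_bigr => t _.
  rewrite flow_count_edge // bb (reindex_inj (addIr (- t))) /=.
  under eq_bigr do rewrite -addrA -opprD -scD [t + _]addrC subrK.
  over.
rewrite (exchange_big_dep predT) //=; apply: eq_bigr => s _.
rewrite sum_nat_const; congr (_ * _)%N.
have -> : #|[pred t : K | (t != 0) && (s - t != 0)]| = #|[predC pred2 (0 : K) s]|.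
  by apply: eq_card => t; rewrite !inE negb_or subr_eq0 (eq_sym s).
have := cardC (pred2 (0 : K) s); rewrite card2 (eq_sym 0).
by case: (s == 0) => /= <-.
Qed.

Lemma flow_count_sum0 F b S : flow_count F b != 0%N -> (forall e, e \in F -> ~~ cut S e) ->
  \sum_(x in S) b x = 0.
Proof.
move=> nz nc; have : exists2 f, suppE F f & excess f = b.
  apply: contrapT => H; case/negP: nz; rewrite /flow_count big1 // => f sf.
  by case: eqP => // ef; case: H; exists f.
move=> [f /suppEP sf <-]; rewrite excess_sum big1 // => e _.
case: (boolP (e \in F)) => eF.
  by have := nc e eF; rewrite /cut negbK => /eqP ->; rewrite subrr mulr0.
by move: eF; rewrite -sf => /negbNE/eqP ->; rewrite mul0r.
Qed.

Lemma flow_count_supp F b x : flow_count F b != 0%N -> (forall e, e \in F -> ~~ inc x e) -> b x = 0.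
Proof.
move=> nz ni; have <- : \sum_(y in [set x]) b y = b x by rewrite big_set1.
by apply: flow_count_sum0 nz _ => e eF; apply: contra (ni e eF) => /cut1.
Qed.

Lemma flow_count_total F b : flow_count F b != 0%N -> \sum_x b x = 0.
Proof.
move=> nz; rewrite -[RHS](@flow_count_sum0 F b [set: V G]) //.
  by apply: eq_bigl => x; rewrite inE.
by move=> e _; rewrite /cut !inE.
Qed.

(** The excess summed over [S] is, up to sign, the value on the only crossing edge, which is not
    zero. *)
Lemma flow_count_cut1 F S e : e \in F -> cut S e -> (forall e', e' \in F -> cut S e' -> e' = e) ->
  flow_count F 0 = 0%N.
Proof.
move=> eF ce uni; rewrite /flow_count big1 // => f /suppEP sf; case: eqP => // ef.
have := excess_sum f S; rewrite ef big1; last by move=> x _; rewrite ffunE.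
rewrite (bigD1 e) //= big1 ?addr0 => [/esym/eqP|e' ne].
  rewrite mulf_eq0 -[f e == 0]negbK sf eF /= subr_eq0; move: ce; rewrite /cut.
  by do 2 case: (_ \in S); rewrite //= ?oner_eq0 // eq_sym oner_eq0.
case: (boolP (e' \in F)) => e'F; last first.
  by move: e'F; rewrite -sf => /negbNE/eqP ->; rewrite mul0r.
case: (boolP (cut S e')) => [/(uni _ e'F) e'e|]; first by rewrite e'e eqxx in ne.
by rewrite /cut negbK => /eqP ->; rewrite subrr mulr0.
Qed.

End Chains.

Lemma push_val (K : finFieldType) (T T' : finType) (phi : T -> T') (f : {ffun T -> K}) x :
  injective phi -> push phi f (phi x) = f x.
Proof.
move=> phi_inj; rewrite ffunE (bigD1 x) //= big1 ?addr0 // => y /andP[/eqP/phi_inj ->].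
by rewrite eqxx.
Qed.

Section PushE.
Variables (K : finFieldType) (H G : graph) (psi : E H -> E G).
Hypothesis psi_inj : injective psi.

Lemma push_out f e : e \notin psi @: [set: E H] -> @push K _ _ psi f e = 0.
Proof.
move=> ne; rewrite ffunE big1 // => e' /eqP ee; case/negP: ne.
by rewrite -ee mem_imset // inE.
Qed.

Lemma sum_supp_push (F : {set E H}) (g : {ffun E G -> K} -> nat) :
  (\sum_(f | suppE (psi @: F) f) g f = \sum_(f | suppE F f) g (push psi f))%N.
Proof.
rewrite (reindex_onto (push psi) (fun f : {ffun E G -> K} => [ffun e => f (psi e)])) /=.
  apply: eq_bigl => f; apply/andP/idP.
    move=> [/suppEP sf _]; apply/suppEP => e.
    by have := sf (psi e); rewrite push_val // mem_imset.
  move=> /suppEP sf; split; last first.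
    by apply/eqP/ffunP => e; rewrite ffunE push_val //.
  apply/suppEP => e; case: (boolP (e \in psi @: [set: E H])) => [/imsetP[e' _ ->]|ne].
    by rewrite push_val // mem_imset.
  rewrite push_out // eqxx; apply/esym; apply: contraNF ne; apply/fintype.subsetP.
  by apply: imsetS; apply/fintype.subsetP => z; rewrite inE.
move=> f /suppEP sf; apply/ffunP => e.
case: (boolP (e \in psi @: [set: E H])) => [/imsetP[e' _ ->]|ne].
  by rewrite push_val // ffunE.
rewrite push_out //; apply/esym/eqP; apply: contraNT ne; rewrite sf; apply/fintype.subsetP.
by apply: imsetS; apply/fintype.subsetP => z; rewrite inE.
Qed.

Lemma big_push f (h : E G -> K) :
  \sum_e push psi f e * h e = \sum_e f e * h (psi e).
Proof.
under eq_bigr do rewrite ffunE big_distrl /=.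
rewrite (exchange_big_dep predT) //=; apply: eq_bigr => e _.
by rewrite (big_pred1 (psi e)) // => x; rewrite /= eq_sym.
Qed.

Lemma push_dd (T T' : finType) (phi : T -> T') u v :
  push phi (dd K u v) = dd K (phi u) (phi v).
Proof.
apply/ffunP => y; rewrite !ffunE.
under eq_bigr do rewrite ffunE.
have one z : \sum_(x | phi x == y) ((x == z)%:R : K) = (y == phi z)%:R.
  case: (eqVneq y (phi z)) => [->|ne].
    by rewrite (bigD1 z) //= eqxx big1 ?addr0 // => x /andP[_ /negbTE ->].
  by rewrite big1 // => x /eqP xy; case: eqP => // xz; rewrite -xy xz eqxx in ne.
by rewrite sumrB !one.
Qed.

Lemma push_sum (T T' : finType) (phi : T -> T') (I : finType) (P : pred I) (F : I -> {ffun T -> K}) :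
  push phi [ffun x => \sum_(i | P i) F i x] = [ffun y => \sum_(i | P i) push phi (F i) y].
Proof.
apply/ffunP => y; rewrite !ffunE; under eq_bigr do rewrite ffunE.
by rewrite exchange_big /=; apply: eq_bigr => i _; rewrite ffunE.
Qed.

Lemma push_sc (T T' : finType) (phi : T -> T') t b :
  @push K _ _ phi (sc t b) = sc t (push phi b).
Proof.
apply/ffunP => y; rewrite !ffunE mulr_sumr; apply: eq_bigr => i _; by rewrite ffunE.
Qed.

Lemma push_exc (GG : graph) (T' : finType) (phi : V GG -> T') (f : {ffun E GG -> K}) :
  push phi (excess f) = [ffun y => \sum_e f e * dd K (phi (ends e).1) (phi (ends e).2) y].
Proof.
have -> : excess f = [ffun x => \sum_e sc (f e) (bd K e) x].
  by apply/ffunP => x; rewrite !ffunE; apply: eq_bigr => e _; rewrite [RHS]ffunE.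
rewrite push_sum; apply/ffunP => y; rewrite !ffunE; apply: eq_bigr => e _.
by rewrite push_sc push_dd [LHS]ffunE.
Qed.

Lemma flow_count_push (phi : V H -> V G) (F : {set E H}) c :
  (forall e, ends (psi e) = (phi (ends e).1, phi (ends e).2)) ->
  flow_count (psi @: F) c = (\sum_(b | @push K _ _ phi b == c) flow_count F b)%N.
Proof.
move=> eP; rewrite /flow_count sum_supp_push exchange_big /=; apply: eq_bigr => f _.
have -> : excess (push psi f) = push phi (excess f).
  rewrite push_exc; apply/ffunP => y; rewrite !ffunE big_push.
  by apply: eq_bigr => e _; rewrite /bd eP /=.
case: eqP => ec; last by rewrite big1 // => b /eqP bc; case: eqP => // fb; rewrite fb bc in ec.
rewrite (bigD1 (excess f)) ?ec //= eqxx big1 // => b /andP[_].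
by rewrite eq_sym => /negbTE ->.
Qed.

(** Vertices go forward along [phi] and edges back along [psi]: identifying vertices keeps the chain
    and adds up its excess over each fibre. *)
Lemma flow_count_quo (phi : V G -> V H) (F : {set E H}) c :
  (forall e, ends e = (phi (ends (psi e)).1, phi (ends (psi e)).2)) ->
  flow_count F c = (\sum_(b | @push K _ _ phi b == c) flow_count (psi @: F) b)%N.
Proof.
move=> eP; rewrite /flow_count exchange_big /= sum_supp_push; apply: eq_bigr => f _.
have -> : excess f = push phi (excess (push psi f)).
  rewrite push_exc; apply/ffunP => y; rewrite !ffunE big_push.
  by apply: eq_bigr => e _; rewrite /bd eP /=.
case: eqP => ec; last by rewrite big1 // => b /eqP bc; case: eqP => // fb; rewrite fb bc in ec.
rewrite (bigD1 (excess (push psi f))) ?ec //= eqxx big1 // => b /andP[_].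
by rewrite eq_sym => /negbTE ->.
Qed.

End PushE.

(** A common interface to [identify], whose type depends on deciding [u = v], and to [contract],
    which identifies after a deletion. [F] is the set of surviving edges: all of them for an
    identification, all but the contracted one for a contraction. *)
Record quotient (G H : graph) (phi : V G -> V H) (psi : E H -> E G) (u v : V G) (F : {set E G}) : Prop := Quo {
  quo_surj : forall y, exists x, phi x = y;
  quo_inj : injective psi;
  quo_img : psi @: finset.setT = F;
  quo_ends : forall e, ends e = (phi (ends (psi e)).1, phi (ends (psi e)).2);
  quo_ker : forall x y, (phi x == phi y) =
     [|| x == y, (x == u) && (y == v) | (x == v) && (y == u)] }.

Lemma identify_spec (G : graph) (u v : V G) : u != v ->
  exists (phi : V G -> V (identify u v)) (psi : E (identify u v) -> E G),
    quotient phi psi u v finset.setT.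
Proof.
move=> nuv.
suff gen b (r : reflect (u = v) b) : exists phi psi, @quotient G
    (match r with ReflectT _ => G | ReflectF h =>
      @Graph ({y : V G | y != v} : finType) (E G)
        (fun e => (idmap (introN eqP h) (ends e).1, idmap (introN eqP h) (ends e).2)) end)
    phi psi u v finset.setT.
  exact: gen.
case: r => uv; first by rewrite uv eqxx in nuv.
exists (idmap (introN eqP uv)), id; split=> //=.
- move=> y; exists (val y); apply: val_inj; rewrite /idmap val_insubd.
  by case: y => y /= ->.
- by rewrite imset_id.
- move=> x y; rewrite -val_eqE /= /idmap !val_insubd /=.
  case: (eqVneq x v) => [->|xv] /=; case: (eqVneq y v) => [->|yv] /=; rewrite ?eqxx ?andbF ?andbT //=.
  all: rewrite ?eqxx ?(negbTE xv) ?(negbTE yv) ?(eq_sym v y) ?(negbTE yv) ?andbT ?andbF ?orbF //=.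
Qed.

Lemma contract_spec (G : graph) (e : E G) : ~~ is_loop e ->
  exists (phi : V G -> V (contract e)) (psi : E (contract e) -> E G),
    quotient phi psi (ends e).1 (ends e).2 (finset.setT :\ e).
Proof.
move=> nl; have [phi [psi [sj ij im en ke]]] := @identify_spec (delete e) _ _ nl.
exists phi, (fun e' => val (psi e')); split=> //.
- by move=> a b /val_inj /ij.
- rewrite (imset_comp val psi) im; apply/setP => f; rewrite !inE andbT.
  apply/imsetP/idP => [[g _ ->]|fe]; first exact: (valP g).
  by exists (exist _ f fe).
Qed.

(** * Flow polynomials *)

Section Counts.
Variable K : finFieldType.
Local Notation NF := (@flow_count K _).
Local Notation dd := (dd K).

Lemma sum_KD (g : K -> nat) : (\sum_t g t = g 0%R + \sum_(t | t != 0%R) g t)%N.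
Proof. by rewrite (bigD1 0). Qed.


(** Turns a sum over all excesses into one over the field, whenever only excesses living on [u] and
    [v] with total 0 contribute. *)
Lemma sum_line (T : finType) (u v : T) (P : pred {ffun T -> K}) (g : {ffun T -> K} -> nat) :
  u != v -> (forall b, P b -> g b != 0%N -> exists t, b = sc t (dd u v)) ->
  (forall t, P (sc t (dd u v))) ->
  (\sum_(b | P b) g b = \sum_t g (sc t (dd u v)))%N.
Proof.
move=> uv H Pt.
rewrite (bigID (fun b => b \in codom (fun t : K => sc t (dd u v)))) /= addnC big1; last first.
  move=> b /andP[Pb nb]; apply/eqP; apply: contraNT nb => /(H b Pb)[t ->].
  exact: codom_f.
rewrite add0n.
rewrite (reindex_onto (fun t => sc t (dd u v)) (fun b => b u)) /=; last first.
  move=> b /andP[_ /codomP[t ->]].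
  by rewrite !ffunE eqxx (negbTE uv) subr0 mulr1.
apply: eq_bigl => t; rewrite /= Pt !ffunE eqxx (negbTE uv) subr0 mulr1 eqxx andbT /=.
exact: (codom_f (fun t : K => sc t (dd u v))).
Qed.

(** A chain becomes a flow after identification when its excess is [t] times [dd u v]; [t = 0] gives
    the flows that exist before, and all other [t] count alike. *)
Lemma flow_count_quo0 (G H : graph) (phi : V G -> V H) psi (u v : V G) F :
  quotient phi psi u v F -> u != v ->
  (NF finset.setT (0%R : {ffun V H -> K}) = NF F 0%R + #|K|.-1 * NF F (dd u v))%N.
Proof.
move=> q uv; rewrite (flow_count_quo (quo_inj q) _ _ (quo_ends q)) (quo_img q).
rewrite (@sum_line _ u v) //.
- rewrite sum_KD sc0; congr (_ + _)%N; rewrite -sum_nz; apply: eq_bigr => t t0.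
  exact: flow_count_scale.
- move=> b /eqP/ffunP pb _; exists (b u); apply/ffunP => x; rewrite !ffunE.
  have pbx y := pb (phi y); have {}pbx y : \sum_(z | phi z == phi y) b z = 0.
    by have := pbx y; rewrite !ffunE.
  have ker := quo_ker q.
  case: (eqVneq x u) => [->|xu]; first by rewrite (negbTE uv) subr0 mulr1.
  case: (eqVneq x v) => [->|xv].
    have := pbx u; rewrite (bigD1 u) //= (bigD1 v) /=; last first.
      by rewrite ker !eqxx !orbT eq_sym uv.
    rewrite big1 ?addr0 => [/eqP|y]; last first.
      by rewrite ker => /andP[/andP[K3 yu] yv]; move: K3; rewrite (negbTE yu) (negbTE yv).
    by rewrite addr_eq0 => /eqP ->; rewrite sub0r mulrN1 opprK.
  rewrite subrr mulr0; have := pbx x; rewrite (big_pred1 x) // => y.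
  by rewrite /= ker (negbTE xu) (negbTE xv) !andbF !orbF.
- move=> t; rewrite push_sc push_dd; apply/eqP.
  have -> : phi u = phi v by apply/eqP; rewrite (quo_ker q) !eqxx !orbT.
  by rewrite ddxx scx0.
Qed.

Section Emb.
Variables (H G : graph) (phi : V H -> V G) (psi : E H -> E G).
Hypotheses (phi_inj : injective phi) (psi_inj : injective psi).
Hypothesis ends_emb : forall e, ends (psi e) = (phi (ends e).1, phi (ends e).2).

Lemma flow_count_emb (F : {set E H}) b : NF (psi @: F) (push phi b) = NF F b.
Proof.
rewrite (flow_count_push psi_inj _ _ ends_emb) (big_pred1 b) // => c.
apply/eqP/eqP => [/ffunP pc|-> //]; apply/ffunP => x; have := pc (phi x).
by rewrite !push_val.
Qed.

Lemma flow_count_emb0 (F : {set E H}) : NF (psi @: F) 0 = NF F 0.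
Proof.
rewrite -(flow_count_emb F); congr NF; apply/ffunP => x; rewrite !ffunE big1 // => y _.
by rewrite ffunE.
Qed.

Lemma flow_count_embd (F : {set E H}) u v : NF (psi @: F) (dd (phi u) (phi v)) = NF F (dd u v).
Proof. by rewrite -(flow_count_emb F) push_dd. Qed.
End Emb.

Lemma delete_img (G : graph) (e : E G) :
  (val : E (delete e) -> E G) @: finset.setT = finset.setT :\ e.
Proof.
apply/setP => f; rewrite !inE andbT.
apply/imsetP/idP => [[g _ ->]|fe]; first exact: (valP g).
by exists (exist _ f fe).
Qed.

Lemma flow_count_delete (G : graph) (e : E G) :
  NF finset.setT (0%R : {ffun V (delete e) -> K}) = NF (finset.setT :\ e) (0%R : {ffun V G -> K}).
Proof.
rewrite -delete_img (@flow_count_emb0 (delete e) G id val) //; first exact: val_inj.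
by move=> f; apply: surjective_pairing.
Qed.

Lemma setT_D1 (T : finType) (e : T) : finset.setT = e |: (finset.setT :\ e).
Proof. by rewrite setD1K // inE. Qed.

Lemma flow_count_setTE (G : graph) (e : E G) :
  (NF finset.setT (0%R : {ffun V G -> K}) = #|K|.-1 * NF (finset.setT :\ e) (bd K e))%N.
Proof. by rewrite {1}(setT_D1 e) flow_count_edge0 // !inE eqxx. Qed.

Lemma flow_count_dc (G : graph) (e : E G) : ~~ is_loop e ->
  (NF finset.setT (0%R : {ffun V (contract e) -> K}) =
   NF finset.setT (0%R : {ffun V G -> K}) + NF finset.setT (0%R : {ffun V (delete e) -> K}))%N.
Proof.
move=> nl; have [phi [psi q]] := contract_spec nl.
by rewrite (flow_count_quo0 q nl) (flow_count_setTE e) flow_count_delete addnC.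
Qed.

Lemma flow_count_loop (G : graph) (e : E G) : is_loop e ->
  (NF finset.setT (0%R : {ffun V G -> K}) =
   #|K|.-1 * NF finset.setT (0%R : {ffun V (delete e) -> K}))%N.
Proof.
by move=> /eqP l; rewrite (flow_count_setTE e) flow_count_delete /bd l ddxx.
Qed.

Lemma flow_count_empty (G : graph) : NF (finset.set0 : {set E G}) (0%R : {ffun V G -> K}) = 1%N.
Proof.
rewrite /flow_count (big_pred1 (0 : {ffun E G -> K})) => [|f].
  suff -> : excess (0%R : {ffun E G -> K}) = 0 by rewrite eqxx.
  by apply/ffunP => x; rewrite !ffunE big1 // => e _; rewrite ffunE mul0r.
apply/suppEP/eqP => [H|->] ; last by move=> e; rewrite ffunE eqxx inE.
by apply/ffunP => e; rewrite ffunE; apply/eqP; apply/negPn; rewrite H inE.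
Qed.

Lemma flow_count_bridge (G : graph) : has_bridge G -> NF finset.setT (0%R : {ffun V G -> K}) = 0%N.
Proof.
move=> /existsP[e /is_bridgeP[S HS]].
apply: (@flow_count_cut1 _ _ _ S e); rewrite ?inE ?HS //.
by move=> f _; rewrite HS => /eqP.
Qed.

End Counts.

Definition flow_number p G : nat := @flow_count 'F_p G finset.setT 0.

Lemma card_delete (G : graph) (e : E G) : #|E G| = #|E (delete e)|.+1.
Proof. 
rewrite /= card_sig; have := cardC (pred1 e); rewrite card1 => <-.
by congr _.+1; apply: eq_card => x; rewrite !inE.
Qed.

Lemma card_contractE (G : graph) (e : E G) : #|E G| = #|E (contract e)|.+1.
Proof.
rewrite (card_delete e) /contract /identify.
suff gen b (r : reflect ((ends e).1 = (ends e).2) b) : #|E (delete e)| =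
    #|E (match r with ReflectT _ => delete e | ReflectF h =>
      @Graph ({y : V (delete e) | y != (ends e).2} : finType) (E (delete e))
        (fun f => (idmap (introN eqP h) (ends f).1, idmap (introN eqP h) (ends f).2)) end)|.
  by rewrite -gen.
by case: r.
Qed.

(** The number of nowhere-zero flows obeys every rule of the recursion, whichever edge is picked;
    this makes the value independent of the picks. *)
Lemma flowp_fuelE p n G : prime p -> (#|E G| < n)%N ->
  (flowp_fuel n G).[p%:R] = (flow_number p G)%:R.
Proof.
move=> pp; elim: n G => // n IH G; rewrite ltnS => En /=.
case: ifPn => [hb|_]; first by rewrite horner0 /flow_number flow_count_bridge.
have pE : (p%:R - 1 : int) = (#|'F_p|.-1)%:R.
  by rewrite card_Fp // -subn1 natrB // prime_gt0.
case: pickP => [e _|no].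
  have dE := card_delete e; have cE := card_contractE e.
  case: ifPn => l.
    rewrite hornerM !hornerE IH; last by rewrite -ltnS -dE.
    by rewrite pE -natrM /flow_number (@flow_count_loop 'F_p _ _ l).
  rewrite hornerD hornerN !IH; [|by rewrite -ltnS -dE|by rewrite -ltnS -cE].
  by rewrite /flow_number (@flow_count_dc 'F_p _ _ l) natrD addrK.
rewrite hornerC /flow_number.
have -> : finset.setT = finset.set0 :> {set E G} by apply/setP => e; have := no e.
by rewrite flow_count_empty.
Qed.

Lemma flowpolyE p G : prime p -> (flowpoly G).[p%:R] = (flow_number p G)%:R.
Proof. by move=> pp; apply: flowp_fuelE. Qed.

(** The route by which identities between flow polynomials are proved: there are infinitely many
    primes, so comparing flow counts over all ['F_p] suffices. *)
Lemma poly_eq_primes (P Q : {poly int}) :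
  (forall p, prime p -> P.[p%:R] = Q.[p%:R]) -> P = Q.
Proof.
move=> H; apply/eqP; rewrite -subr_eq0; apply/eqP.
have ex n : exists s : seq nat, [/\ size s = n, uniq s & all prime s].
  elim: n => [|n [s [ss us ps]]]; first by exists [::].
  have [p ps' pp] := prime_above (\max_(i <- s) i).
  exists (p :: s); split=> /=; rewrite ?ss ?us ?pp ?andbT //.
  apply/negP => pin; have := @leq_bigmax_seq _ s xpredT id p pin isT.
  by rewrite leqNgt ps'.
have [s [ss us ps]] := ex (size (P - Q)).
apply: (@roots_geq_poly_eq0 _ _ [seq i%:R | i <- s]).
- apply/allP => _ /mapP[i is_ ->]; rewrite /root hornerD hornerN H ?subrr //.
  exact: (allP ps).
- by rewrite map_inj_uniq // => i j /eqP; rewrite eqr_nat => /eqP.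
- by rewrite size_map ss.
Qed.

Lemma predpE p : prime p -> ((#|'F_p|.-1)%:R = p%:R - 1 :> int).
Proof. by move=> pp; rewrite card_Fp // -subn1 natrB // prime_gt0. Qed.

Lemma predp2E p : prime p -> ((#|'F_p|.-2)%:R = p%:R - 2 :> int).
Proof. by move=> pp; rewrite card_Fp // -subn2 natrB // prime_gt1. Qed.

(** * Flow counts of glued graphs and of graphs with added edges *)

Definition addedge (G : graph) (u v : V G) : graph :=
  @Graph (V G) (option (E G) : finType) (fun o => if o is Some e then ends e else (u, v)).

Section CountOps.
Variable K : finFieldType.
Local Notation NF := (@flow_count K _).
Local Notation dd := (dd K).

Lemma Some_img (G : graph) (u v : V G) :
  finset.setT = (None : E (addedge u v)) |: ((Some : E G -> E (addedge u v)) @: finset.setT).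
Proof.
apply/setP => -[e|]; rewrite !inE //=.
by apply/esym/(imset_f Some); rewrite inE.
Qed.

Lemma None_img (G : graph) (u v : V G) (F : {set E G}) :
  (None : E (addedge u v)) \notin ((Some : E G -> E (addedge u v)) @: F).
Proof. by apply/imsetP => -[]. Qed.

Lemma addedge_ends (G : graph) (u v : V G) (e : E G) :
  ends (Some e : E (addedge u v)) = (id (ends e).1, id (ends e).2).
Proof. exact: surjective_pairing. Qed.

Lemma Some_inj (T : Type) : injective (@Some T). Proof. by move=> a b []. Qed.

Lemma flow_count_addedge (G : graph) (u v : V G) :
  (NF finset.setT (0%R : {ffun V (addedge u v) -> K}) =
   #|K|.-1 * NF finset.setT (dd u v : {ffun V G -> K}))%N.
Proof.
rewrite (Some_img u v) flow_count_edge0 ?None_img //; congr (_ * _)%N.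
exact: (@flow_count_embd K G (addedge u v) id Some (@inj_id _) (@Some_inj _) (@addedge_ends G u v)).
Qed.

(** The excess that one side passes to the other lives on [w] alone and has total 0, so it
    vanishes. *)
Lemma flow_count_glue1 (G : graph) (F1 F2 : {set E G}) (w : V G) :
  F1 :&: F2 = finset.set0 -> F1 :|: F2 = finset.setT ->
  (forall x e f, x != w -> e \in F1 -> f \in F2 -> inc x e -> ~~ inc x f) ->
  (NF finset.setT (0%R : {ffun V G -> K}) = NF F1 0%R * NF F2 0%R)%N.
Proof.
move=> F12 FT sh; rewrite -FT flow_count_conv // (bigD1 (0%R : {ffun V G -> K})) //= subrr big1 ?addn0 // => c.
apply: contraNeq; rewrite muln_eq0 negb_or => /andP[n1 n2].
have c0 x : x != w -> c x = 0.
  move=> xw; case: (pickP (fun e => (e \in F1) && inc x e)) => [e /andP[e1 xe]|no].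
    apply/eqP; rewrite -oppr_eq0; apply/eqP.
    have := flow_count_supp n2 (x := x); rewrite !ffunE sub0r; apply=> f f2.
    exact: sh e1 f2 xe.
  by apply: flow_count_supp n1 _ => e e1; have := no e; rewrite e1 => /negbT.
apply/eqP/ffunP => x; rewrite ffunE; case: (eqVneq x w) => [->|/c0 //].
by have := flow_count_total n1; rewrite (bigD1 w) //= big1 ?addr0.
Qed.

(** The excess that one side passes to the other lives on [u] and [v] and has total 0, so it is a
    multiple of [dd u v]. *)
Lemma flow_count_glue2 (G : graph) (F1 F2 : {set E G}) (u v : V G) : u != v ->
  F1 :&: F2 = finset.set0 -> F1 :|: F2 = finset.setT ->
  (forall x e f, x != u -> x != v -> e \in F1 -> f \in F2 -> inc x e -> ~~ inc x f) ->
  (NF finset.setT (0%R : {ffun V G -> K}) = NF F1 0%R * NF F2 0%R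
    + #|K|.-1 * (NF F1 (dd u v) * NF F2 (dd u v)))%N.
Proof.
move=> uv F12 FT sh; rewrite -FT flow_count_conv // (@sum_line _ _ u v xpredT) //; last first.
  move=> c _; rewrite muln_eq0 negb_or => /andP[n1 n2].
  have c0 x : x != u -> x != v -> c x = 0.
    move=> xu xv; case: (pickP (fun e => (e \in F1) && inc x e)) => [e /andP[e1 xe]|no].
      apply/eqP; rewrite -oppr_eq0; apply/eqP.
      have := flow_count_supp n2 (x := x); rewrite !ffunE sub0r; apply=> f f2.
      exact: sh e1 f2 xe.
    by apply: flow_count_supp n1 _ => e e1; have := no e; rewrite e1 => /negbT.
  exists (c u); apply/ffunP => x; rewrite !ffunE.
  case: (eqVneq x u) => [->|xu]; first by rewrite (negbTE uv) subr0 mulr1.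
  case: (eqVneq x v) => [->|xv]; last by rewrite subrr mulr0 c0.
  have := flow_count_total n1; rewrite (bigD1 u) //= (bigD1 v) /= ?(eq_sym v) //.
  rewrite big1 ?addr0 => [|y /andP[]]; last exact: c0.
  by move/eqP; rewrite addr_eq0 => /eqP ->; rewrite sub0r mulrN1 opprK.
rewrite sum_KD sc0 subr0; congr (_ + _)%N; rewrite -sum_nz; apply: eq_bigr => t t0.
by rewrite sub0r -scN !flow_count_scale // oppr_eq0.
Qed.

Lemma subg_img (G : graph) (S : {set V G}) F : issub S F ->
  (val : E (subg S F) -> E G) @: finset.setT = F.
Proof.
move=> i; have -> : [set: E (subg S F)] = val @^-1: F.
  by apply/setP => e; rewrite !inE psi_in.
exact: subg_eset.
Qed.

Lemma flow_count_subg (G : graph) (S : {set V G}) F : issub S F ->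
  NF finset.setT (0%R : {ffun V (subg S F) -> K}) = NF F (0%R : {ffun V G -> K}).
Proof.
move=> i; rewrite -[in RHS](subg_img i).
by rewrite (@flow_count_emb0 K (subg S F) G val val val_inj val_inj (@subg_ends _ _ _)).
Qed.

Lemma flow_count_subgd (G : graph) (S : {set V G}) F (a b : V (subg S F)) : issub S F ->
  NF finset.setT (dd a b) = NF F (dd (val a) (val b)).
Proof.
move=> i; rewrite -[in RHS](subg_img i).
by rewrite (@flow_count_embd K (subg S F) G val val val_inj val_inj (@subg_ends _ _ _)).
Qed.

Lemma flow_count_addedge2 (G : graph) (u v : V G) :
  (NF finset.setT (0%R : {ffun V (addedge (u : V (addedge u v)) v) -> K}) =
   #|K|.-1 * NF finset.setT (0%R : {ffun V G -> K}) +
   #|K|.-2 * NF finset.setT (0%R : {ffun V (addedge u v) -> K}))%N.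
Proof.
set H := addedge u v; rewrite [in RHS](flow_count_addedge u v).
have eS : [set: E H] = (None : E H) |: (Some : E G -> E H) @: finset.setT := Some_img u v.
rewrite (Some_img (u : V H) v) eS imsetU1 flow_count_par ?None_img //; last first.
  by apply/imsetP => -[x /imsetP[y _ ->]].
pose s2 : E G -> E (addedge (u : V H) v) := fun e => Some (Some e).
have -> : (Some : E H -> E (addedge (u : V H) v)) @: ((Some : E G -> E H) @: finset.setT)
   = s2 @: finset.setT by rewrite -imset_comp.
have s2i : injective s2 by move=> a b [].
have en e : ends (s2 e) = (id (ends e).1, id (ends e).2) by exact: surjective_pairing.
rewrite sum_KD eqxx sc0 subr0 (@flow_count_emb0 K G (addedge (u : V H) v) id s2 (@inj_id _) s2i en) //; congr (_ + _)%N.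
rewrite mulnCA -sum_nz; apply: eq_bigr => t t0.
rewrite (negbTE t0) sub0r -scN flow_count_scale ?oppr_eq0 //; congr (_ * _)%N.
exact: (@flow_count_embd K G (addedge (u : V H) v) id s2 (@inj_id _) s2i en).
Qed.

End CountOps.

(** * Identities between flow polynomials *)

Lemma flowpoly_dc (G : graph) (e : E G) : ~~ is_loop e ->
  flowpoly G = flowpoly (contract e) - flowpoly (delete e).
Proof.
move=> nl; apply: poly_eq_primes => p pp; rewrite !hornerE !flowpolyE // /flow_number.
by rewrite (@flow_count_dc 'F_p _ _ nl) natrD addrK.
Qed.

Lemma flowpoly_loop (G : graph) (e : E G) : is_loop e ->
  flowpoly G = ('X - 1) * flowpoly (delete e).
Proof.
move=> l; apply: poly_eq_primes => p pp; rewrite !hornerE !flowpolyE // /flow_number.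
by rewrite (@flow_count_loop 'F_p _ _ l) natrM predpE.
Qed.

Lemma flowpoly_vsplit (G : graph) S1 S2 F1 F2 (w : V G) : vertex_split S1 S2 F1 F2 w ->
  flowpoly G = flowpoly (subg S1 F1) * flowpoly (subg S2 F2).
Proof.
move=> [[i1 i2 S12 ST] [F12 FT _ _]]; apply: poly_eq_primes => p pp.
rewrite !hornerE !flowpolyE // /flow_number !flow_count_subg // (@flow_count_glue1 'F_p _ F1 F2 w) ?natrM //.
move=> x e f xw e1 f2 xe; apply: contra xw => xf; rewrite -in_set1 -S12 inE.
by move/issubP: i1 => /(_ _ _ e1 xe) ->; move/issubP: i2 => /(_ _ _ f2 xf) ->.
Qed.

Lemma flowpoly_identify (G : graph) (u v : V G) : u != v ->
  flowpoly (identify u v) = flowpoly G + flowpoly (addedge u v).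
Proof.
move=> uv; apply: poly_eq_primes => p pp; rewrite !hornerE !flowpolyE // /flow_number.
have [phi [psi q]] := identify_spec uv.
by rewrite (flow_count_quo0 _ q uv) flow_count_addedge natrD.
Qed.

Definition pair_split (G : graph) (S1 S2 : {set V G}) (F1 F2 : {set E G}) (u v : V G) :=
  [/\ issub S1 F1, issub S2 F2, u != v, S1 :&: S2 = [set u; v] & S1 :|: S2 = finset.setT] /\
  [/\ F1 :&: F2 = finset.set0 & F1 :|: F2 = finset.setT].

(** The factor ['X - 1] clears a denominator: the count of a side with excess [dd u v] is the flow
    count of that side with an added edge, divided by p - 1. Two such divisions meet a single factor
    p - 1 in [flow_count_glue2]. *)
Lemma flowpoly_psplit (G : graph) S1 S2 F1 F2 (u v : V G)
  (u1 v1 : V (subg S1 F1)) (u2 v2 : V (subg S2 F2)) :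
  pair_split S1 S2 F1 F2 u v -> val u1 = u -> val v1 = v -> val u2 = u -> val v2 = v ->
  ('X - 1) * flowpoly G = ('X - 1) * (flowpoly (subg S1 F1) * flowpoly (subg S2 F2))
     + flowpoly (addedge u1 v1) * flowpoly (addedge u2 v2).
Proof.
move=> [[i1 i2 uv S12 ST] [F12 FT]] eu1 ev1 eu2 ev2; apply: poly_eq_primes => p pp.
rewrite !hornerE !flowpolyE // /flow_number !flow_count_addedge !flow_count_subg // !flow_count_subgd // eu1 ev1 eu2 ev2.
rewrite (@flow_count_glue2 'F_p _ F1 F2 u v) //.
  by rewrite natrD !natrM predpE //=; ring.
move=> x e f xu xv e1 f2 xe; apply/negP => xf.
suff : x \in [set u; v] by rewrite !inE (negbTE xu) (negbTE xv).
rewrite -S12 inE.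
by move/issubP: i1 => /(_ _ _ e1 xe) ->; move/issubP: i2 => /(_ _ _ f2 xf) ->.
Qed.

Lemma flowpoly_addedge2 (G : graph) (u v : V G) :
  flowpoly (addedge (u : V (addedge u v)) v) =
  ('X - 1) * flowpoly G + ('X - 2%:P) * flowpoly (addedge u v).
Proof.
apply: poly_eq_primes => p pp; rewrite !hornerE !flowpolyE // /flow_number.
by rewrite flow_count_addedge2 natrD !natrM predpE // predp2E.
Qed.

Lemma flowpoly_bridge (G : graph) : has_bridge G -> flowpoly G = 0.
Proof. by move=> hb; rewrite /flowpoly /= hb. Qed.

Lemma flowpoly_card1 (G : graph) : #|V G| = 1 -> flowpoly G = ('X - 1) ^+ #|E G|.
Proof.
move En : #|E G| => n; elim: n G En => [|n IH] G En VG.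
  rewrite /flowpoly En /=; case: ifP => [/existsP[e]|_].
    by have := max_card (pred1 e); rewrite En card1.
  case: pickP => // e; by have := max_card (pred1 e); rewrite En card1.
have /card_gt0P[e _] : (0 < #|E G|)%N by rewrite En.
have l : is_loop e.
  by rewrite /is_loop; move/eqP: VG => /fintype1P[x H]; rewrite (H (ends e).1) (H (ends e).2).
rewrite (flowpoly_loop l) IH ?exprS //.
by apply: succn_inj; rewrite -card_delete.
Qed.

(* [e] is replaced by a path of length 2 with doubled edges *)
Definition ear (G : graph) (e : E G) : graph :=
  @Graph (option (V G) : finType) ((E (delete e) + bool * bool)%type : finType)
    (fun x => match x with
      | inl f => (Some (ends (val f)).1, Some (ends (val f)).2)
      | inr (true, _) => (Some (ends e).1, None)
      | inr (false, _) => (None, Some (ends e).2) end).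

(** Conservation at the new vertex forces the same total [s] through both doubled edges. The case
    [s = 0] leaves flows of [delete e], with p - 1 choices on each pair; a non-zero [s] makes the
    path act as the edge [e], with p - 2 choices on each pair. *)
Lemma flowpoly_ear (G : graph) (e : E G) :
  flowpoly (ear e) = ('X - 1) ^+ 2 * flowpoly (delete e) + ('X - 2%:P) ^+ 2 * flowpoly G.
Proof.
apply: poly_eq_primes => p pp; rewrite !hornerE !flowpolyE // /flow_number (flow_count_setTE _ e).
set K := ('F_p : finFieldType).
pose il : E (delete e) -> E (ear e) := inl.
pose a i : E (ear e) := inr (true, i).
pose b i : E (ear e) := inr (false, i).
have -> : [set: E (ear e)] = a true |: (a false |: (b true |: (b false |: il @: finset.setT))).
  apply/setP => -[f|[[] []]]; rewrite !inE //=.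
  by apply/esym/(imset_f il); rewrite inE.
have nil x : inr x \notin il @: finset.setT by apply/imsetP => -[].
have il_inj : injective il by move=> x y [].
have en f : ends (il f) = (Some (ends f).1, Some (ends f).2) by [].
have c1 : flow_count (il @: finset.setT) (0 : {ffun V (ear e) -> K}) = flow_count finset.setT (0 : {ffun V (delete e) -> K}).
  exact: (@flow_count_emb0 K (delete e) (ear e) Some il (@Some_inj _) il_inj en).
have c2 : flow_count (il @: finset.setT) (dd K (Some (ends e).1) (Some (ends e).2) : {ffun V (ear e) -> K}) =
  flow_count (finset.setT :\ e) (bd K e).
  rewrite (@flow_count_embd K (delete e) (ear e) Some il (@Some_inj _) il_inj en).
  rewrite -delete_img (@flow_count_embd K (delete e) G id val) //; first exact: val_inj.
  by move=> f; apply: surjective_pairing.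
set X := il @: _ in c1 c2 *.
set c := (fun t : K => if t == 0%R then #|K|.-1 else #|K|.-2)%N.
pose Su : V (ear e) := Some (ends e).1; pose Sv : V (ear e) := Some (ends e).2.
have key s r : flow_count X (0 - sc s (bd K (a true)) - sc r (bd K (b true))) != 0%N -> r = s.
  move=> nz; have := flow_count_supp nz (x := None : V (ear e)); rewrite !ffunE /=. move=> H.
  apply/esym/eqP; rewrite -subr_eq0; apply/eqP; rewrite -[RHS]H.
    by rewrite !sub0r subr0 mulr1 mulrN1 opprK.
  by move=> _ /imsetP[f _ ->].
have step : flow_count (a true |: (a false |: (b true |: (b false |: X)))) (0%R : {ffun V (ear e) -> K}) =
    (\sum_s c s * (c s * flow_count X (sc s (dd K Su Sv))))%N.
  rewrite (@flow_count_par K (ear e) (a true) (a false)) ?inE ?negb_or ?nil //.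
  apply: eq_bigr => s _; congr (_ * _)%N.
  rewrite (@flow_count_par K (ear e) (b true) (b false)) ?nil //.
  rewrite (bigD1 s) //= big1 ?addn0 => [|r rs]; last first.
    apply/eqP; rewrite muln_eq0; apply/orP; right; apply: contraNT rs => /key ->.
    exact: eqxx.
  congr (_ * _)%N.
  have -> : 0 - sc s (bd K (a true)) - sc s (bd K (b true)) = - sc s (dd K Su Sv).
    apply/ffunP => x; rewrite !ffunE /=; ring.
  have -> : - sc s (dd K Su Sv) = sc (-1) (sc s (dd K Su Sv)) by rewrite scN sc1.
  by rewrite flow_count_scale // oppr_eq0 oner_eq0.
rewrite step sum_KD /c eqxx sc0 c1.
under eq_bigr => t t0.
  rewrite (negbTE t0) flow_count_scale // c2.
  over.
by rewrite sum_nz natrD !natrM predpE // predp2E //; ring.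
Qed.

Local Close Scope ring_scope.

(** * Edge bipartitions of non-separable graphs *)

Section Attach.
Variable G : graph.
Implicit Types (x y u v w : V G) (e f : E G) (S A : {set V G}) (F : {set E G}).

Definition touched F : {set V G} := [set x | [exists e in F, inc x e]].
(** The vertices of attachment of [F]. They depend only on the bipartition of the edges
    ([attach_C]), so the class containing a chosen edge may be fixed at will. *)
Definition attach F := touched F :&: touched (~: F).

Lemma touchedP F x : reflect (exists2 e, e \in F & inc x e) (x \in touched F).
Proof. by rewrite inE; apply: (iffP exists_inP). Qed.

Lemma attach_C F : attach (~: F) = attach F.
Proof. by rewrite /attach finset.setCK finset.setIC. Qed.

Lemma connected_inc x : connected G -> [set: E G] != set0 -> exists e, inc x e.
Proof.
move=> /conn_subP[_ cS] /set0Pn[e _].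
case: (boolP (inc x e)) => xe; first by exists e.
have [||||f _ /cut1 xf] := cS [set x] x (ends e).1; rewrite ?inE //; last by exists f.
by apply: contraNneq xe => <-; rewrite incE1.
Qed.

Lemma nonsep_attachP :
  reflect (connected G /\ forall F, F != set0 -> F != setT -> 1 < #|attach F|) (nonsep G).
Proof.
apply: (iffP (nonsepP G)) => -[cG H]; split=> //.
  move=> F F0 FT; rewrite ltnNge; apply/negP => a1.
  have [w hw] : exists w, forall x, x \in attach F -> x = w.
    case: (pickP (mem (attach F))) => [w wa|no].
      by exists w => x xa; have := card_le1P a1 w wa x; rewrite xa => /esym/eqP.
    have [[x _] _] := connectedP _ cG.
    by exists x => y ya; have := no y; rewrite /= ya.
  apply: (H F (~: F) w); first by rewrite finset.setUCr.
  split=> //.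
  - by rewrite -finset.setCT (inj_eq (can_inj (@finset.setCK _))).
  - by move=> e eF; rewrite inE eF.
  - move=> x e f eF fF xe xf; apply: hw; rewrite inE.
    by apply/andP; split; apply/touchedP; [exists e|exists f].
move=> F1 F2 w F12 [F10 F20 dis sh].
have F2E : F2 = ~: F1.
  apply/setP => e; rewrite inE; case: (boolP (e \in F1)) => e1.
    by rewrite (negbTE (dis e e1)).
  by have := in_setT e; rewrite -F12 inE (negbTE e1).
have F1T : F1 != setT.
  by apply: contraNneq F20 => F1T; rewrite F2E F1T finset.setCT.
have /card_gt1P[x [y [xa ya]]] := H F1 F10 F1T; case/negP.
have eqw z : z \in attach F1 -> z = w.
  by rewrite inE -F2E => /andP[/touchedP[e e1 ze] /touchedP[f f2 zf]]; apply: sh ze zf.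
by rewrite (eqw x xa) (eqw y ya).
Qed.

Lemma not_nonsep_vsplit : connected G -> [set: E G] != set0 -> ~~ nonsep G ->
  exists S1 S2 F1 F2 w, vertex_split S1 S2 F1 F2 w.
Proof.
move=> cG E0 /nonsep_attachP nG.
have [F [F0 FT a1]] : exists F, [/\ F != set0, F != setT & #|attach F| <= 1].
  apply: contrapT => H; apply: nG; split=> // F F0 FT; rewrite ltnNge; apply/negP => a1.
  by apply: H; exists F.
have FC0 : ~: F != set0 by rewrite -finset.setCT (inj_eq (can_inj (@finset.setCK _))).
(* Without any attachment, no edge would cross [touched F], against connectivity. *)
have [w aw] : exists w, attach F = [set w].
  apply/cards1P; rewrite eqn_leq a1 /=; apply: contraT; rewrite -eqn0Ngt cards_eq0 => /eqP a0.
  case/set0Pn: F0 => e eF; case/set0Pn: FC0 => f fF.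
  have no x : x \in touched F -> x \in touched (~: F) -> False.
    by move=> x1 x2; have := in_set0 x; rewrite -a0 inE x1 x2.
  have e1 : (ends e).1 \in touched F by apply/touchedP; exists e; rewrite ?incE1.
  have f1 : (ends f).1 \notin touched F.
    by apply/negP => /no; apply; apply/touchedP; exists f; rewrite ?incE1.
  have [_ /(_ _ _ _ e1 f1)[g]] := connectedP _ cG.
  case: (boolP (g \in F)) => gF.
    have -> : cut (touched F) g = false => //.
    rewrite /cut; apply/negbTE; rewrite negbK; apply/eqP.
    by apply/idP/idP => _; apply/touchedP; exists g; rewrite ?incE1 ?incE2.
  have gn x : inc x g -> x \notin touched F.
    by move=> xg; apply/negP => /no; apply; apply/touchedP; exists g; rewrite ?inE.
  by rewrite /cut (negbTE (gn _ (incE1 g))) (negbTE (gn _ (incE2 g))).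
exists (touched F), (touched (~: F)), F, (~: F), w; split; split=> //.
- by apply/issubP => e x eF xe; apply/touchedP; exists e.
- by apply/issubP => e x eF xe; apply/touchedP; exists e.
- apply/setP => x; rewrite finset.in_setT inE; have [e xe] := connected_inc x cG E0.
  case: (boolP (e \in F)) => eF; apply/orP; [left|right]; apply/touchedP; exists e => //.
  by rewrite inE.
- exact: finset.setICr.
- exact: finset.setUCr.
Qed.

Lemma cutC S e : cut (~: S) e = cut S e.
Proof. by rewrite /cut !inE; case: (_ \in S); case: (_ \in S). Qed.

(** If [e] were the only edge crossing [S], the edges meeting [S] would be attached to the others
    only at the end of [e] outside [S]. A second edge [f] makes this a genuine bipartition, after
    replacing [S] by its complement if [f] meets [S]. *)
Lemma nonsep_bridgeless : nonsep G -> 1 < #|E G| -> bridgeless G.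
Proof.
move=> /nonsep_attachP[cG H] E2; apply/bridgelessP => S e ce; apply: contrapT => Hn.
have uni f : cut S f -> f = e.
  by move=> cf; apply: contrapT => /eqP fe; apply: Hn; exists f.
have [f fe] : exists f, f != e.
  move: E2; rewrite -cardsT => /card_gt1P[x [y [_ _ xy]]].
  by case: (eqVneq x e) => [xe|]; [exists y; rewrite -xe eq_sym|exists x].
wlog f1 : S ce uni Hn / (ends f).1 \notin S => [wl|].
  case: (boolP ((ends f).1 \in S)) => f1; last exact: (wl S).
  apply: (wl (~: S)).
  - by rewrite cutC.
  - by move=> g; rewrite cutC; apply: uni.
  - by move=> [g ge]; rewrite cutC => cg; apply: Hn; exists g.
  - by rewrite inE negbK.
have f2 : (ends f).2 \notin S.
  apply/negP => f2; have /uni/eqP : cut S f by rewrite /cut f2 (negbTE f1).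
  by rewrite (negbTE fe).
pose F := [set g | [exists x in S, inc x g]].
have eF : e \in F.
  rewrite inE; apply/existsP; move: ce; rewrite /cut.
  case e1: ((ends e).1 \in S); first by exists (ends e).1; rewrite e1 incE1.
  by case e2: ((ends e).2 \in S) => // _; exists (ends e).2; rewrite e2 incE2.
have fF : f \notin F.
  rewrite inE; apply/existsP => -[x /andP[xS]]; rewrite /inc.
  by move=> /orP[] /eqP xx; move: xS; rewrite -xx ?(negbTE f1) ?(negbTE f2).
have [||] := card_gt1P (H F _ _).
- by apply/set0Pn; exists e.
- by apply: contraNneq fF => ->; rewrite inE.
move=> x [y [xa ya]]; case/negP.
have key z : z \in attach F -> z \notin S /\ inc z e.
  rewrite inE => /andP[/touchedP[g gF zg] /touchedP[h hF zh]].
  have zS : z \notin S.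
    by apply: contraTN hF => zS; rewrite inE negbK inE; apply/existsP; exists z; rewrite zS.
  split=> //; have <- // : g = e; apply: uni.
  move: gF; rewrite inE => /existsP[t /andP[tS]]; move: zg; rewrite /inc /cut.
  move=> /orP[]/eqP zg /orP[]/eqP tg; rewrite ?zg ?tg ?tS ?(negbTE zS) //.
  - by rewrite -tg zg (negbTE zS) in tS.
  - by rewrite -tg zg (negbTE zS) in tS.
have [xS xe] := key x xa; have [yS ye] := key y ya.
move: ce xS yS xe ye; rewrite /cut /inc.
case e1: ((ends e).1 \in S); case e2: ((ends e).2 \in S) => // _ xS yS.
  have n1 z : z \notin S -> ((ends e).1 == z) = false.
    by move=> zS; apply: contraNF zS => /eqP <-.
  by rewrite (n1 x xS) (n1 y yS) /= => /eqP <- /eqP <-.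
have n1 z : z \notin S -> ((ends e).2 == z) = false.
  by move=> zS; apply: contraNF zS => /eqP <-.
by rewrite (n1 x xS) (n1 y yS) !orbF => /eqP <- /eqP <-.
Qed.

Lemma nonsep_loopless e : nonsep G -> 1 < #|E G| -> ~~ is_loop e.
Proof.
move=> /nonsep_attachP[cG H] E2; apply/negP => l.
have : 1 < #|attach [set e]|.
  apply: H; first by apply/set0Pn; exists e; rewrite inE.
  by apply/eqP => eT; move: E2; rewrite -cardsT -eT cards1.
move=> /card_gt1P[x [y [xa ya]]]; case/negP.
have key z : z \in attach [set e] -> z = (ends e).1.
  rewrite inE => /andP[/touchedP[f /set1P ->]]; move: l; rewrite /is_loop /inc => /eqP <-.
  by rewrite orbb => /eqP.
by rewrite (key x xa) (key y ya).
Qed.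

Lemma connected_delete e : connected G -> bridgeless G -> connected (delete e).
Proof.
move=> /connectedP[[x _] H] /bridgelessP B; apply/connectedP; split; first by exists x.
move=> S a b aS bS; have [f cf] := H S a b aS bS.
have [g ge cg] : exists2 g, g != e & @cut G S g.
  by case: (eqVneq f e) => [fe|fe]; [subst f; apply: B|exists f].
by exists (@exist _ (fun f => f != e) g ge : E (delete e)).
Qed.

End Attach.

(** * Degrees relative to a set of edges *)

Section Degree.
Variable G : graph.
Implicit Types (x y u v w : V G) (e f : E G) (S A : {set V G}) (F : {set E G}).

Definition edeg e x : nat := ((ends e).1 == x) + ((ends e).2 == x).
Definition degF F x : nat := \sum_(e in F) edeg e x.

Lemma degE x : deg x = degF setT x.
Proof.
rewrite /deg /degF big_split /= -!sum1dep_card.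
by congr (_ + _); rewrite [LHS]big_mkcond /=; apply: eq_big => e; rewrite ?inE //; case: (_ == x).
Qed.

Lemma degF_U F1 F2 x : F1 :&: F2 = set0 -> degF (F1 :|: F2) x = degF F1 x + degF F2 x.
Proof.
move=> F12; rewrite /degF (big_setID F1) /=; congr (_ + _); apply: eq_bigl => e; rewrite !inE.
  by case: (_ \in F1); rewrite ?andbF.
case: (boolP (e \in F1)) => //= e1; apply/esym/negbTE; exact: (setI0_notin F12).
Qed.

Lemma degF_sub F1 F2 x : F1 \subset F2 -> degF F1 x <= degF F2 x.
Proof.
move=> s; rewrite /degF (big_setID F1 (A := F2)) /= (setIidPr s); exact: leq_addr.
Qed.

Lemma degF1 e x : degF [set e] x = edeg e x.
Proof. by rewrite /degF big_set1. Qed.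

Lemma edeg_inc e x : (0 < edeg e x) = inc x e.
Proof. by rewrite /edeg /inc; do 2 case: (_ == x). Qed.

Lemma edeg_le1 e x : ~~ is_loop e -> edeg e x = inc x e.
Proof.
rewrite /edeg /inc /is_loop => l; case: (eqVneq (ends e).1 x) => [e1|_]; last by case: (_ == x).
by case: (eqVneq (ends e).2 x) => // e2; rewrite e1 e2 eqxx in l.
Qed.

Lemma degF_gt0 F x : (0 < degF F x) = (x \in touched F).
Proof.
rewrite lt0n /degF sum_nat_eq0 negb_forall; apply/existsP/touchedP => -[e].
  by rewrite negb_imply => /andP[eF H]; exists e; rewrite // -edeg_inc lt0n.
by move=> eF xe; exists e; rewrite negb_imply eF -lt0n edeg_inc.
Qed.

Lemma degF_eq1 F x : degF F x = 1 -> exists e, [/\ e \in F, edeg e x = 1 &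
  forall f, f \in F -> inc x f -> f = e].
Proof.
move=> d1; have /touchedP[e eF xe] : x \in touched F by rewrite -degF_gt0 d1.
have dE : degF F x = edeg e x + \sum_(f in F | f != e) edeg f x by rewrite /degF (bigD1 e).
have [ed s0] : edeg e x = 1 /\ \sum_(f in F | f != e) edeg f x = 0.
  by move: xe dE; rewrite -edeg_inc d1; set s := \sum_(_ in _ | _) _; lia.
exists e; split=> // f fF xf; apply: contrapT => /eqP fe.
have /eqP := s0; rewrite sum_nat_eq0 => /forallP/(_ f).
by rewrite fF fe /= -leqn0 leqNgt edeg_inc xf.
Qed.

Lemma cut1E x e : cut [set x] e = (edeg e x == 1).
Proof. by rewrite /cut /edeg !inE; do 2 case: (_ == x). Qed.

Lemma subg_deg1_bridge S F x : issub S F -> degF F x = 1 -> has_bridge (subg S F).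
Proof.
move=> i /degF_eq1[e [eF e1 H]].
have eP := subE_in i eF; pose e' : E (subg S F) := exist _ e eP.
have xS : x \in S by move/issubP: i; apply; [exact: eF|rewrite -edeg_inc e1].
pose x' : V (subg S F) := exist _ x xS.
apply/existsP; exists e'; apply/is_bridgeP; exists [set x'] => f.
have -> : cut [set x'] f = cut [set x] (val f).
  by rewrite /cut /= !inE -!val_eqE.
apply/idP/eqP => [/cut1 xf|->]; last by rewrite cut1E /= e1.
by apply: val_inj; apply: H => //; apply: psi_in.
Qed.

End Degree.

Lemma deg_push (H G : graph) (phi : V H -> V G) (psi : E H -> E G) x :
  injective phi -> injective psi ->
  (forall e, ends (psi e) = (phi (ends e).1, phi (ends e).2)) ->
  deg x = degF (psi @: [set: E H]) (phi x).
Proof.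
move=> pi si en; rewrite degE /degF big_imset /=; last by move=> ? ? _ _; apply: si.
by apply: eq_bigr => e _; rewrite /edeg en /= !(inj_eq pi).
Qed.

Lemma deg_subg (G : graph) (S : {set V G}) F (x : V (subg S F)) : issub S F ->
  deg x = degF F (val x).
Proof.
move=> i; rewrite -[in RHS](subg_img i).
exact: (@deg_push (subg S F) G val val x val_inj val_inj (@subg_ends _ _ _)).
Qed.

Lemma deg_addedge (G : graph) (u v x : V G) :
  deg (x : V (addedge u v)) = deg x + ((u == x) + (v == x)).
Proof.
rewrite !degE {1}/degF (Some_img u v) big_setU1 ?None_img //= addnC; congr (_ + _).
by rewrite big_imset //= => ? ? _ _ [].
Qed.

Lemma W_emb (H G : graph) (phi : V H -> V G) : injective phi ->
  (forall x, deg x <= deg (phi x)) -> #|Wset H| <= #|Wset G|.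
Proof.
move=> pi d; rewrite -(card_imset _ pi); apply/subset_leq_card/fintype.subsetP.
by move=> _ /imsetP[x xW ->]; move: xW; rewrite !inE => /leq_trans; apply.
Qed.

(** * Graphs obtained by merging two vertices *)

Section Quo.
Variables (G H : graph) (phi : V G -> V H) (psi : E H -> E G) (u v : V G) (F : {set E G}).
Hypotheses (q : quotient phi psi u v F) (uv : u != v).

Lemma quo_phi_eq x y : x != u -> x != v -> phi x = phi y -> x = y.
Proof.
by move=> xu xv /eqP; rewrite (quo_ker q) (negbTE xu) (negbTE xv) /= orbF => /eqP.
Qed.

Lemma quo_uv : phi u = phi v.
Proof. by apply/eqP; rewrite (quo_ker q) !eqxx !orbT. Qed.

Lemma quo_merged x : phi x = phi u -> x = u \/ x = v.
Proof.
by case: (eqVneq x u) => [|xu]; [left|case: (eqVneq x v) => [|xv]; [right|move/quo_phi_eq->; auto]].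
Qed.

Lemma quo_cardV : #|V G| = #|V H|.+1.
Proof.
have := cardsC1 v; rewrite (cardsD1 v) in_setC1 eqxx add0n => c.
have cV : #|V G| = #|[set~ v]|.+1 by rewrite cardsC1 prednK //; apply/card_gt0P; exists v.
rewrite cV -(card_in_imset (f := phi)).
  congr _.+1; rewrite -cardsT; apply: eq_card => y; rewrite finset.in_setT.
  apply/imsetP; have [x <-] := quo_surj q y.
  case: (eqVneq x v) => [->|xv]; last by exists x; rewrite ?inE.
  by exists u; rewrite ?quo_uv // !inE.
move=> x y; rewrite !inE => xv yv /eqP; rewrite (quo_ker q) (negbTE xv) (negbTE yv) !andbF !orbF.
by move/eqP.
Qed.

Lemma quo_cut (S : {set V H}) e : cut S e = cut (phi @^-1: S) (psi e).
Proof. by rewrite /cut (quo_ends q) /= !inE. Qed.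

(** Edges lost in the quotient cross no pulled-back cut. This is vacuous for an identification, and
    for a contraction the lost edge joins [u] to [v]. *)
Hypothesis collapse : forall e, e \notin F -> phi (ends e).1 = phi (ends e).2.

Lemma quo_cut_in (S : {set V H}) f : cut (phi @^-1: S) f -> exists2 e, f = psi e & cut S e.
Proof.
move=> cf; have fF : f \in F.
  by apply: contraTT cf => /collapse ef; rewrite /cut !inE ef eqxx.
move: fF; rewrite -(quo_img q) => /imsetP[e _ fe]; exists e => //.
by rewrite quo_cut -fe.
Qed.

Lemma quo_connected : connected G -> connected H.
Proof.
move=> /connectedP[[x _] cG]; apply/connectedP; split; first by exists (phi x).
move=> S a b; have [a' <-] := quo_surj q a; have [b' <-] := quo_surj q b => aS bS.
have [||f] := cG (phi @^-1: S) a' b'; rewrite ?inE //.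
by move=> /quo_cut_in[e _ ce]; exists e.
Qed.

Lemma quo_bridgeless : bridgeless G -> bridgeless H.
Proof.
move=> /bridgelessP bG; apply/bridgelessP => S e; rewrite quo_cut => /bG[f fe].
move=> /quo_cut_in[e' fe' ce']; exists e' => //; apply: contraNneq fe => <-.
by rewrite fe'.
Qed.

Lemma deg_quo y : deg y = \sum_(x | phi x == y) degF F x.
Proof.
rewrite degE /degF exchange_big /= -(quo_img q).
rewrite (big_imset (h := psi)) /=; last by move=> ? ? _ _; apply: (quo_inj q).
apply: eq_bigr => e _; rewrite /edeg (quo_ends q) /= big_split /=.
have one z : \sum_(i | phi i == y) (z == i : nat) = (phi z == y).
  case: eqP => [zy|ne].
    by rewrite (bigD1 z) /= ?zy // eqxx big1 // => x /andP[_]; rewrite eq_sym => /negbTE ->.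
  by rewrite big1 // => x /eqP xy; case: eqP => // zx; rewrite zx in ne.
by rewrite !one.
Qed.

Lemma deg_quo_merged : deg (phi u) = degF F u + degF F v.
Proof.
rewrite deg_quo (bigD1 u) //= (bigD1 v) /=; last by rewrite -quo_uv eqxx eq_sym.
rewrite big1 ?addn0 // => x /andP[/andP[/eqP/quo_merged[->|->]]]; rewrite ?eqxx //.
Qed.

Lemma deg_quo_other x : x != u -> x != v -> deg (phi x) = degF F x.
Proof.
move=> xu xv; rewrite deg_quo (big_pred1 x) // => y /=; rewrite eq_sym.
by apply/eqP/eqP => [/(quo_phi_eq xu xv)|->].
Qed.

Lemma quo_W_sub : Wset H \subset phi u |: (phi @: Wset G).
Proof.
apply/fintype.subsetP => y; have [x <-] := quo_surj q y.
rewrite !inE => dx.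
case: (eqVneq x u) => [->|xu]; first by rewrite eqxx.
case: (eqVneq x v) => [->|xv]; first by rewrite -quo_uv eqxx.
apply/orP; right; apply/imsetP; exists x => //; rewrite inE.
by move: dx; rewrite deg_quo_other // degE => /leq_trans; apply; apply: degF_sub; apply/finset.subsetT.
Qed.

(** The merged vertex may be of large degree, but it then takes the place of [u] or [v]. *)
Lemma quo_W_in : (u \in Wset G) || (v \in Wset G) -> #|Wset H| <= #|Wset G|.
Proof.
move=> W; apply: leq_trans (leq_imset_card phi (mem (Wset G))).
apply: subset_leq_card; apply: (fintype.subset_trans quo_W_sub).
rewrite finset.subUset fintype.subxx andbT sub1set.
by case/orP: W => W; [|rewrite quo_uv]; apply: imset_f.
Qed.

(** Contracting an edge of a graph without vertices of degree above 3 may create one; this is why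
    the reduction asks for [0 < k]. *)
Lemma quo_W_le1 : Wset G = set0 -> #|Wset H| <= 1.
Proof.
move=> W0; rewrite -(cards1 (phi u)); apply: subset_leq_card.
by apply: (fintype.subset_trans quo_W_sub); rewrite W0 imset0 finset.setU0.
Qed.

Lemma quo_W_notmerged : deg (phi u) <= 3 -> #|Wset H| <= #|Wset G|.
Proof.
move=> d3; apply: leq_trans (leq_imset_card phi (mem (Wset G))).
apply: subset_leq_card; apply/fintype.subsetP => y yW.
have := fintype.subsetP quo_W_sub y yW; rewrite !inE => /orP[/eqP yu|//].
by move: yW; rewrite inE yu ltnNge d3.
Qed.

Lemma quo_VF (A : {set E H}) : touched A = phi @: touched (psi @: A).
Proof.
apply/setP => y; apply/touchedP/imsetP => [[e eA]|[x /touchedP[_ /imsetP[e eA ->]] xe ->]].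
  rewrite /inc (quo_ends q) /= => /orP[]/eqP <-.
    by exists (ends (psi e)).1 => //; apply/touchedP; exists (psi e); rewrite ?imset_f ?incE1.
  by exists (ends (psi e)).2 => //; apply/touchedP; exists (psi e); rewrite ?imset_f ?incE2.
exists e => //; move: xe; rewrite /inc (quo_ends q) /=.
by move=> /orP[] /eqP ->; rewrite eqxx ?orbT.
Qed.

End Quo.

(** * Sides of vertex splits and of 2-separations *)

Section Parts.
Variables (G : graph) (S1 S2 : {set V G}) (F1 F2 : {set E G}).
Hypotheses (i1 : issub S1 F1) (i2 : issub S2 F2).
Hypotheses (ST : S1 :|: S2 = setT) (FT : F1 :|: F2 = setT).

Lemma part_edge e : e \notin F1 -> e \in F2.
Proof. by move=> e1; have := in_setT e; rewrite -FT inE (negbTE e1). Qed.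

(* A cut of one side, extended by the whole other side when it contains an
   attachment vertex, is crossed by no edge of the other side. *)
Lemma extend_cut (A : {set V (subg S1 F1)}) :
  (forall x y, x \in S1 :&: S2 -> y \in S1 :&: S2 ->
     (x \in val @: A) = (y \in val @: A)) ->
  exists B : {set V G},
    (forall x : V (subg S1 F1), (val x \in B) = (x \in A)) /\
    (forall f, cut B f -> exists2 e : E (subg S1 F1), val e = f & cut A e).
Proof.
move=> H; pose t := [exists x in S1 :&: S2, x \in val @: A].
pose B := [set x | if x \in S1 then x \in val @: A else t].
have BE (x : V (subg S1 F1)) : (val x \in B) = (x \in A).
  by rewrite inE (valP x) mem_imset //; apply: val_inj.
have B2 x : x \in S2 -> (x \in B) = t.
  move=> x2; rewrite inE; case: ifP => // x1.
  have x12 : x \in S1 :&: S2 by rewrite inE x1.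
  apply/idP/exists_inP => [xA|[y y12 yA]]; first by exists x.
  by rewrite (H x y).
exists B; split=> // f cf.
have f1 : f \in F1.
  apply: contraT => /part_edge f2; move: cf; rewrite /cut.
  by move/issubP: i2 => iS; rewrite !B2 ?eqxx //; apply: iS f2 _; rewrite ?incE1 ?incE2.
exists (exist _ f (subE_in i1 f1)) => //.
by move: cf; rewrite /cut -!BE.
Qed.

Lemma subg_connected_of (A0 : S1 != set0) :
  connected G -> (forall (A : {set V (subg S1 F1)}) x y, x \in A -> y \notin A ->
    (forall x y, x \in S1 :&: S2 -> y \in S1 :&: S2 ->
     (x \in val @: A) = (y \in val @: A)) \/ exists e, cut A e) -> connected (subg S1 F1).
Proof.
move=> /connectedP[_ cG] H; apply/connectedP; split.
  by case/set0Pn: A0 => x xS; exists (exist _ x xS).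
move=> A x y xA yA; case: (H A x y xA yA) => // /extend_cut[B [BE BC]].
have [||f /BC[e _ ce]] := cG B (val x) (val y); rewrite ?BE //.
by exists e.
Qed.

Lemma W_subg : #|Wset (subg S1 F1)| <= #|Wset G|.
Proof.
apply: (@W_emb (subg S1 F1) G val) => [|x]; first exact: val_inj.
by rewrite deg_subg // degE; apply: degF_sub; apply/finset.subsetT.
Qed.
End Parts.

Section VSplit.
Variables (G : graph) (S1 S2 : {set V G}) (F1 F2 : {set E G}) (w : V G).
Hypothesis sp : vertex_split S1 S2 F1 F2 w.

Lemma vsplit_att (A : {set V (subg S1 F1)}) x y : x \in S1 :&: S2 -> y \in S1 :&: S2 ->
     (x \in val @: A) = (y \in val @: A).
Proof. by have [[_ _ -> _] _] := sp; rewrite !inE => /eqP -> /eqP ->. Qed.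

Lemma vsplit_connected : connected G -> connected (subg S1 F1).
Proof.
have [[i1 i2 S12 ST] [F12 FT _ _]] := sp.
move=> cG; apply: (subg_connected_of i1 i2 FT) => //.
  by apply/set0Pn; exists w; have := set11 w; rewrite -S12 inE => /andP[].
by move=> A x y _ _; left=> a b; apply: vsplit_att.
Qed.

Lemma vsplit_bridgeless : bridgeless G -> bridgeless (subg S1 F1).
Proof.
have [[i1 i2 S12 ST] [F12 FT _ _]] := sp.
move=> /bridgelessP bG; apply/bridgelessP => A e ce.
have [B [BE BC]] := extend_cut i1 i2 FT (@vsplit_att A).
have [|f fe /BC[e' ef ce']] := bG B (val e); first by move: ce; rewrite /cut -!BE.
by exists e' => //; apply: contraNneq fe => <-; rewrite ef.
Qed.

Lemma vsplit_cardV : #|S1| + #|S2| = #|V G|.+1.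
Proof.
have [[_ _ S12 ST] _] := sp.
by rewrite -cardsUI ST S12 cards1 cardsT addn1.
Qed.

Lemma vsplit_cardE : #|F1| + #|F2| = #|E G|.
Proof. by have [_ [F12 FT _ _]] := sp; rewrite -cardsUI FT F12 cards0 cardsT addn0. Qed.
End VSplit.

Section PSplit.
Variables (G : graph) (S1 S2 : {set V G}) (F1 F2 : {set E G}) (u v : V G).
Hypothesis sp : pair_split S1 S2 F1 F2 u v.

Lemma psplit_sym : pair_split S2 S1 F2 F1 u v.
Proof.
by have [[a b c d e] [f g]] := sp; split; split=> //; rewrite finset.setIC || rewrite finset.setUC.
Qed.

Lemma psplit_swap : pair_split S1 S2 F1 F2 v u.
Proof.
have [[a b c d e] [f g]] := sp; split; split=> //; first by rewrite eq_sym.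
by rewrite d finset.setUC.
Qed.

Lemma psplit_cardV : #|S1| + #|S2| = #|V G|.+2.
Proof.
have [[_ _ uv S12 ST] _] := sp.
by rewrite -cardsUI ST S12 cards2 uv cardsT addn2.
Qed.

Lemma psplit_cardE : #|F1| + #|F2| = #|E G|.
Proof. by have [_ [F12 FT]] := sp; rewrite -cardsUI FT F12 cards0 cardsT addn0. Qed.

Lemma psplit_u1 : u \in S1.
Proof. by have [[_ _ _ S12 _] _] := sp; have := set21 u v; rewrite -S12 inE => /andP[]. Qed.
Lemma psplit_v1 : v \in S1.
Proof. by have [[_ _ _ S12 _] _] := sp; have := set22 u v; rewrite -S12 inE => /andP[]. Qed.

Lemma psplit_C : ~: F1 = F2.
Proof.
have [_ [F12 FT]] := sp; apply/setP => e; rewrite inE; apply/idP/idP; last first.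
  by rewrite finset.setIC in F12; apply: setI0_notin.
by move=> e1; have := in_setT e; rewrite -FT inE (negbTE e1).
Qed.

Lemma psplit_att : attach F1 \subset [set u; v].
Proof.
have [[/issubP i1 /issubP i2 uv S12 ST] [F12 FT]] := sp.
apply/fintype.subsetP => x; rewrite in_setI psplit_C -S12 in_setI => /andP[/touchedP[e e1 xe] /touchedP[f f2 xf]].
by rewrite (i1 e) // (i2 f).
Qed.

Lemma psplit_attE : nonsep G -> F1 != set0 -> F2 != set0 -> attach F1 = [set u; v].
Proof.
move=> /nonsep_attachP[_ H] F10 F20; apply/eqP; rewrite eqEcard psplit_att cards2.
apply: leq_trans (H F1 F10 _); first by case: (u != v).
by rewrite -psplit_C in F20; apply: contraNneq F20 => ->; rewrite finset.setCT.
Qed.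

Lemma psplit_degu : nonsep G -> F1 != set0 -> F2 != set0 -> 0 < degF F1 u.
Proof.
move=> nG F10 F20; rewrite degF_gt0.
by have := set21 u v; rewrite -(psplit_attE nG F10 F20) inE => /andP[].
Qed.

Definition pt1 : V (subg S1 F1) := exist _ u psplit_u1.
Definition pt2 : V (subg S1 F1) := exist _ v psplit_v1.

(** The new edge stands for the whole other side. Given a bipartition with the new edge in [A], the
    complement [B] of [A] is a class of a bipartition of [G] whose other class also takes all of
    [F2]; attachments of [B] through [F2] are [u] or [v], which the new edge attaches as well. *)
Lemma psplit_addedge_nonsep : nonsep G -> F1 != set0 -> F2 != set0 ->
  nonsep (addedge pt1 pt2).
Proof.
move=> nG F10 F20; have [[i1 i2 uv S12 ST] [F12 FT]] := sp.
have [cG HG] := nonsep_attachP _ nG.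
set H := addedge pt1 pt2; apply/nonsep_attachP; split.
  apply/connectedP; split; first by exists pt1.
  move=> A x y xA yA.
  case: (eqVneq (pt1 \in A) (pt2 \in A)) => [eA|neA]; last by exists None; rewrite /cut /=.
  have AE z : z \in S1 :&: S2 -> (z \in val @: (A : {set V (subg S1 F1)})) = (pt1 \in A).
    rewrite S12 !inE => /orP[]/eqP ->; rewrite ?eA.
      by rewrite -[u]/(val pt1) mem_imset //; apply: val_inj.
    by rewrite -[v]/(val pt2) mem_imset //; apply: val_inj.
  have [|B [BE BC]] := @extend_cut G S1 S2 F1 F2 i1 i2 FT A.
    by move=> a b a12 b12; rewrite !AE.
  have [_ cG'] := connectedP _ cG.
  have [||f /BC[e _ ce]] := cG' B (val x) (val y); rewrite ?BE //.
  by exists (Some e).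
move=> A A0 AT.
wlog NA : A A0 AT / None \in A => [wl|].
  case: (boolP (None \in A)) => NA; first exact: wl.
  rewrite -attach_C; apply: wl; last by rewrite inE.
    by rewrite -finset.setCT (inj_eq (can_inj (@finset.setCK _))).
  by rewrite -finset.setC0 (inj_eq (can_inj (@finset.setCK _))).
pose B : {set E G} := [set f | [exists e : E (subg S1 F1), (val e == f) && (Some e \notin A)]].
have B0 : B != set0.
  have [x xA] : exists x, x \notin A.
    by apply/existsP; rewrite -negb_forall; apply: contra AT => /forallP ax; apply/eqP/setP => z; rewrite ax inE.
  case: x xA NA => [e|] xA NA; last by rewrite NA in xA.
  by apply/set0Pn; exists (val e); rewrite inE; apply/existsP; exists e; rewrite eqxx.
have BF1 f : f \in B -> f \in F1.
  by rewrite inE => /existsP[e /andP[/eqP <- _]]; apply: psi_in.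
have BT : B != setT.
  case/set0Pn: F20 => f f2; apply: contraTneq f2 => BT.
  by apply: (setI0_notin F12); apply: BF1; rewrite BT inE.
have [x [y [xa ya xy]]] := card_gt1P (HG B B0 BT).
have key z : z \in attach B -> exists2 z' : V H, val z' = z & z' \in attach A.
  rewrite inE => /andP[/touchedP[f fB zf] /touchedP[g gB zg]].
  have z1 : z \in S1 by move/issubP: i1 => /(_ f z (BF1 f fB) zf).
  pose z' : V (subg S1 F1) := exist _ z z1.
  exists z' => //; rewrite inE; apply/andP; split; last first.
    move: fB; rewrite inE => /existsP[e /andP[/eqP ef eA]].
    by apply/touchedP; exists (Some e); rewrite ?inE //; move: zf; rewrite -ef /inc /= -!val_eqE.
  case: (boolP (g \in F1)) => g1.
    pose e : E (subg S1 F1) := exist _ g (subE_in i1 g1).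
    apply/touchedP; exists (Some e); last by move: zg; rewrite /inc /= -!val_eqE.
    by apply: contraTT gB => eA; rewrite inE negbK inE; apply/existsP; exists e; rewrite eqxx.
  have z2 : z \in S2 by move/issubP: i2 => /(_ g z (part_edge FT g1) zg).
  have : z \in S1 :&: S2 by rewrite inE z1.
  rewrite S12 => z12; apply/touchedP; exists None => //; move: z12; rewrite !inE /inc /= -!val_eqE /=.
  by rewrite ![z == _]eq_sym.
have [x' xx xa'] := key x xa; have [y' yy ya'] := key y ya.
by apply/card_gt1P; exists x', y'; split=> //; apply: contraNneq xy => xy; rewrite -xx -yy xy.
Qed.
End PSplit.

Lemma addedge_connected_bridgeless (G : graph) (u v : V G) :
  connected (addedge u v) -> bridgeless (addedge u v) -> connected G.
Proof.
move=> /connectedP[[x _] H] /bridgelessP B; apply/connectedP; split; first by exists x.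
move=> S a b aS bS; have [f cf] := H S a b aS bS.
have [g ge cg] : exists2 g, g != None & @cut (addedge u v) S g.
  by case: (eqVneq f None) => [fe|fe]; [subst f; apply: B|exists f].
by case: g ge cg => // e _ ce; exists e.
Qed.

(** A bipartition that splits the old edges attaches already in [G]; if the new edge is alone in its
    class, it attaches at both [u] and [v]. *)
Lemma nonsep_addedge (G : graph) (u v : V G) : u != v -> [set: E G] != set0 ->
  nonsep G -> nonsep (addedge u v).
Proof.
move=> uv E0 /nonsep_attachP[cG HG]; apply/nonsep_attachP; split.
  move/connectedP: (cG) => [[x _] H]; apply/connectedP; split; first by exists x.
  by move=> S a b aS bS; have [f cf] := H S a b aS bS; exists (Some f).
move=> A A0 AT.
wlog NA : A A0 AT / None \in A => [wl|].
  case: (boolP (None \in A)) => NA; first exact: wl.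
  rewrite -attach_C; apply: wl; last by rewrite inE.
    by rewrite -finset.setCT (inj_eq (can_inj (@finset.setCK _))).
  by rewrite -finset.setC0 (inj_eq (can_inj (@finset.setCK _))).
pose B : {set E G} := [set e | Some e \notin A].
have B0 : B != set0.
  have [x xA] : exists x, x \notin A.
    by apply/existsP; rewrite -negb_forall; apply: contra AT => /forallP ax; apply/eqP/setP => z; rewrite ax inE.
  case: x xA NA => [e|] xA NA; last by rewrite NA in xA.
  by apply/set0Pn; exists e; rewrite inE.
have up z : z \in touched B -> z \in touched (~: A).
  by move=> /touchedP[e eB ze]; apply/(@touchedP (addedge u v) (~: A) z); exists (Some e); rewrite !inE in eB *.
case: (eqVneq B setT) => [BT|BT]; last first.
  apply: leq_trans (HG B B0 BT) _; apply/subset_leq_card/fintype.subsetP => z.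
  rewrite !in_setI => /andP[/up -> /touchedP[e eB ze]]; rewrite andbT.
  by apply/(@touchedP (addedge u v) A z); exists (Some e) => //; rewrite !inE negbK in eB.
have all z : z \in touched (~: A).
  apply: up; have [e ze] := @connected_inc G z cG E0.
  by apply/(@touchedP G B z); exists e; rewrite // BT inE.
apply/card_gt1P; exists u, v; split=> //; rewrite in_setI all andbT; apply/touchedP; exists None => //.
  by rewrite /inc /= eqxx.
by rewrite /inc /= eqxx orbT.
Qed.

(** A bipartition that splits the edges of [delete e] attaches there. Otherwise the complement of
    [A] consists of new edges only, and two attachments are found among the ends of [e] and the new
    vertex, depending on which doubled edges that complement meets. *)
Lemma ear_nonsep (G : graph) (e : E G) : ~~ is_loop e -> [set: E (delete e)] != set0 ->
  nonsep (delete e) -> nonsep (ear e).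
Proof.
move=> nl E0 /nonsep_attachP[cG HG].
have [_ cD] := connectedP _ cG.
apply/nonsep_attachP; split.
  apply/connectedP; split; first by exists None.
  move=> S a b aS bS.
  case: (boolP [exists x, exists y, (Some x \in S) && (Some y \notin S)]).
    move=> /existsP[x /existsP[y /andP[xS yS]]].
    have [||f cf] := cD [set z | Some z \in S] x y; rewrite ?inE //.
    by exists (inl f); move: cf; rewrite /cut /= !inE.
  rewrite negb_exists => /forallP H.
  have H' x y : Some x \in S -> Some y \in S.
    by move=> xS; have := H x; rewrite negb_exists => /forallP/(_ y); rewrite xS /= negbK.
  exists (inr (true, true)); rewrite /cut /=.
  case: a b aS bS => [a|] [b|] aS bS.
  - by rewrite (H' _ _ aS) in bS.
  - by rewrite (negbTE bS) (H' _ _ aS).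
  - by rewrite aS; apply/negP => /eqP xS; rewrite (H' _ _ xS) in bS.
  - by rewrite aS in bS.
move=> A A0 AT.
pose B (A : {set E (ear e)}) : {set E (delete e)} := [set f | inl f \in A].
have BC X : ~: B X = B (~: X) by apply/setP => f; rewrite !inE.
have up (X : {set E (ear e)}) z : z \in touched (B X) -> Some z \in touched X.
  by move=> /touchedP[f fB zf]; apply/touchedP; exists (inl f); rewrite // inE in fB.
wlog BT : A A0 AT / B A = setT => [wl|].
  case: (eqVneq (B A) setT) => BT; first exact: wl.
  case: (eqVneq (B A) set0) => B0.
    rewrite -attach_C; apply: wl; last by rewrite -BC B0 finset.setC0.
      by rewrite -finset.setCT (inj_eq (can_inj (@finset.setCK _))).
    by rewrite -finset.setC0 (inj_eq (can_inj (@finset.setCK _))).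
  have [x [y [xa ya xy]]] := card_gt1P (HG (B A) B0 BT).
  apply/card_gt1P; exists (Some x), (Some y); split=> //.
    by move: xa; rewrite !in_setI BC => /andP[/up -> /up ->].
  by move: ya; rewrite !in_setI BC => /andP[/up -> /up ->].
have all z : Some z \in touched A.
  apply: up; have [f zf] := @connected_inc (delete e) z cG E0.
  by apply/(@touchedP (delete e) (B A) z); exists f; rewrite // BT inE.
have notl f : inl f \in A by have := in_setT f; rewrite -BT inE.
have inA z : (z \in attach A) = (z \in touched A) && (z \in touched (~: A)) by rewrite inE.
case: (boolP [exists i, inr (true, i) \notin A]) => [/existsP[i iA]|Hu];
case: (boolP [exists j, inr (false, j) \notin A]) => [/existsP[j jA]|Hv].
- apply/card_gt1P; exists (Some (ends e).1), (Some (ends e).2); split=> //.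
    by rewrite inA all; apply/touchedP; exists (inr (true, i)); rewrite ?inE // /inc /= eqxx.
  by rewrite inA all; apply/touchedP; exists (inr (false, j)); rewrite ?inE // /inc /= eqxx ?orbT.
- apply/card_gt1P; exists (Some (ends e).1), None; split=> //.
    by rewrite inA all; apply/touchedP; exists (inr (true, i)); rewrite ?inE // /inc /= eqxx.
  rewrite inA; apply/andP; split; apply/touchedP.
    exists (inr (false, true)) => //; apply: contraT => nA; case/negP: Hv; apply/existsP.
    by exists true.
  by exists (inr (true, i)); rewrite ?inE.
- apply/card_gt1P; exists (Some (ends e).2), None; split=> //.
    by rewrite inA all; apply/touchedP; exists (inr (false, j)); rewrite ?inE // /inc /= eqxx ?orbT.
  rewrite inA; apply/andP; split; apply/touchedP.
    exists (inr (true, true)) => //; apply: contraT => nA; case/negP: Hu; apply/existsP.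
    by exists true.
  by exists (inr (false, j)); rewrite ?inE.
- case/negP: AT; apply/eqP/setP => x; rewrite [RHS]inE; case: x => [f|[[] i]]; first exact: notl.
    by apply: contraT => nA; case/negP: Hu; apply/existsP; exists i.
  by apply: contraT => nA; case/negP: Hv; apply/existsP; exists i.
Qed.

Lemma quo_sym (G H : graph) phi psi (u v : V G) F :
  @quotient G H phi psi u v F -> quotient phi psi v u F.
Proof. by move=> [a b c d ke]; split=> // x y; rewrite ke [X in _ || X]orbC. Qed.

Lemma contract_quo (G : graph) (e : E G) (a b : V G) : inc a e -> inc b e -> a != b ->
  exists phi psi, @quotient G (contract e) phi psi a b (setT :\ e).
Proof.
move=> ae be ab.
have nl : ~~ is_loop e.
  apply: contra ab => l; move: l ae be; rewrite /is_loop /inc => /eqP ->.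
  by rewrite !orbb => /eqP <- /eqP <-.
have [phi [psi q]] := contract_spec nl; exists phi, psi.
move: ae be; rewrite /inc => /orP[]/eqP ea /orP[]/eqP eb.
- by rewrite -ea -eb eqxx in ab.
- by rewrite -ea -eb.
- by rewrite -ea -eb; apply: quo_sym.
- by rewrite -ea -eb eqxx in ab.
Qed.

Lemma contract_collapse (G H : graph) (e : E G) phi psi (a b : V G) :
  @quotient G H phi psi a b (setT :\ e) -> inc a e -> inc b e -> a != b ->
  forall f, f \notin setT :\ e -> phi (ends f).1 = phi (ends f).2.
Proof.
move=> q ae be ab f; rewrite !inE andbT negbK => /eqP ->.
have puv := quo_uv q.
move: ae be; rewrite /inc => /orP[]/eqP ea /orP[]/eqP eb.
- by rewrite -ea -eb eqxx in ab.
- by rewrite ea eb.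
- by rewrite ea eb.
- by rewrite -ea -eb eqxx in ab.
Qed.

(** * Degree 2, separable deletions and separable contractions *)

Section Local.
Variable G : graph.
Hypotheses (nG : nonsep G) (E2 : 1 < #|E G|).

Let loopless e := nonsep_loopless e nG E2.

Lemma degF_card F (x : V G) : degF F x = #|[set e in F | inc x e]|.
Proof.
rewrite /degF -sum1dep_card [RHS]big_mkcondr /=; apply: eq_bigr => e _.
by rewrite edeg_le1 //; case: (inc x e).
Qed.

Lemma degF_le_card F (x : V G) : degF F x <= #|F|.
Proof.
by rewrite degF_card; apply/subset_leq_card/fintype.subsetP => e; rewrite inE => /andP[].
Qed.

Lemma other_end (e : E G) v : inc v e -> exists2 a, inc a e & a != v.
Proof. by move=> _; apply: nonloop_other. Qed.

Lemma inc_ends (e : E G) a b x : inc a e -> inc b e -> a != b -> inc x e -> x = a \/ x = b.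
Proof.
rewrite /inc => /orP[]/eqP <- /orP[]/eqP <-; rewrite ?eqxx // => _ /orP[]/eqP <-; auto.
Qed.

Lemma deg_D1 (e : E G) x : inc x e -> deg x = (degF (setT :\ e) x).+1.
Proof.
move=> xe; rewrite degE (setT_D1 e) degF_U; last first.
  by apply/setP => f; rewrite !inE; case: eqP.
rewrite degF1 edeg_le1 // xe add1n; congr (_.+1); rewrite /degF; apply: eq_bigl => f.
by rewrite !inE; case: eqP.
Qed.

(** Let [e] and [f] be the edges at [v]. In a bipartition of the contraction, [e] is put into the
    class of [f]; then [v] is not attached and [phi] is injective on attachments. The merged vertex
    inherits the degree of the other end of [e], and [f] is a bridge of [delete e], so F(G) =
    F(G/e). *)
Lemma deg2_contract (v : V G) : deg v = 2 -> exists e : E G, [/\ ~~ is_loop e,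
  nonsep (contract e), has_bridge (delete e) & #|Wset (contract e)| <= #|Wset G|] /\
  #|V G| = #|V (contract e)|.+1.
Proof.
move=> d2; have [cG HG] := nonsep_attachP _ nG.
have : #|[set e in setT | inc v e]| == 2 by rewrite -degF_card -degE d2.
move=> /cards2P[e [f [ef D]]].
have inD g : inc v g = (g == e) || (g == f).
  by have := in_set2 g e f; rewrite -D !inE.
have ve : inc v e by rewrite inD eqxx.
have vf : inc v f by rewrite inD eqxx orbT.
have [a ae av] := other_end ve.
have [phi [psi q]] := contract_quo ae ve av.
have coll := contract_collapse q ae ve av.
have fT : f \in setT :\ e by rewrite !inE eq_sym ef.
exists e; split; last exact: quo_cardV q av.
split=> //.
- apply/nonsep_attachP; split; first exact: quo_connected q coll cG.
  move=> A A0 AT.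
  have [f' _ ff'] : exists2 f', f' \in setT & f = psi f'.
    by move: fT; rewrite -(quo_img q) => /imsetP.
  wlog fA : A A0 AT / f' \in A => [wl|].
    case: (boolP (f' \in A)) => fA; first exact: wl.
    rewrite -attach_C; apply: wl; last by rewrite inE.
      by rewrite -finset.setCT (inj_eq (can_inj (@finset.setCK _))).
    by rewrite -finset.setC0 (inj_eq (can_inj (@finset.setCK _))).
  set B := psi @: (~: A).
  have fB : f \notin B by rewrite ff' mem_imset ?inE ?fA //; apply: (quo_inj q).
  have eB : e \notin B.
    apply/negP => eB; have : e \in psi @: setT by apply: fintype.subsetP eB; apply/imsetS/finset.subsetT.
    by rewrite (quo_img q) !inE eqxx.
  have B0 : B != set0.
    have : ~: A != set0 by rewrite -finset.setCT (inj_eq (can_inj (@finset.setCK _))).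
    by case/set0Pn => g gA; apply/set0Pn; exists (psi g); apply: imset_f.
  have BT : B != setT by apply: contraNneq fB => ->; rewrite inE.
  have vB : v \notin touched B.
    by apply/touchedP => -[g gB]; rewrite inD => /orP[]/eqP gE; rewrite gE ?(negbTE eB) ?(negbTE fB) in gB.
  have phi_in : {in attach B &, injective phi}.
    have nv z : z \in attach B -> z != v.
      by rewrite in_setI => /andP[zB _]; apply: contraNneq vB => <-.
    move=> x y /nv xv /nv yv /eqP; rewrite (quo_ker q) (negbTE xv) (negbTE yv).
    by rewrite andbF /= !orbF => /eqP.
  apply: leq_trans (HG B B0 BT) _; rewrite -(card_in_imset phi_in).
  apply/subset_leq_card/fintype.subsetP => _ /imsetP[x + ->].
  rewrite !in_setI => /andP[xB /touchedP[g gB xg]]; apply/andP; split; last first.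
    by rewrite (quo_VF q); apply: imset_f.
  rewrite (quo_VF q); case: (eqVneq g e) => [ge|ge].
    suff -> : phi x = phi v.
      by apply: imset_f; apply/touchedP; exists f; rewrite // ff' imset_f.
    subst g; have [->|-> //] := inc_ends ae ve av xg; exact: quo_uv q.
  apply: imset_f; apply/touchedP; exists g => //.
  have : g \in psi @: setT by rewrite (quo_img q) !inE ge.
  move=> /imsetP[g' _ gg']; rewrite gg'; apply: imset_f.
  by apply: contraTT gB => gA; rewrite inE negbK gg' imset_f // inE.
- apply/existsP; exists (exist _ f (ltac:(by rewrite eq_sym) : f != e)).
  apply/is_bridgeP; exists [set v] => g.
  have -> : @cut (delete e) [set v] g = @cut G [set v] (val g) by [].
  rewrite -val_eqE /= cut1E edeg_le1 // inD.
  by rewrite (negbTE (valP g)) /=; case: (_ == f).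
- case: (boolP (a \in Wset G)) => aW; first by apply: (quo_W_in q); rewrite ?aW.
  apply: (quo_W_notmerged q) => //; rewrite (deg_quo_merged q) //.
  move: aW; rewrite inE -leqNgt; have := deg_D1 ae; have := deg_D1 ve; rewrite d2.
  by move=> [<-] ->; rewrite addn1.
Qed.

Hypothesis deg3 : forall x : V G, 2 < deg x.

(** [e] joins the two sides of a 1-separation of [delete e], as otherwise [G] itself would be
    separable. Adding [e] to one side, together with its far end [b], gives a 2-separation in which
    [b] has degree 1 on that side. The side then has a bridge and a flow polynomial equal to 0. *)
Lemma delete_psplit (e : E G) : ~~ nonsep (delete e) ->
  exists S1 S2 F1 F2 u v, [/\ @pair_split G S1 S2 F1 F2 u v, 1 < #|F1|, 1 < #|F2| & degF F1 v = 1].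
Proof.
move=> nD; have [cG HG] := nonsep_attachP _ nG.
have bG := nonsep_bridgeless nG E2.
have cD : connected (delete e) := connected_delete e cG bG.
have ED : [set: E (delete e)] != set0.
  by rewrite -card_gt0 cardsT -ltnS -card_delete.
have [S1 [S2 [A [B [w sp]]]]] := not_nonsep_vsplit cD ED nD.
pose VG := V G; pose X (A : {set E (delete e)}) : {set E G} := val @: A.
have inX (A' : {set E (delete e)}) (f : E (delete e)) : (val f \in X A') = (f \in A').
  by rewrite mem_imset //; apply: val_inj.
have eX A' : e \notin X A'.
  by apply/imsetP => -[f _ ef]; have := valP f; rewrite -ef eqxx.
have X0 A' : A' != set0 -> X A' != set0.
  by case/set0Pn => f fA; apply/set0Pn; exists (val f); rewrite inX.
have key T1 T2 A' B' : vertex_split T1 T2 A' B' w -> exists2 x : V G, inc x e & x \notin (T1 : {set VG}).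
  move=> [[/issubP i1 /issubP i2 T12 TT] [AB ABT A0 B0]].
  apply: contrapT => H.
  have H' x : inc x e -> x \in (T1 : {set VG}).
    by move=> xe; apply: contraT => xT; case: H; exists x.
  have := HG (X B') (X0 B' B0); rewrite ltnNge (_ : #|attach (X B')| <= 1).
    by move=> HH; have /negP := eX B'; apply; have /eqP -> : X B' == setT; [exact: contraT HH|rewrite inE].
  rewrite -(cards1 (w : V G)); apply/subset_leq_card/fintype.subsetP => x.
  rewrite -(T12 : _ = [set (w : V G)]) !in_setI => /andP[/touchedP[f /imsetP[f' fB ->] xf] /touchedP[g gB xg]].
  rewrite (i2 f' x fB xf) andbT; case: (eqVneq g e) => [ge|ge].
    by apply: H'; rewrite -ge.
  pose g' : E (delete e) := exist _ g ge.
  apply: (i1 g' x _ xg); have : g' \in A' :|: B' by rewrite ABT inE.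
  rewrite inE => /orP[//|gB']; move: gB.
  by rewrite inE -[g]/(val g') inX gB'.
have [b be b1] := key _ _ _ _ sp.
have [a ae a2] := key _ _ _ _ (vsplit_sym sp).
have [[/issubP i1 /issubP i2 S12 ST] [AB ABT A0 B0]] := sp.
have ab : a != b.
  apply: contraNneq b1 => ba; have : a \in S1 :|: S2 by rewrite ST inE.
  by rewrite inE (negbTE a2) orbF ba.
have a1 : a \in S1.
  by have : a \in S1 :|: S2; [rewrite ST inE|rewrite inE (negbTE a2) orbF].
have b2 : b \in S2.
  by have : b \in S1 :|: S2; [rewrite ST inE|rewrite inE (negbTE b1)].
have w1 : w \in S1 by have := set11 w; rewrite -S12 inE => /andP[].
have F12 : (e |: X A) :&: X B = set0.
  apply/setP => f; rewrite !inE; case: (eqVneq f e) => [->|fe] /=; first by rewrite (negbTE (eX B)).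
  apply/negP => /andP[/imsetP[g gA ->]]; rewrite inX; apply/negP; exact: setI0_notin gA.
have FT : (e |: X A) :|: X B = setT.
  apply/setP => f; rewrite !inE; case: (eqVneq f e) => //= fe.
  pose f' : E (delete e) := exist _ f fe.
  by rewrite -[f]/(val f') !inX -in_setU ABT inE.
have d1 : degF (e |: X A) b = 1.
  rewrite degF_U; last first.
    by apply/setP => f; rewrite !inE; case: eqP => // ->; rewrite (negbTE (eX A)).
  rewrite degF1 edeg_le1 // be; apply/eqP; rewrite eqSS -leqn0 leqNgt degF_gt0.
  by apply/touchedP => -[f /imsetP[f' fA ->] bf]; have := i1 f' b fA bf; rewrite (negbTE b1).
exists (b |: S1), S2, (e |: X A), (X B), w, b; split=> //.
- split; split=> //.
  + apply/issubP => f x; rewrite !inE => /orP[/eqP ->|/imsetP[f' fA ->]] xf.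
      by have [->|->] := inc_ends ae be ab xf; rewrite ?a1 ?eqxx ?orbT.
    by rewrite (i1 f') ?orbT.
  + by apply/issubP => f x /imsetP[f' fB ->]; apply: i2.
  + by apply: contraNneq b1 => <-.
  + apply/setP => x; rewrite !inE; case: (eqVneq x b) => [->|xb] /=; first by rewrite b2 orbT.
    by rewrite orbF -in_setI S12 inE.
  + by rewrite -finset.setUA ST finset.setUT.
- rewrite cardsU1 eX; case/set0Pn: (X0 A A0) => f fA.
  by rewrite add1n ltnS; apply/card_gt0P; exists f.
(* [b] has degree at least 3, of which [e] accounts for one; the remaining edges are in [X B]. *)
- apply: leq_trans (degF_le_card (X B) b).
  have := deg3 b; rewrite degE -FT degF_U // d1 add1n ltnS //.
Qed.

(** In a 1-separation of [contract e] the merged vertex is the attachment, so both classes touch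
    both ends of [e] in [G]. As [v] has degree 3, each class contains one edge at [v]; a class with
    at least two edges is one part, and [e] joins the other. When both classes are single edges, [G]
    consists of three parallel edges. *)
Lemma contract_psplit (e : E G) v : inc v e -> deg v = 3 -> ~~ nonsep (contract e) ->
  (exists S1 S2 F1 F2 u, [/\ @pair_split G S1 S2 F1 F2 u v, 1 < #|F1|, 1 < #|F2| & degF F1 v = 1])
  \/ (#|E G| = 3 /\ #|V G| = 2).
Proof.
move=> ve dv nC; have [cG HG] := nonsep_attachP _ nG.
have [a ae av] := other_end ve.
have [phi [psi q]] := contract_quo ae ve av.
have coll := contract_collapse q ae ve av.
have cC := quo_connected q coll cG.
have [A [A0 AT A1]] : exists A : {set E (contract e)}, [/\ A != set0, A != setT & #|attach A| <= 1].
  apply: contrapT => H; case/negP: nC; apply/nonsep_attachP; split=> // A A0 AT.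
  by rewrite ltnNge; apply/negP => A1; apply: H; exists A.
pose X (A : {set E (contract e)}) : {set E G} := psi @: A.
have eX A' : e \notin X A'.
  apply/negP => eB; have : e \in psi @: setT by apply: fintype.subsetP eB; apply/imsetS/finset.subsetT.
  by rewrite (quo_img q) !inE eqxx.
have XC A' : ~: X A' = e |: X (~: A').
  apply/setP => f; rewrite !inE; case: (eqVneq f e) => [->|fe] /=; first by rewrite eX.
  have : f \in psi @: setT by rewrite (quo_img q) !inE fe.
  by move=> /imsetP[f' _ ->]; rewrite !(mem_imset _ _ (quo_inj q)) inE.
have X0 A' : A' != set0 -> X A' != set0.
  by case/set0Pn => f fA; apply/set0Pn; exists (psi f); apply: imset_f.
have XT A' : X A' != setT by apply/eqP => XT; have := eX A'; rewrite XT inE.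
have VXC A' x : x \in touched (~: X A') = [|| x == a, x == v | x \in touched (X (~: A'))].
  rewrite XC; apply/touchedP/idP => [[f]|].
    rewrite in_setU1 => /orP[/eqP ->|fX] xf.
      by have [->|->] := inc_ends ae ve av xf; rewrite ?eqxx ?orbT.
    by apply/or3P; apply: Or33; apply/touchedP; exists f.
  move=> /or3P[/eqP->|/eqP->|/touchedP[f fX xf]].
  - by exists e; rewrite ?setU11.
  - by exists e; rewrite ?setU11.
  - by exists f; rewrite // !inE fX orbT.
(* Unless the merged vertex is attached to both sides, the side avoiding it
   lifts to a 1-separation of [G]. *)
have merged A' : A' != set0 -> #|attach A'| <= 1 -> phi a \in touched A'.
  move=> A'0 A'1; apply: contraT => na.
  have nVF x : x \in touched (X A') -> x != a /\ x != v.
    move=> xX; split; apply: contraNneq na => xE; rewrite -?xE ?(quo_uv q) -?xE (quo_VF q); exact: imset_f.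
  have := HG (X A') (X0 _ A'0) (XT A'); rewrite ltnNge => /negP; case.
  apply: leq_trans A'1; rewrite -(card_in_imset (f := phi)).
    apply/subset_leq_card/fintype.subsetP => _ /imsetP[x + ->].
    rewrite !in_setI => /andP[xX]; rewrite VXC; have [/negbTE -> /negbTE ->] /= := nVF x xX.
    by move=> xXC; rewrite !(quo_VF q) !imset_f.
  by move=> x y; rewrite !in_setI => /andP[/nVF[xa xv] _] _; apply: quo_phi_eq q _ _ xa xv.
have AC0 : ~: A != set0 by rewrite -finset.setCT (inj_eq (can_inj (@finset.setCK _))).
have attA x : x \in touched A -> x \in touched (~: A) -> x = phi a.
  move=> x1 x2; apply/eqP.
  have aA : phi a \in attach A by rewrite in_setI !merged // attach_C.
  have xA : x \in attach A by rewrite in_setI x1.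
  by have := card_le1P A1 _ aA x; rewrite xA => /esym.
have share x : x \in touched (X A) -> x \in touched (X (~: A)) -> x = a \/ x = v.
  move=> x1 x2; apply: (quo_merged q); apply: attA; rewrite (quo_VF q); exact: imset_f.
have touch A' : A' != set0 -> #|attach A'| <= 1 ->
   (forall x, x \in touched (X A') -> x \in touched (X (~: A')) -> x = a \/ x = v) ->
   a \in touched (X A') /\ v \in touched (X A').
  move=> A'0 A'1 sh.
  have := HG (X A') (X0 _ A'0) (XT A').
  have s : attach (X A') \subset [set a; v].
    apply/fintype.subsetP => x; rewrite in_setI VXC in_set2 => /andP[xX /or3P[->|->|xXC]]; rewrite ?orbT //.
    by have [->|->] := sh x xX xXC; rewrite eqxx ?orbT.
  move=> c; have E' : attach (X A') = [set a; v].
    by apply/eqP; rewrite eqEcard s cards2 av.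
  have := set21 a v; have := set22 a v; rewrite -E' !in_setI => /andP[vX _] /andP[aX _].
  by split.
have [aX vX] := touch A A0 A1 share.
have [aY vY] : a \in touched (X (~: A)) /\ v \in touched (X (~: A)).
  by apply: touch => //; rewrite ?attach_C // finset.setCK => x x1 x2; apply: share.
have XX : X A :&: X (~: A) = set0.
  apply/setP => f; rewrite !inE; apply/negP => /andP[/imsetP[g gA ->]].
  by rewrite mem_imset ?inE ?gA //; apply: (quo_inj q).
have [dX dY] : degF (X A) v = 1 /\ degF (X (~: A)) v = 1.
  move: vX vY; rewrite -!degF_gt0; have := deg_D1 ve; rewrite dv.
  have -> : setT :\ e = X A :|: X (~: A).
    by rewrite -(quo_img q) -imsetU finset.setUCr.
  by rewrite degF_U // => -[]; lia.
have ps A' : X A' :&: X (~: A') = set0 ->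
   (forall x, x \in touched (X A') -> x \in touched (X (~: A')) -> x = a \/ x = v) ->
   a \in touched (X A') -> v \in touched (X A') -> a \in touched (X (~: A')) -> v \in touched (X (~: A')) ->
   pair_split (touched (X A')) (touched (X (~: A'))) (X A') (e |: X (~: A')) a v.
  move=> XX' sh aX' vX' aY' vY'; split; split=> //.
  - by apply/issubP => f x fX xf; apply/touchedP; exists f.
  - apply/issubP => f x; rewrite in_setU1 => /orP[/eqP ->|fX] xf.
      by have [->|->] := inc_ends ae ve av xf.
    by apply/touchedP; exists f.
  - apply/setP => x; rewrite in_setI in_set2; apply/andP/orP => [[x1 x2]|].
      by have [->|->] := sh x x1 x2; rewrite eqxx; auto.
    by move=> []/eqP ->.
  - apply/setP => x; rewrite in_setU in_setT; apply/orP.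
    have [|f xf] := @connected_inc G x cG; first by apply/set0Pn; exists e.
    case: (boolP (f \in X A')) => fX; first by left; apply/touchedP; exists f.
    have : f \in ~: X A' by rewrite inE.
    rewrite XC in_setU1 => /orP[/eqP fe|fX'].
      by rewrite fe in xf; left; have [->|->] := inc_ends ae ve av xf.
    by right; apply/touchedP; exists f.
  - apply/setP => f; rewrite !inE; apply/negP => /andP[f1 /orP[/eqP fe|f2]].
      by move: (eX A'); rewrite -fe f1.
    by have := setI0_notin XX' f1; rewrite f2.
  - by rewrite -XC finset.setUCr.
have cardY A' : A' != set0 -> 1 < #|e |: X A'|.
  move=> /X0 /set0Pn[f fX]; rewrite cardsU1 eX add1n ltnS; apply/card_gt0P; by exists f.
case: (ltnP 1 #|X A|) => cX.
  left; exists (touched (X A)), (touched (X (~: A))), (X A), (e |: X (~: A)), a; split=> //.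
    exact: ps.
  exact: cardY.
case: (ltnP 1 #|X (~: A)|) => cY.
  left; exists (touched (X (~: A))), (touched (X A)), (X (~: A)), (e |: X A), a; split=> //.
    have := ps (~: A); rewrite finset.setCK; apply=> //; first by rewrite finset.setIC.
    by move=> x x1 x2; apply: share.
  exact: cardY.
have c1 : #|X A| = 1 by apply/eqP; rewrite eqn_leq cX card_gt0 X0.
have c2 : #|X (~: A)| = 1 by apply/eqP; rewrite eqn_leq cY card_gt0 X0.
right; split.
  have := cardsC (X A); rewrite c1 XC cardsU1 eX c2 => <- //.
have [f fE] := cards1P (introT eqP c1); have [g gE] := cards1P (introT eqP c2).
have all x : x \in [set a; v].
  have [|h xh] := @connected_inc G x cG; first by apply/set0Pn; exists e.
  have af : inc a f by move: aX => /touchedP[f']; rewrite fE inE => /eqP ->.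
  have vf : inc v f by move: vX => /touchedP[f']; rewrite fE inE => /eqP ->.
  have ag : inc a g by move: aY => /touchedP[f']; rewrite gE inE => /eqP ->.
  have vg : inc v g by move: vY => /touchedP[f']; rewrite gE inE => /eqP ->.
  have E' h' : inc a h' -> inc v h' -> inc x h' -> x \in [set a; v].
    by move=> ah vh; rewrite in_set2 => /(inc_ends ah vh av)[->|->]; rewrite eqxx ?orbT.
  case: (boolP (h \in X A)) => hX; first by move: hX xh; rewrite fE inE => /eqP ->; apply: E'.
  have : h \in ~: X A by rewrite inE.
  by rewrite XC gE !inE => /orP[]/eqP hE; move: xh; rewrite hE => /E'; rewrite in_set2; apply.
by have := cards2 a v; rewrite av => <-; rewrite -cardsT; apply: eq_card => x; rewrite all inE.
Qed.

End Local.

Lemma setT_nz (T : finType) : ([set: T] != set0) = (0 < #|T|).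
Proof. by rewrite -card_gt0 cardsT. Qed.

Lemma deg_ge2 (G : graph) (x : V G) : connected G -> bridgeless G -> 0 < #|E G| -> 1 < deg x.
Proof.
move=> cG /bridgelessP bG E0; have [|e xe] := connected_inc x cG; first by rewrite setT_nz.
rewrite ltn_neqAle degE degF_gt0 andbC; apply/andP; split.
  by apply/touchedP; exists e; rewrite ?inE.
apply/eqP => /esym/degF_eq1[f [_ f1 H]].
have [g gf cg] := bG [set x] f (ltac:(by rewrite cut1E f1)).
by move: gf; rewrite (H g) ?inE ?eqxx // cut1.
Qed.

Lemma nonsep_card1E (G : graph) : nonsep G -> bridgeless G -> #|E G| = 1 -> #|V G| = 1.
Proof.
move=> nG /bridgelessP bG E1.
have /card_gt0P[e _] : 0 < #|E G| by rewrite E1.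
have l : is_loop e.
  apply: contraT => l; have [|f fe _] := bG [set (ends e).1] e.
    by rewrite cut1E edeg_le1 // incE1.
  by have [y ey] := fintype1 E1; move: fe; rewrite (ey f) (ey e) eqxx.
move: nG => /and4P[_ _ _ /orP[/negP|/andP[/eqP H _]]]; last by rewrite cardsT in H.
by case; apply/hasloopP; exists e.
Qed.

Section PSplitPoly.
Variables (G : graph) (S1 S2 : {set V G}) (F1 F2 : {set E G}) (u v : V G).
Hypothesis sp : pair_split S1 S2 F1 F2 u v.

Definition side1 : graph := addedge (pt1 sp) (pt2 sp).
Definition side2 : graph := addedge (pt1 (psplit_sym sp)) (pt2 (psplit_sym sp)).

Local Open Scope ring_scope.
Lemma psplit_poly : ('X - 1) * flowpoly G =
  ('X - 1) * (flowpoly (subg S1 F1) * flowpoly (subg S2 F2)) + flowpoly side1 * flowpoly side2.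
Proof.
exact: (@flowpoly_psplit G S1 S2 F1 F2 u v (pt1 sp) (pt2 sp)
  (pt1 (psplit_sym sp)) (pt2 (psplit_sym sp)) sp erefl erefl erefl erefl).
Qed.
Local Close Scope ring_scope.

Lemma card_option_E (H : graph) (a b : V H) : #|E (addedge a b)| = #|E H|.+1.
Proof. by rewrite card_option. Qed.

Lemma side1_E : #|E side1| = #|F1|.+1.
Proof. by have [[i1 _ _ _ _] _] := sp; rewrite card_option_E card_subgE. Qed.
Lemma side2_E : #|E side2| = #|F2|.+1.
Proof. by have [[_ i2 _ _ _] _] := sp; rewrite card_option_E card_subgE. Qed.
Lemma side1_V : #|V side1| = #|S1|. Proof. exact: card_subgV. Qed.
Lemma side2_V : #|V side2| = #|S2|. Proof. exact: card_subgV. Qed.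

Hypotheses (nG : nonsep G) (F10 : 0 < #|F1|) (F20 : 0 < #|F2|).
Lemma side1_nonsep : nonsep side1.
Proof. by apply: psplit_addedge_nonsep; rewrite // -card_gt0. Qed.
Lemma side2_nonsep : nonsep side2.
Proof. by apply: psplit_addedge_nonsep; rewrite // -card_gt0. Qed.
Lemma side1_bridgeless : bridgeless side1.
Proof. by apply: nonsep_bridgeless; rewrite ?side1_nonsep ?side1_E. Qed.
Lemma side2_bridgeless : bridgeless side2.
Proof. by apply: nonsep_bridgeless; rewrite ?side2_nonsep ?side2_E. Qed.
Lemma side1_connected : connected side1. Proof. by have /nonsep_attachP[] := side1_nonsep. Qed.
Lemma side2_connected : connected side2. Proof. by have /nonsep_attachP[] := side2_nonsep. Qed.
Lemma part1_connected : connected (subg S1 F1).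
Proof. exact: addedge_connected_bridgeless side1_connected side1_bridgeless. Qed.

End PSplitPoly.

Lemma contract_facts (G : graph) (e : E G) : ~~ is_loop e -> connected G -> bridgeless G ->
  [/\ connected (contract e), bridgeless (contract e), #|E G| = #|E (contract e)|.+1 &
      #|V G| = #|V (contract e)|.+1].
Proof.
move=> nl cG bG.
have [phi [psi q]] := contract_spec nl.
have coll := contract_collapse q (incE1 e) (incE2 e) nl.
split.
- exact: quo_connected q coll cG.
- exact: quo_bridgeless q coll bG.
- exact: card_contractE.
- exact: quo_cardV q nl.
Qed.

Local Open Scope ring_scope.

Lemma sgn_odd (R : pzRingType) (a b : nat) : odd a = odd b -> (-1 : R) ^+ a = (-1) ^+ b.
Proof. by move=> ab; rewrite -[LHS]signr_odd ab signr_odd. Qed.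

(* The derivative of the flow polynomial at 1 is, up to sign, Crapo's beta
   invariant: nonnegative, and positive exactly for non-separable graphs. *)
Lemma flowpoly_beta (G : graph) : connected G -> bridgeless G -> (0 < #|E G|)%N ->
  exists g, flowpoly G = ('X - 1) * g /\
    (if nonsep G then 0 < (-1) ^+ (#|E G| + #|V G|) * g.[1] else g.[1] == 0).
Proof.
move En : #|E G| => n; elim/ltn_ind: n G En => n IH G En cG bG n0.
(* A separable graph has two factors vanishing at 1, hence a double zero there. *)
case: (boolP (nonsep G)) => nG; last first.
  have [S1 [S2 [F1 [F2 [w sp]]]]] := not_nonsep_vsplit cG (ltac:(by rewrite setT_nz En)) nG.
  have [[i1 i2 S12 ST] [F12 FT F10 F20]] := sp.
  have cE := vsplit_cardE sp.
  move: (F10) (F20); rewrite -!card_gt0 => F10' F20'.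
  have [||||g1 [e1 _]] := IH #|F1| _ (subg S1 F1) (card_subgE i1).
  - by clear -cE En F20'; lia.
  - exact: vsplit_connected sp cG.
  - exact: vsplit_bridgeless sp bG.
  - by [].
  have sp' := vsplit_sym sp.
  have [||||g2 [e2 _]] := IH #|F2| _ (subg S2 F2) (card_subgE i2).
  - by clear -cE En F10'; lia.
  - exact: vsplit_connected sp' cG.
  - exact: vsplit_bridgeless sp' bG.
  - by [].
  exists (g1 * (('X - 1) * g2)); rewrite (flowpoly_vsplit sp) e1 e2; split; first by ring.
  have h : ('X - 1 : {poly int}).[1] = 0 by rewrite !hornerE subrr.
  by rewrite !hornerM h mul0r mulr0.
case: (leqP n 1) => n1.
  have n1E : n = 1%N by clear -n0 n1; lia.
  have V1 := nonsep_card1E nG bG (etrans En n1E).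
  exists 1; rewrite flowpoly_card1 // En n1E expr1 mulr1 V1; split=> //.
  by rewrite hornerE -polyC1 hornerC.
have E2 : (1 < #|E G|)%N by rewrite En.
case: (boolP [exists v : V G, deg v == 2]) => [/existsP[v /eqP d2]|no2].
  have [e [[nl nC hb _] VC]] := deg2_contract nG E2 d2.
  have [cC bC EC _] := contract_facts nl cG bG.
  have [||||g [Fg gC]] := IH #|E (contract e)| _ (contract e) erefl.
  - by clear -EC En; lia.
  - by [].
  - by [].
  - by clear -EC En n1; lia.
  rewrite nC in gC; exists g; rewrite (flowpoly_dc nl) (flowpoly_bridge hb) subr0; split=> //.
  by rewrite -En EC VC (sgn_odd _ (b := #|E (contract e)| + #|V (contract e)|)) // addSn addnS /= negbK.
have deg3 (x : V G) : (2 < deg x)%N.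
  have := deg_ge2 x cG bG (ltnW E2); move: no2; rewrite negb_exists => /forallP/(_ x).
  by move=> n2 g1; rewrite ltn_neqAle eq_sym n2.
have [[x _] _] := connectedP _ cG.
have E3 : (2 < #|E G|)%N.
  by apply: leq_trans (deg3 x) _; rewrite degE -cardsT; apply: degF_le_card.
have /card_gt0P[e _] : (0 < #|E G|)%N by exact: ltnW.
have nl := nonsep_loopless e nG E2.
have [cC bC EC VC] := contract_facts nl cG bG.
have ED := card_delete e.
(* After correction by the signs, the derivative for [G] is the sum of those for [contract e], which
   is nonnegative, and for [delete e], which is positive in this case. *)
case: (boolP (nonsep (delete e))) => nD.
  have [cD _] := nonsep_attachP _ nD.
  have bD : bridgeless (delete e) by apply: nonsep_bridgeless => //; clear -ED E3; lia.
  have [||||gC [FC sC]] := IH #|E (contract e)| _ (contract e) erefl.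
  - by clear -EC En; lia.
  - exact: cC.
  - exact: bC.
  - by clear -EC E3; lia.
  have [||||gD [FD sD]] := IH #|E (delete e)| _ (delete e) erefl.
  - by clear -ED En; lia.
  - exact: cD.
  - exact: bD.
  - by clear -ED E3; lia.
  exists (gC - gD); rewrite (flowpoly_dc nl) FC FD; split; first by ring.
  rewrite nD in sD; rewrite !hornerE mulrBr.
  rewrite -En [X in X - _ * _](_ : _ = (-1) ^+ (#|E (contract e)| + #|V (contract e)|) * gC.[1]); last first.
    by rewrite EC VC; congr (_ * _); apply: sgn_odd; rewrite addSn addnS /= negbK.
  have -> : (-1 : int) ^+ (#|E G| + #|V G|) = - (-1) ^+ (#|E (delete e)| + #|V (delete e)|).
    by rewrite ED addSn exprS mulN1r.
  rewrite mulNr opprK; apply: ltr_wpDl => //.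
  by move: sC; case: ifP => _; [apply: ltW|move/eqP ->; rewrite mulr0].
(* One side has a bridge, so in [psplit_poly] only the product of the two sides with their added
   edges survives. Both of these are smaller and non-separable, since each part has at least two
   edges. *)
have [S1 [S2 [F1 [F2 [u [v [sp F1c F2c d1]]]]]]] := delete_psplit nG E2 deg3 nD.
have [[i1 i2 uv S12 ST] [F12 FT]] := sp.
have z1 := flowpoly_bridge (subg_deg1_bridge i1 d1).
have cE := psplit_cardE sp; have cV := psplit_cardV sp.
have [||||g1 [e1 s1]] := IH #|E (side1 sp)| _ (side1 sp) erefl.
- by rewrite side1_E; clear -cE En F2c; lia.
- by apply: side1_connected => //; exact: ltnW.
- by apply: side1_bridgeless => //; exact: ltnW.
- by rewrite side1_E.
have [||||g2 [e2 s2]] := IH #|E (side2 sp)| _ (side2 sp) erefl.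
- by rewrite side2_E; clear -cE En F1c; lia.
- by apply: side2_connected => //; exact: ltnW.
- by apply: side2_bridgeless => //; exact: ltnW.
- by rewrite side2_E.
have X1 : ('X - 1 : {poly int}) != 0 by apply: monic_neq0; apply: monicXsubC.
exists (g1 * g2); split.
  by apply: (mulfI X1); rewrite (psplit_poly sp) z1 mul0r mulr0 add0r e1 e2; ring.
move: s1 s2; rewrite side1_nonsep ?side2_nonsep //; try exact: ltnW.
rewrite side1_E side2_E side1_V side2_V hornerM => s1 s2.
have := mulr_gt0 s1 s2; rewrite mulrACA -exprD.
rewrite (sgn_odd _ (b := n + #|V G|)) //.
have -> : (#|F1|.+1 + #|S1| + (#|F2|.+1 + #|S2|) = (n + #|V G|) + 4)%N by clear -cE cV En; lia.
by rewrite oddD addbF.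
Qed.

(** [p1], [q1] and [p2], [q2] stand for the values of the sides G1 and G2 of a 2-separation without
    and with an edge uv. [p1 + q1] is the value of G1/uv, and the last hypothesis concerns G2 with
    uv added twice. They give |q1| > |p1| and (2 - x)|q2| > (x - 1)|p2|, so |q1 q2| outweighs (x -
    1)|p1 p2|. *)
Lemma signed_domination (R : realFieldType) (x s t p1 p2 q1 q2 : R) : 1 < x -> x < 2 ->
  0 < s * p1 -> 0 < - t * p2 -> 0 < - t * q2 -> 0 < - s * (p1 + q1) ->
  0 < t * ((x - 1) * p2 + (x - 2) * q2) ->
  0 < s * t * ((x - 1) * (p1 * p2) + q1 * q2).
Proof.
move=> x1 x2 A0 B0 D0 C0 K.
have y1 : 0 < x - 1 by rewrite subr_gt0.
have y2 : 0 < 2 - x by rewrite subr_gt0.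
have [A AE] : exists A, A = s * p1 by exists (s * p1).
have [B BE] : exists B, B = - t * p2 by exists (- t * p2).
have [C CE] : exists C, C = - s * q1 by exists (- s * q1).
have [D DE] : exists D, D = - t * q2 by exists (- t * q2).
have -> : s * t * ((x - 1) * (p1 * p2) + q1 * q2) = C * D - (x - 1) * A * B.
  by rewrite AE BE CE DE; ring.
have hK : 0 < (2 - x) * D - (x - 1) * B.
  have -> : (2 - x) * D - (x - 1) * B = t * ((x - 1) * p2 + (x - 2) * q2) by rewrite BE DE; ring.
  by [].
have hC : 0 < C - A.
  by have -> : C - A = - s * (p1 + q1) by rewrite AE CE; ring.
rewrite -AE in A0; rewrite -BE in B0; rewrite -DE in D0.
have -> : C * D - (x - 1) * A * B =
    (C - A) * D + A * ((2 - x) * D - (x - 1) * B) + A * D * (x - 1) by ring.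
by rewrite !addr_gt0 ?mulr_gt0.
Qed.

(** * Signs of flow polynomials in (1, 2) *)

Section Value.
Variables (R : realType) (x : R).

Definition flowpolyR (G : graph) : {poly R} := map_poly (fun z : int => z%:~R) (flowpoly G).
Definition flow_value (G : graph) : R := (flowpolyR G).[x].
Definition flow_sign (G : graph) : R := (-1) ^+ (#|E G| + #|V G| + (bnum G).+1).
Definition well_signed (G : graph) : Prop := 0 < flow_sign G * flow_value G.

Lemma map_X : map_poly (fun z : int => z%:~R) 'X = 'X :> {poly R}. Proof. exact: map_polyX. Qed.

Lemma flow_valueE (G : graph) (P : {poly int}) : flowpoly G = P ->
  flow_value G = (map_poly (fun z : int => z%:~R) P).[x].
Proof. by rewrite /flow_value /flowpolyR => ->. Qed.

Lemma flow_value_dc (G : graph) (e : E G) : ~~ is_loop e -> flow_value G = flow_value (contract e) - flow_value (delete e).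
Proof. by move=> nl; rewrite (flow_valueE (flowpoly_dc nl)) rmorphB hornerD hornerN. Qed.

Lemma flow_value_vsplit (G : graph) S1 S2 F1 F2 (w : V G) : vertex_split S1 S2 F1 F2 w ->
  flow_value G = flow_value (subg S1 F1) * flow_value (subg S2 F2).
Proof. by move=> sp; rewrite (flow_valueE (flowpoly_vsplit sp)) rmorphM hornerM. Qed.

Lemma flow_value_identify (G : graph) (u v : V G) : u != v ->
  flow_value (identify u v) = flow_value G + flow_value (addedge u v).
Proof. by move=> uv; rewrite (flow_valueE (flowpoly_identify uv)) rmorphD hornerD. Qed.

Lemma X1E : (map_poly (fun z : int => z%:~R : R) ('X - 1)).[x] = x - 1.
Proof. by rewrite rmorphB rmorph1 /= map_X !hornerE. Qed.
Lemma X2E : (map_poly (fun z : int => z%:~R : R) ('X - 2%:P)).[x] = x - 2.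
Proof. by rewrite rmorphB /= map_X map_polyC !hornerE. Qed.

Lemma flow_value_psplit (G : graph) S1 S2 F1 F2 (u v : V G) (sp : pair_split S1 S2 F1 F2 u v) :
  (x - 1) * flow_value G = (x - 1) * (flow_value (subg S1 F1) * flow_value (subg S2 F2)) + flow_value (side1 sp) * flow_value (side2 sp).
Proof.
have := congr1 (fun P => (map_poly (fun z : int => z%:~R : R) P).[x]) (psplit_poly sp).
by rewrite /= rmorphD !rmorphM hornerD !hornerM X1E.
Qed.

Lemma flow_value_addedge2 (G : graph) (u v : V G) :
  flow_value (addedge (u : V (addedge u v)) v) = (x - 1) * flow_value G + (x - 2) * flow_value (addedge u v).
Proof. by rewrite (flow_valueE (flowpoly_addedge2 u v)) rmorphD !rmorphM hornerD !hornerM X1E X2E. Qed.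

Lemma flow_value_ear (G : graph) (e : E G) :
  flow_value (ear e) = (x - 1) ^+ 2 * flow_value (delete e) + (x - 2) ^+ 2 * flow_value G.
Proof.
rewrite (flow_valueE (flowpoly_ear e)) !expr2 rmorphD !rmorphM hornerD !hornerM.
by rewrite X1E X2E.
Qed.

Lemma flow_value_bridge (G : graph) : has_bridge G -> flow_value G = 0.
Proof. by move=> hb; rewrite (flow_valueE (flowpoly_bridge hb)) rmorph0 horner0. Qed.

Lemma flow_value_card1 (G : graph) : #|V G| = 1%N -> flow_value G = (x - 1) ^+ #|E G|.
Proof. by move=> V1; rewrite (flow_valueE (flowpoly_card1 V1)) rmorphXn horner_exp X1E. Qed.

Lemma flow_sign_odd (G : graph) : odd (bnum G) -> flow_sign G = (-1) ^+ (#|E G| + #|V G|).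
Proof. by move=> ob; apply: sgn_odd; rewrite [in LHS]oddD /= ob addbF. Qed.

Lemma flow_sign_nonsep (G : graph) : nonsep G -> (0 < #|E G|)%N -> flow_sign G = (-1) ^+ (#|E G| + #|V G|).
Proof. by move=> nG E0; rewrite flow_sign_odd // bnum_nonsep ?setT_nz. Qed.

Lemma even_nonsep (G : graph) : ~~ odd (bnum G) -> (0 < #|E G|)%N -> ~~ nonsep G.
Proof. by move=> ob E0; apply: contra ob => nG; rewrite bnum_nonsep // setT_nz. Qed.

Lemma bnum_noedge (G : graph) : #|E G| = 0%N -> bnum G = 0%N.
Proof.
move=> E0; apply: eq_card0 => -[S F]; rewrite inE /=; apply/negP => /andP[_ /set0Pn[e _]].
by have := max_card (pred1 e); rewrite E0 card1.
Qed.

Lemma connected_noedge (G : graph) : connected G -> #|E G| = 0%N -> #|V G| = 1%N.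
Proof.
move=> /connectedP[[v _] cG] E0; have one y : y = v.
  apply: contrapT => /eqP yv; have [||e _] := cG [set y] y v; rewrite ?inE //; first by rewrite eq_sym.
  by have := max_card (pred1 e); rewrite E0 card1.
by rewrite -(card1 v); apply: eq_card => y; rewrite !inE (one y) eqxx.
Qed.

Lemma good_noedge (G : graph) : connected G -> #|E G| = 0%N -> well_signed G.
Proof.
move=> cG E0; have V1 := connected_noedge cG E0.
by rewrite /well_signed /flow_sign flow_value_card1 // E0 V1 bnum_noedge // expr0 mulr1 -signr_odd ltr01.
Qed.

Lemma W_delete (G : graph) (e : E G) : (#|Wset (delete e)| <= #|Wset G|)%N.
Proof.
apply: (@W_emb (delete e) G id) => // y.
rewrite (@deg_push (delete e) G id val y) //; first by rewrite degE; apply/degF_sub/finset.subsetT.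
  exact: val_inj.
by move=> f; apply: surjective_pairing.
Qed.

(** At [u] and at [v] the added edge replaces at least one edge of the other side. *)
Lemma W_side1 (G : graph) S1 S2 F1 F2 (u v : V G) (sp : pair_split S1 S2 F1 F2 u v) :
  nonsep G -> (0 < #|F1|)%N -> (0 < #|F2|)%N -> (#|Wset (side1 sp)| <= #|Wset G|)%N.
Proof.
move=> nG F10 F20; have [[i1 i2 uv S12 ST] [F12 FT]] := sp.
apply: (@W_emb (side1 sp) G val) => [|y]; first exact: val_inj.
rewrite deg_addedge deg_subg // degE -FT degF_U // leq_add2l.
have F1n : F1 != finset.set0 by rewrite -card_gt0.
have F2n : F2 != finset.set0 by rewrite -card_gt0.
rewrite -!val_eqE /=.
case: (eqVneq u (val y)) => [eu|_]; case: (eqVneq v (val y)) => [ev|_] //.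
- by rewrite eu ev eqxx in uv.
- by rewrite -eu; exact: (psplit_degu (psplit_sym sp)).
- by rewrite -ev; exact: (psplit_degu (psplit_sym (psplit_swap sp))).
Qed.

End Value.

Lemma side2E (G : graph) S1 S2 F1 F2 (u v : V G) (sp : pair_split S1 S2 F1 F2 u v) :
  side2 sp = side1 (psplit_sym sp).
Proof. by []. Qed.

(** * Exclusions in a graph whose smaller companions are well signed *)

Section Reduction.
Variables (R : realType) (x : R) (k : nat) (G : graph).
Hypotheses (x1 : 1 < x) (x2 : x < 2) (k0 : (0 < k)%N) (PG : Psi k G).
Local Notation Fx := (@flow_value R x).
Local Notation sg := (@flow_sign R).
Local Notation good := (@well_signed R x).
Hypothesis IH : forall H : graph, Psi k H -> (#|E H| < #|E G|)%N -> good H.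

Let bG : bridgeless G. Proof. by case: PG. Qed.
Let cG : connected G. Proof. by case: PG => _ []. Qed.
Let WG : (#|Wset G| <= k)%N. Proof. by case: PG => _ []. Qed.

Lemma good_separable : (0 < #|E G|)%N -> ~~ nonsep G -> good G.
Proof.
move=> E0 nG; have [|S1 [S2 [F1 [F2 [w sp]]]]] := not_nonsep_vsplit cG _ nG.
  by rewrite setT_nz.
have [[i1 i2 S12 ST] [F12 FT F10 F20]] := sp.
have cE := vsplit_cardE sp; have cV := vsplit_cardV sp; have cb := bnum_vsplit sp.
rewrite -!card_gt0 in F10 F20; have sp' := vsplit_sym sp.
have g1 : good (subg S1 F1).
  apply: IH; last by rewrite card_subgE //; clear -cE F20; lia.
  split; [|split]; [exact: vsplit_bridgeless sp bG|exact: vsplit_connected sp cG|].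
  exact: leq_trans (W_subg i1) WG.
have g2 : good (subg S2 F2).
  apply: IH; last by rewrite card_subgE //; clear -cE F10; lia.
  split; [|split]; [exact: vsplit_bridgeless sp' bG|exact: vsplit_connected sp' cG|].
  exact: leq_trans (W_subg i2) WG.
have := mulr_gt0 g1 g2; rewrite mulrACA -(flow_value_vsplit x sp) /sg -exprD.
rewrite !card_subgV !card_subgE // /well_signed /flow_sign cb.
set b1 := bnum _; set b2 := bnum _; rewrite (sgn_odd _ (b := #|E G| + #|V G| + (b1 + b2).+1)) //.
have -> : (#|F1| + #|S1| + b1.+1 + (#|F2| + #|S2| + b2.+1) = (#|E G| + #|V G| + (b1 + b2).+1) + 2)%N.
  by clear -cE cV; lia.
by rewrite [in LHS]oddD addbF.
Qed.

Section NonSep.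
Hypotheses (nG : nonsep G) (E2 : (1 < #|E G|)%N).

Let sgG : sg G = (-1) ^+ (#|E G| + #|V G|).
Proof. by apply: flow_sign_nonsep => //; exact: ltnW. Qed.

Section Pair.
Variables (S1 S2 : {set V G}) (F1 F2 : {set E G}) (u v : V G).
Hypotheses (sp : pair_split S1 S2 F1 F2 u v) (F12 : (1 < #|F1|)%N) (F22 : (1 < #|F2|)%N).

Let cE := psplit_cardE sp.
Let cV := psplit_cardV sp.

Lemma good_side1 : good (side1 sp).
Proof.
apply: IH; last by rewrite side1_E; clear -cE F22; lia.
split; [|split].
- by apply: side1_bridgeless => //; exact: ltnW.
- by apply: side1_connected => //; exact: ltnW.
- by apply: leq_trans (W_side1 sp nG _ _) WG; exact: ltnW.
Qed.

Lemma flow_sign_side1 : sg (side1 sp) = - (-1) ^+ (#|F1| + #|S1|).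
Proof.
rewrite flow_sign_nonsep ?side1_E // ?side1_V ?addSn ?exprS ?mulN1r //.
by apply: side1_nonsep => //; exact: ltnW.
Qed.

Lemma good_part1 : bridgeless (subg S1 F1) -> good (subg S1 F1).
Proof.
have [[i1 i2 uv S12 ST] [FF FT]] := sp.
move=> b1; apply: IH; last by rewrite card_subgE //; clear -cE F22; lia.
split=> //; split; last exact: leq_trans (W_subg i1) WG.
by apply: (part1_connected sp) => //; exact: ltnW.
Qed.

Lemma flow_sign_part1 : sg (subg S1 F1) = (-1) ^+ (#|F1| + #|S1|) * (-1) ^+ (bnum (subg S1 F1)).+1.
Proof. by have [[i1 _ _ _ _] _] := sp; rewrite /flow_sign card_subgE // card_subgV exprD. Qed.

End Pair.

Section Pair2.
Variables (S1 S2 : {set V G}) (F1 F2 : {set E G}) (u v : V G).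
Hypotheses (sp : pair_split S1 S2 F1 F2 u v) (F12 : (1 < #|F1|)%N) (F22 : (1 < #|F2|)%N).
Let sp' := psplit_sym sp.
Let b1 := bnum (subg S1 F1).
Let b2 := bnum (subg S2 F2).

Lemma flow_sign_pair : sg G = (-1) ^+ (#|F1| + #|S1|) * (-1) ^+ (#|F2| + #|S2|).
Proof.
rewrite sgG -exprD (sgn_odd _ (b := #|E G| + #|V G|)) //.
have -> : (#|F1| + #|S1| + (#|F2| + #|S2|) = #|E G| + #|V G| + 2)%N.
  by have cE := psplit_cardE sp; have cV := psplit_cardV sp; clear -cE cV; lia.
by rewrite [in LHS]oddD addbF.
Qed.

(** In the formula for a 2-separation the product of the sides with added edges always has the right
    sign. The product of the sides themselves has it when their numbers of blocks agree in parity;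
    it vanishes if one side has a bridge. *)
Lemma good_pair : Fx (subg S1 F1) * Fx (subg S2 F2) = 0 \/ odd b1 = odd b2 -> good G.
Proof.
move=> H; rewrite /well_signed -(pmulr_rgt0 _ (_ : 0 < x - 1)) ?subr_gt0 //.
rewrite mulrCA (flow_value_psplit x sp) mulrDr; apply: ltr_wpDl.
  rewrite mulrCA; apply: mulr_ge0; first by rewrite subr_ge0 ltW.
  have [->|n0] := eqVneq (Fx (subg S1 F1) * Fx (subg S2 F2)) 0; first by rewrite mulr0 lexx.
  have ob : odd b1 = odd b2 by case: H => // H; rewrite H eqxx in n0.
  move: n0; rewrite mulf_eq0 negb_or => /andP[n1 n2].
  have g1 : good (subg S1 F1).
    by apply: (good_part1 sp) => //; apply: contraNN n1 => hb; rewrite (flow_value_bridge x hb) eqxx.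
  have g2 : good (subg S2 F2).
    by apply: (good_part1 sp') => //; apply: contraNN n2 => hb; rewrite (flow_value_bridge x hb) eqxx.
  have := mulr_gt0 g1 g2; rewrite mulrACA (flow_sign_part1 sp) (flow_sign_part1 sp') flow_sign_pair.
  rewrite -/b1 -/b2; have e12 : (-1 : R) ^+ b1.+1 * (-1) ^+ b2.+1 = 1.
    by rewrite -exprD -signr_odd oddD /= ob addbb.
  by rewrite (mulrACA ((-1) ^+ (#|F1| + #|S1|))) e12 mulr1 => /ltW.
have g1 := good_side1 sp F12 F22; have g2 := good_side1 sp' F22 F12.
have := mulr_gt0 g1 g2; rewrite mulrACA (flow_sign_side1 sp) // (flow_sign_side1 sp') // mulrNN flow_sign_pair.
by rewrite side2E.
Qed.

(** Here the two products have opposite signs. Their sizes are compared through two further smaller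
    graphs: G1/uv, whose value is the sum of those of G1 and G1 + uv, and G2 with uv added twice.
    The signs of these feed [signed_domination]. *)
Lemma good_pair_identify : odd (bnum (identify (pt1 sp) (pt2 sp))) = odd b1 ->
  odd b1 != odd b2 -> good G.
Proof.
have [[i1 i2 uv S12 ST] [FF FT]] := sp.
have cE := psplit_cardE sp; have cV := psplit_cardV sp.
set H := identify _ _ => oH ob.
case: (boolP (has_bridge (subg S1 F1))) => [hb|br1].
  by apply: good_pair; left; rewrite flow_value_bridge ?mul0r.
case: (boolP (has_bridge (subg S2 F2))) => [hb|br2].
  by apply: good_pair; left; rewrite (flow_value_bridge _ hb) mulr0.
have F10 := ltnW F12; have F20 := ltnW F22.
have c1 : connected (subg S1 F1) by apply: (part1_connected sp).
have c2 : connected (subg S2 F2) by apply: (part1_connected sp').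
have d1 (z : V (subg S1 F1)) : (1 < degF F1 (val z))%N.
  by rewrite -(deg_subg z i1); apply: deg_ge2 => //; rewrite card_subgE.
have d2 (z : V (subg S2 F2)) : (1 < degF F2 (val z))%N.
  by rewrite -(deg_subg z i2); apply: deg_ge2 => //; rewrite card_subgE.
(* [u] has degree at least 2 on each bridgeless side, hence at least 4 in [G]; the merged vertex of
   [H] can be charged to it. *)
have uW : u \in Wset G.
  have := d1 (pt1 sp); have := d2 (pt1 sp'); rewrite inE degE -FT degF_U //= => du dv.
  exact: (leq_add dv du).
have puv : pt1 sp != pt2 sp by rewrite -val_eqE.
have [phi [psi q]] := identify_spec puv.
have coll (f : E (subg S1 F1)) : f \notin finset.setT -> phi (ends f).1 = phi (ends f).2.
  by rewrite inE.
have bH : bridgeless H by apply: quo_bridgeless q coll br1.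
have cH : connected H by apply: quo_connected q coll c1.
have EH : #|E H| = #|F1|.
  by rewrite -(card_subgE i1) -[LHS]cardsT -(card_imset _ (quo_inj q)) (quo_img q) cardsT.
have VH : #|S1| = #|V H|.+1 by rewrite -(card_subgV S1 F1) (quo_cardV q puv).
have WH : (#|Wset H| <= k)%N.
  apply: leq_trans WG; pose Z := [set z : V (subg S1 F1) | val z \in Wset G].
  apply: (@leq_trans #|Z|).
    apply: leq_trans (leq_imset_card phi (mem Z)); apply/subset_leq_card.
    apply: fintype.subset_trans (quo_W_sub q) _; rewrite finset.subUset sub1set; apply/andP; split.
      by apply: imset_f; rewrite inE.
    apply: imsetS; apply/fintype.subsetP => z; rewrite !inE deg_subg // => dz.
    by apply: leq_trans dz _; rewrite degE; apply/degF_sub/finset.subsetT.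
  rewrite -(card_imset Z val_inj); apply/subset_leq_card/fintype.subsetP => _ /imsetP[z + ->].
  by rewrite inE.
have gH : good H by apply: IH => //; rewrite EH -cE -[X in (X < _)%N]addn0 ltn_add2l.
have E10 : (0 < #|E (subg S1 F1)|)%N by rewrite card_subgE.
(* If [b1] were even, G1 and [H] would both be separable and their flow polynomials would have
   derivative 0 at 1. So would their difference, the flow polynomial of [side1 sp], which is
   non-separable. *)
have ob1 : odd b1.
  apply: contraT => nb1.
  have [g1 [e1 s1]] := flowpoly_beta c1 br1 E10.
  have [|gH' [eH sH]] := flowpoly_beta cH bH; first by rewrite EH.
  have [||| g [eg s]] := @flowpoly_beta (side1 sp).
  - by apply: side1_connected.
  - by apply: side1_bridgeless.
  - by rewrite side1_E.
  have X1 : ('X - 1 : {poly int}) != 0 by apply: monic_neq0; apply: monicXsubC.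
  have gE : g = gH' - g1.
    apply: (mulfI X1); rewrite -eg mulrBr -eH -e1 /H (flowpoly_identify puv) addrC addrA addNr add0r.
    by [].
  rewrite (negbTE (even_nonsep nb1 E10)) in s1.
  have nH : ~~ nonsep H by apply: even_nonsep; rewrite ?oH ?EH.
  rewrite (negbTE nH) in sH; rewrite side1_nonsep // in s.
  by move: s; rewrite gE hornerD hornerN (eqP s1) (eqP sH) subr0 mulr0 ltxx.
(* Makes G2 with two added edges smaller than [G]. If [F1] had only two edges, they would be
   parallel and [H] a vertex with two loops, whose value (x - 1)^2 has the wrong sign for an odd
   number of blocks. *)
have F13 : (2 < #|F1|)%N.
  rewrite ltn_neqAle F12 andbT; apply/eqP => F1E.
  have all (z : V (subg S1 F1)) f : f \in F1 -> inc (val z) f.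
    have := d1 z; rewrite (degF_card nG E2) => dz fF.
    have : [set e in F1 | inc (val z) e] = F1.
      apply/eqP; rewrite eqEcard -F1E dz andbT; apply/fintype.subsetP => g.
      by rewrite inE => /andP[].
    by move=> /setP/(_ f); rewrite inE fF.
  have S1E : #|S1| = 2%N.
    have /card_gt0P[f fF] := F10.
    have -> : S1 = [set u; v].
      apply/setP => z; rewrite !inE; apply/idP/orP; last first.
        by case=> /eqP ->; [exact: psplit_u1 sp|exact: psplit_v1 sp].
      move=> zS; have zf : inc z f := all (exist _ z zS) f fF.
      by have [->|->] := inc_ends (all (pt1 sp) f fF) (all (pt2 sp) f fF) uv zf; rewrite eqxx; auto.
    by rewrite cards2 uv.
  have VH1 : #|V H| = 1%N by move: VH; rewrite S1E => -[].
  move: gH; rewrite /well_signed /flow_sign flow_value_card1 // EH -F1E VH1 -signr_odd oddD /= oH ob1 /=.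
  rewrite expr1 mulN1r oppr_gt0 => /lt_geF; rewrite exprn_ge0 // subr_ge0 ltW //.
have ob2 : ~~ odd b2 by move: ob; rewrite ob1; case: (odd b2).
have gp1 := good_part1 sp F12 F22 br1; have gp2 := good_part1 sp' F22 F12 br2.
have gs2 := good_side1 sp' F22 F12.
have e1 : (-1 : R) ^+ b1.+1 = 1 by rewrite -signr_odd /= ob1.
have e2 : (-1 : R) ^+ b2.+1 = -1 by rewrite -signr_odd /= ob2.
have eH : (-1 : R) ^+ (bnum H).+1 = 1 by rewrite -signr_odd /= oH ob1.
rewrite /well_signed (flow_sign_part1 sp) -/b1 e1 mulr1 in gp1.
rewrite /well_signed (flow_sign_part1 sp') -/b2 e2 mulrN1 in gp2.
rewrite /well_signed (flow_sign_side1 sp') // in gs2.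
have gH2 : 0 < - (-1) ^+ (#|F1| + #|S1|) * Fx H.
  by move: gH; rewrite /well_signed /flow_sign EH exprD eH mulr1 VH addnS exprS mulN1r opprK.
(* The second parallel edge stays within the degrees of [G], since [u] and [v] have degree at least
   2 on the discarded side. *)
pose H2 := addedge (pt1 sp' : V (side1 sp')) (pt2 sp').
have nH2 : nonsep H2.
  apply: nonsep_addedge; [by rewrite -val_eqE|by rewrite setT_nz side1_E|].
  by apply: side1_nonsep.
have EH2 : #|E H2| = #|F2|.+2 by rewrite card_option_E side1_E.
have gH2' : good H2.
  apply: IH; last by rewrite EH2 -cE; clear -F13; lia.
  split; [|split].
  - by apply: nonsep_bridgeless => //; rewrite EH2.
  - by have /nonsep_attachP[] := nH2.
  - apply: leq_trans WG; apply: (@W_emb H2 G val) => [|y]; first exact: val_inj.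
    rewrite !deg_addedge deg_subg // degE -FT finset.setUC degF_U; last by rewrite finset.setIC.
    rewrite -addnA leq_add2l -!val_eqE /=.
    case: (eqVneq u (val y)) => [uy|_]; case: (eqVneq v (val y)) => [vy|_] //.
    + by rewrite uy vy eqxx in uv.
    + by rewrite -uy; exact: (d1 (pt1 sp)).
    + by rewrite -vy; exact: (d1 (pt2 sp)).
rewrite /well_signed flow_sign_nonsep ?EH2 // in gH2'.
rewrite (_ : #|V H2| = #|S2|) in gH2'; last exact: card_subgV.
rewrite !addSn !exprS !mulN1r opprK flow_value_addedge2 in gH2'.
have FH := flow_value_identify x puv.
rewrite /well_signed -(pmulr_rgt0 _ (_ : 0 < x - 1)) ?subr_gt0 //.
rewrite mulrCA (flow_value_psplit x sp) flow_sign_pair side2E.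
move: gp1 gp2 gs2 gH2 gH2'; rewrite -/H in FH; rewrite FH.
rewrite -/(side1 sp) -/(side1 sp').
exact: signed_domination.
Qed.

End Pair2.
End NonSep.
End Reduction.

Lemma identify_subE (G : graph) S1 S2 F1 F2 (u v : V G) (sp : pair_split S1 S2 F1 F2 u v) :
  identify_sub S1 F1 u v = identify (pt1 sp) (pt2 sp).
Proof.
rewrite /identify_sub; case: insubP => [a _ au|]; last by rewrite (psplit_u1 sp).
case: insubP => [b _ bv|]; last by rewrite (psplit_v1 sp).
by congr identify; apply: val_inj.
Qed.

Section Reduction2.
Variables (R : realType) (x : R) (k : nat) (G : graph).
Hypotheses (x1 : 1 < x) (x2 : x < 2) (k0 : (0 < k)%N) (PG : Psi k G).
Local Notation Fx := (@flow_value R x).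
Local Notation sg := (@flow_sign R).
Local Notation good := (@well_signed R x).
Hypothesis IH : forall H : graph, Psi k H -> (#|E H| < #|E G|)%N -> good H.

Let bG : bridgeless G. Proof. by case: PG. Qed.
Let cG : connected G. Proof. by case: PG => _ []. Qed.
Let WG : (#|Wset G| <= k)%N. Proof. by case: PG => _ []. Qed.

Lemma Psi_contract (e : E G) : ~~ is_loop e -> (#|Wset (contract e)| <= k)%N ->
  Psi k (contract e).
Proof. by move=> nl W; have [cC bC _ _] := contract_facts nl cG bG. Qed.

Lemma Psi_delete (e : E G) : nonsep (delete e) -> (2 < #|E G|)%N -> Psi k (delete e).
Proof.
move=> nD; rewrite (card_delete e) ltnS => E3; split; first exact: nonsep_bridgeless.
by split; [have /nonsep_attachP[] := nD|exact: leq_trans (W_delete e) WG].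
Qed.

(** In F(G) = F(G/e) - F(G - e), an odd b(G/e) gives F(G/e) the sign expected of F(G), while the
    non-separable G - e, with one edge less and as many vertices, has the opposite one. *)
Lemma good_contract (e : E G) : nonsep G -> (2 < #|E G|)%N -> nonsep (delete e) ->
  odd (bnum (contract e)) -> (#|Wset (contract e)| <= k)%N -> good G.
Proof.
move=> nG E3 nD ob W; have E2 := ltnW E3; have nl := nonsep_loopless e nG E2.
have [cC bC EC VC] := contract_facts nl cG bG; have ED := card_delete e.
have gC : good (contract e) by apply: IH; [exact: Psi_contract|rewrite EC].
have gD : good (delete e) by apply: IH; [exact: Psi_delete|rewrite ED].
rewrite /well_signed flow_sign_nonsep ?(ltnW E2) // (flow_value_dc x nl) mulrBr -mulrN.
have E20 : (0 < #|E (delete e)|)%N by move: E2; rewrite ED.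
rewrite /well_signed flow_sign_nonsep // in gD.
have -> : (-1 : R) ^+ (#|E G| + #|V G|) = sg (contract e).
  by rewrite flow_sign_odd //; apply: sgn_odd; rewrite EC VC addSn addnS /= negbK.
apply: addr_gt0 => //.
have -> : sg (contract e) = - (-1) ^+ (#|E (delete e)| + #|V (delete e)|).
  rewrite flow_sign_odd // -[RHS]mulN1r -exprS; apply: sgn_odd.
  by rewrite -addSn -ED EC [V (delete e)]/(V G) VC addSn addnS /= negbK.
by rewrite mulrNN.
Qed.

Lemma reduction : ~ good G -> [/\ inPhi G, (#|V G| <= k)%N & (2 < #|E G|)%N].
Proof.
move=> bad.
have E0 : (0 < #|E G|)%N.
  by rewrite lt0n; apply/eqP => E0; apply: bad; exact: good_noedge.
have nG : nonsep G.
  by apply: contraT => nG; case: bad; apply: good_separable PG IH E0 nG.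
have E2 : (1 < #|E G|)%N.
  rewrite ltn_neqAle E0 andbT; apply/eqP => E1; apply: bad.
  have V1 := nonsep_card1E nG bG (esym E1).
  by rewrite /well_signed flow_sign_nonsep // flow_value_card1 // V1 -E1 -signr_odd expr0 mul1r expr1 subr_gt0.
have sgG : sg G = (-1) ^+ (#|E G| + #|V G|) by apply: flow_sign_nonsep.
have deg3 (v : V G) : (2 < deg v)%N.
  rewrite ltn_neqAle deg_ge2 // andbT; apply/eqP => /esym d2; apply: bad.
  have [e [[nl nC hb W] VC]] := deg2_contract nG E2 d2.
  have [_ _ EC _] := contract_facts nl cG bG.
  have gC : good (contract e).
    by apply: IH; [apply: Psi_contract => //; exact: leq_trans W WG|rewrite EC].
  rewrite /well_signed flow_sign_nonsep // in gC; last by move: E2; rewrite EC.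
  rewrite /well_signed sgG (flow_value_dc x nl) (flow_value_bridge x hb) subr0.
  rewrite (sgn_odd _ (b := #|E (contract e)| + #|V (contract e)|)) //.
  by rewrite EC VC addSn addnS /= negbK.
have [[v0 _] cutG] := connectedP _ cG.
have E3 : (2 < #|E G|)%N.
  by apply: leq_trans (deg3 v0) _; rewrite degE -cardsT; apply: degF_le_card.
have nloop e := nonsep_loopless e nG E2.
have deg1_good S1 S2 F1 F2 (u v : V G) : pair_split S1 S2 F1 F2 u v -> (1 < #|F1|)%N -> (1 < #|F2|)%N ->
    degF F1 v = 1%N -> False.
  move=> sp F12 F22 d1; have [[i1 _ _ _ _] _] := sp.
  apply: bad; apply: (good_pair x1 PG IH nG E2 sp F12 F22); left.
  by rewrite flow_value_bridge ?mul0r //; apply: subg_deg1_bridge d1.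
have a' (e : E G) : nonsep (delete e).
  apply: contraT => nD.
  have [S1 [S2 [F1 [F2 [u [v [sp F12 F22 d1]]]]]]] := delete_psplit nG E2 deg3 nD.
  by case: (deg1_good S1 S2 F1 F2 u v).
have noodd (e : E G) : (#|Wset (contract e)| <= k)%N -> ~~ odd (bnum (contract e)).
  by move=> W; apply/negP => ob; apply: bad; apply: good_contract (a' e) ob W.
(* Once all degrees exceed 3, #V = #W is at most [k]. A vertex outside W(G) yields a degree-3 end of
   an edge whose contraction stays in [Psi k]: an edge leaving W(G), or any edge if W(G) is empty.
   That contraction has an even number of blocks by [noodd], so it is separable and
   [contract_psplit] applies. *)
have allW (v : V G) : v \in Wset G.
  apply: contraT => vW.
  have [e [v' [ve v'W We]]] : exists e (v' : V G), [/\ inc v' e, v' \notin Wset G & (#|Wset (contract e)| <= k)%N].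
    case: (eqVneq (Wset G) finset.set0) => [W0|/set0Pn[w wW]].
      have [|e ve] := connected_inc v cG; first by rewrite setT_nz.
      have [phi [psi q]] := contract_spec (nloop e).
      by exists e, v; split=> //; apply: leq_trans (quo_W_le1 q W0) k0.
    have [e ce] := cutG (Wset G) w v wW vW.
    have [phi [psi q]] := contract_spec (nloop e).
    have W' : (#|Wset (contract e)| <= k)%N.
      apply: leq_trans WG; apply: (quo_W_in q); move: ce; rewrite /cut.
      by case: (_ \in Wset G) => //=; case: (_ \in Wset G).
    move: ce; rewrite /cut; case e1: ((ends e).1 \in Wset G) => //=.
      by move=> e2; exists e, (ends e).2; split; rewrite ?incE2 //; case: (_ \in _) e2.
    by exists e, (ends e).1; rewrite incE1 e1.
  have d3 : deg v' = 3%N.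
    by apply/eqP; rewrite eqn_leq deg3 andbT; move: v'W; rewrite inE -leqNgt.
  have [_ _ EC VC] := contract_facts (nloop e) cG bG.
  have nC : ~~ nonsep (contract e).
    by apply: even_nonsep (noodd e We) _; move: E2; rewrite EC.
  have [[S1 [S2 [F1 [F2 [u [sp F12 F22 d1]]]]]]|[E3E V2E]] := contract_psplit nG E2 ve d3 nC.
    by case: (deg1_good S1 S2 F1 F2 u v').
  (* Three parallel edges: the value is (x - 1)(x - 2), negative on (1, 2) as the odd exponent
     requires. *)
  case: bad; rewrite /well_signed sgG E3E V2E -signr_odd /= expr1.
  rewrite (flow_value_dc x (nloop e)) flow_value_card1; last by move: VC; rewrite V2E => -[].
  have -> : #|E (contract e)| = 2%N by move: EC; rewrite E3E => -[].
  have ED : #|E (delete e)| = 2%N by have := card_delete e; rewrite E3E => -[].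
  have /card_gt0P[f _] : (0 < #|E (delete e)|)%N by rewrite ED.
  have nlf : ~~ is_loop f := nloop (val f).
  have [cD _] := nonsep_attachP _ (a' e).
  have bD : bridgeless (delete e) by apply: nonsep_bridgeless (a' e) _; rewrite ED.
  have [_ _ EfC VfC] := contract_facts nlf cD bD.
  rewrite (flow_value_dc x nlf) flow_value_card1; last by move: VfC; rewrite [#|V (delete e)|]V2E => -[].
  have -> : #|E (contract f)| = 1%N by move: EfC; rewrite ED => -[].
  have ED1 : #|E (delete f)| = 1%N by have := card_delete f; rewrite ED => -[].
  rewrite (flow_value_bridge x (G := delete f)).
    rewrite subr0 expr1 [X in 0 < X](_ : _ = (x - 1) * (2 - x)); last by ring.
    by rewrite mulr_gt0 ?subr_gt0.
  have /card_gt0P[g _] : (0 < #|E (delete f)|)%N by rewrite ED1.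
  have [g0 ag] := fintype1 ED1.
  have nlg : ~~ is_loop (val (val g)) := nloop _.
  apply/existsP; exists g; apply/is_bridgeP; exists [set (ends g).1] => h.
  have -> : h = g by rewrite (ag h) (ag g).
  by rewrite eqxx cut1E edeg_le1 ?incE1.
split=> //.
  split=> //.
  - have /card_gt0P[e _] : (0 < #|E G|)%N by [].
    by rewrite -cardsT; apply/card_gt1P; exists (ends e).1, (ends e).2; split; rewrite ?inE //; apply: nloop.
  (* Both ends of [e] lie in W(G) by now, so no contraction enlarges it. *)
  - move=> e; apply: noodd; have [phi [psi q]] := contract_spec (nloop e).
    by apply: leq_trans (quo_W_in q _) WG; rewrite allW.
  (* (c') amounts to b(G1) differing in parity from both b(G2) and b(G1/u1u2); each agreement is
     excluded by one of the two lemmas on 2-separations. *)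
  - move=> S1 S2 F1 F2 u1 u2 i1 i2 F12 F22 uu S12 ST FF FT.
    have sp : pair_split S1 S2 F1 F2 u1 u2 by [].
    have ob : odd (bnum (subg S1 F1)) != odd (bnum (subg S2 F2)).
      by apply/eqP => ob; apply: bad; apply: (good_pair x1 PG IH nG E2 sp F12 F22); right.
    rewrite (identify_subE sp).
    have oi : odd (bnum (identify (pt1 sp) (pt2 sp))) != odd (bnum (subg S1 F1)).
      by apply/eqP => oi; apply: bad; apply: (good_pair_identify x1 x2 PG IH nG E2 F12 F22 oi ob).
    by move: oi ob; do 3 case: (odd _).
by apply: leq_trans WG; apply: subset_leq_card; apply/fintype.subsetP => z _.
Qed.

End Reduction2.

(** * Finiteness and roots *)

(** The fuel bounds the depth of the recursion, so finitely many shapes arise although the graphs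
    range over a proper class. *)
Lemma flowp_fuel_finite n : exists L : seq {poly int}, forall G, flowp_fuel n G \in L.
Proof.
elim: n => [|n [L HL]]; first by exists [:: 1] => G; rewrite inE.
exists [:: 0, 1 & [seq ('X - 1) * P | P <- L] ++ [seq P - Q | P <- L, Q <- L]] => G /=.
case: ifP => _; first by rewrite inE eqxx.
case: pickP => [e _|_]; last by rewrite !inE eqxx orbT.
rewrite !inE mem_cat; case: ifP => _.
  by rewrite map_f ?orbT.
by rewrite (allpairs_f (fun P Q => P - Q)) ?orbT.
Qed.

Lemma flowpoly_finite n : exists L : seq {poly int}, forall G, (#|E G| <= n)%N -> flowpoly G \in L.
Proof.
elim: n => [|n [L HL]].
  have [L HL] := flowp_fuel_finite 1; exists L => G; rewrite leqn0 => /eqP E0.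
  by rewrite /flowpoly E0.
have [L' HL'] := flowp_fuel_finite n.+2; exists (L ++ L') => G.
rewrite leq_eqVlt mem_cat => /orP[/eqP EG|/HL -> //].
by rewrite /flowpoly EG HL' orbT.
Qed.

Lemma bnum_card1 (G : graph) : #|V G| = 1%N -> bnum G = #|E G|.
Proof.
move En : #|E G| => n; elim/ltn_ind: n G En => n IH G En V1.
have [v0 av] := fintype1 V1.
have cG : connected G.
  apply/connectedP; split; first by exists v0.
  by move=> S a b; rewrite (av a) (av b) => ->.
case: (posnP n) => [n0|n0]; first by rewrite n0 bnum_noedge // En.
case: (boolP (nonsep G)) => nG.
  rewrite bnum_nonsep ?setT_nz ?En //; apply/esym/eqP; rewrite eqn_leq n0 andbT leqNgt.
  apply/negP => n2; have := nG => /nonsep_attachP[_ H].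
  have /card_gt0P[e _] : (0 < #|E G|)%N by rewrite En.
  have e0 : [set e] != finset.set0 by apply/set0Pn; exists e; rewrite inE.
  have eT : [set e] != finset.setT.
    by apply/eqP => eT; move: n2; rewrite -En -cardsT -eT cards1.
  have [x [y [_ _]]] := card_gt1P (H [set e] e0 eT).
  by rewrite (av x) (av y) eqxx.
have [|S1 [S2 [F1 [F2 [w sp]]]]] := not_nonsep_vsplit cG _ nG; first by rewrite setT_nz En.
have [[i1 i2 S12 ST] [F12 FT F10 F20]] := sp.
have cV := vsplit_cardV sp; have cE := vsplit_cardE sp.
rewrite -!card_gt0 in F10 F20.
have S1w (S : {set V G}) : w \in S -> #|S| = 1%N.
  move=> wS; apply/eqP; rewrite eqn_leq; apply/andP; split; last by apply/card_gt0P; exists w.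
  by rewrite -V1; apply: max_card.
have := set11 w; rewrite -S12 inE => /andP[w1 w2].
rewrite (bnum_vsplit sp) (IH #|F1|) ?card_subgV ?card_subgE ?S1w //.
- rewrite (IH #|F2|) ?card_subgV ?card_subgE ?S1w ?cE // -En -cE.
  by rewrite -[X in (X < _)%N]add0n ltn_add2r.
- by rewrite -En -cE -[X in (X < _)%N]addn0 ltn_add2l.
Qed.

Lemma inPhi_nonsep G : inPhi G -> nonsep G. Proof. by case. Qed.

Lemma inPhi_connected G : inPhi G -> connected G.
Proof. by move=> /inPhi_nonsep/nonsep_attachP[]. Qed.

Lemma inPhi_bridgeless G : inPhi G -> bridgeless G.
Proof.
move=> [_ _ a' _ _]; apply/bridgelessP => S e ce.
have /nonsep_attachP[/connectedP[_ cD] _] := a' e.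
have [x [y [xS yS]]] : exists x y, x \in S /\ y \notin S.
  move: ce; rewrite /cut; case e1: ((ends e).1 \in S); case e2: ((ends e).2 \in S) => // _.
    by exists (ends e).1, (ends e).2; rewrite e1 e2.
  by exists (ends e).2, (ends e).1; rewrite e1 e2.
by have [f cf] := cD S x y xS yS; exists (val f); [exact: (valP f)|].
Qed.

Lemma inPhi_E G : inPhi G -> (1 < #|E G|)%N.
Proof.
move=> PG; have [nG V2 a' _ _] := PG; have cG := inPhi_connected PG.
rewrite ltnNge; apply/negP => E1.
have E0 : (0 < #|E G|)%N.
  by rewrite lt0n; apply/eqP => E0; move: V2; rewrite (connected_noedge cG E0).
have E1' : #|E G| = 1%N by apply/eqP; rewrite eqn_leq E1.
by move: V2; rewrite (nonsep_card1E nG (inPhi_bridgeless PG) E1').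
Qed.

(* Three parallel edges would violate (c'): that subgraph is one block, and
   identifying its two vertices turns it into three loops. *)
Lemma inPhi_parallel G (p : V G * V G) : inPhi G -> (4 < #|E G|)%N ->
  (#|[set e : E G | ends e == p]| <= 2)%N.
Proof.
move=> PG E5; rewrite leqNgt; apply/negP => /card_gt2P[e1 [e2 [e3 [[m1 m2 m3] [n12 n23 n31]]]]].
have [nG _ _ _ c'] := PG; have E2 := inPhi_E PG.
set F1 := e1 |: [set e2; e3].
have F1E : #|F1| = 3%N.
  by rewrite /F1 cardsU1 cards2 !inE negb_or n12 n23 eq_sym n31.
have F1p f : f \in F1 -> ends f = p.
  by rewrite !inE in m1 m2 m3 * => /or3P[]/eqP -> ; apply/eqP.
pose a := p.1; pose b := p.2.
have ab : a != b.
  have := nonsep_loopless e1 nG E2; rewrite /is_loop F1p //; by rewrite !inE eqxx.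
have i1 : issub [set a; b] F1.
  apply/issubP => f x fF; rewrite /inc (F1p f fF) !inE.
  by move=> /orP[]/eqP <-; rewrite eqxx ?orbT.
have sp : pair_split [set a; b] finset.setT F1 (~: F1) a b.
  split; split=> //.
  - by apply/issubP => f x _ _; rewrite inE.
  - by rewrite finset.setIT.
  - by rewrite finset.setUT.
  - exact: finset.setICr.
  - exact: finset.setUCr.
have [[_ i2 _ S12 ST] [FF FT]] := sp.
(* Five edges leave two outside the parallel three, as (c') requires of the other part. *)
have F2E : (2 <= #|~: F1|)%N.
  by have := cardsC F1; rewrite F1E; clear -E5; lia.
have [|odds _] := c' _ _ _ _ _ _ i1 i2 _ F2E ab S12 ST FF FT; first by rewrite F1E.
move: odds; rewrite (identify_subE sp).
have puv : pt1 sp != pt2 sp by rewrite -val_eqE.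
have [phi [psi q]] := identify_spec puv.
set H := identify _ _ in q *.
have VH : #|V H| = 1%N.
  by have := quo_cardV q puv; rewrite card_subgV cards2 ab => -[].
have EH : #|E H| = 3%N.
  by rewrite -F1E -(card_subgE i1) -[LHS]cardsT -(card_imset _ (quo_inj q)) (quo_img q) cardsT.
rewrite (bnum_card1 VH) EH bnum_nonsep //; last by rewrite setT_nz card_subgE // F1E.
have all2 (z : V (subg [set a; b] F1)) : z = pt1 sp \/ z = pt2 sp.
  by have := valP z; rewrite in_set2 => /orP[]/eqP zE; [left|right]; apply: val_inj.
have ends_sub (f : E (subg [set a; b] F1)) : (ends f).1 = pt1 sp /\ (ends f).2 = pt2 sp.
  by split; apply: val_inj; rewrite /= (F1p _ (psi_in f)).
apply/nonsep_attachP; split.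
  apply/connectedP; split; first by exists (pt1 sp).
  have /card_gt0P[f _] : (0 < #|E (subg [set a; b] F1)|)%N by rewrite card_subgE // F1E.
  move=> S z y zS yS; have [f1 f2] := ends_sub f; exists f; rewrite /cut f1 f2.
  by have [zE|zE] := all2 z; have [yE|yE] := all2 y; move: zS yS; rewrite zE yE => zS; rewrite ?zS // => /negbTE ->.
move=> A A0 AT.
have touch (B : {set E (subg [set a; b] F1)}) z : B != finset.set0 -> z \in touched B.
  move=> /set0Pn[f fB]; have [f1 f2] := ends_sub f; apply/touchedP; exists f => //.
  by rewrite /inc f1 f2; have [->|->] := all2 z; rewrite eqxx ?orbT.
have AC0 : ~: A != finset.set0 by rewrite -finset.setCT (inj_eq (can_inj (@finset.setCK _))).
by apply/card_gt1P; exists (pt1 sp), (pt2 sp); split; rewrite // in_setI !touch.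
Qed.

(** The ends form ordered pairs, so there are k * k classes of at most two edges each; the 4 covers
    the graphs too small for [inPhi_parallel]. *)
Lemma PhiK_card_E k G : PhiK k G -> (#|E G| <= maxn 4 (2 * (k * k)))%N.
Proof.
move=> [PG VG]; case: (leqP #|E G| 4) => E4; first by rewrite leq_max E4.
rewrite leq_max; apply/orP; right.
have -> : #|E G| = (\sum_(p : V G * V G) #|[set e : E G | ends e == p]|)%N.
  rewrite -sum1_card (partition_big (@ends G) xpredT) //=.
  by apply: eq_bigr => p _; rewrite sum1dep_card.
apply: (@leq_trans (\sum_(p : V G * V G) 2)%N).
  by apply: leq_sum => p _; apply: inPhi_parallel.
by rewrite sum_nat_const mulnC card_prod VG.
Qed.

Section Analysis.
Variable R : realType.
Implicit Types (x u r : R).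

Lemma poly_roots_in_seq (p : {poly R}) : p != 0 -> exists s : seq R, forall r, root p r -> r \in s.
Proof.
move Sp : (size p) => n; elim: n p Sp => [|n IH] p Sp p0.
  by move/eqP: Sp; rewrite size_poly_eq0 (negbTE p0).
case: (pselect (exists r, root p r)) => [[r /factor_theorem[q pE]]|no]; last first.
  by exists [::] => r rr; case: no; exists r.
have q0 : q != 0 by apply: contraNneq p0 => q0; rewrite pE q0 mul0r.
have Sq : size q = n by move: Sp; rewrite pE size_Mmonic ?monicXsubC // size_XsubC addn2 => -[].
have [s Hs] := IH q Sq q0; exists (r :: s) => r'.
by rewrite pE rootM root_XsubC inE => /orP[/Hs ->|->]; rewrite ?orbT.
Qed.

Lemma polys_roots_in_seq (L : seq {poly R}) :
  exists s : seq R, forall p, p \in L -> p != 0 -> forall r, root p r -> r \in s.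
Proof.
elim: L => [|p L [s Hs]]; first by exists [::].
case: (eqVneq p 0) => [p0|p0].
  by exists s => q; rewrite inE => /orP[/eqP ->|/Hs //]; rewrite p0 eqxx.
have [s' Hs'] := poly_roots_in_seq p0; exists (s' ++ s) => q.
rewrite inE => /orP[/eqP ->|qL] q0 r rr; rewrite mem_cat ?(Hs' r rr) //.
by rewrite (Hs q qL q0 r rr) orbT.
Qed.

Lemma exists_min_seq (P : R -> Prop) (s : seq R) : (exists r, P r) ->
  (forall r, P r -> r \in s) -> exists2 m, P m & forall r, P r -> m <= r.
Proof.
elim: s P => [|a s IH] P [r Pr] Ps; first by have := Ps r Pr.
case: (pselect (exists r', P r' /\ r' < a)) => [[r' [Pr' ra]]|no].
  have [||m [Pm ma] mP] := IH (fun r => P r /\ r < a); first by exists r'.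
    by move=> t [Pt ta]; have := Ps t Pt; rewrite inE (lt_eqF ta).
  exists m => // t Pt; case: (ltP t a) => ta; first exact: mP.
  by apply: le_trans ta; apply: ltW.
have aP t : P t -> a <= t by move=> Pt; rewrite leNgt; apply/negP => ta; apply: no; exists t.
case: (pselect (P a)) => Pa; first by exists a.
apply: IH; first by exists r.
move=> t Pt; have := Ps t Pt; rewrite inE => /orP[/eqP ta|//].
by case: Pa; rewrite -ta.
Qed.

Lemma flow_rootE G x : flow_root G x <-> flow_value x G = 0.
Proof. by rewrite /flow_root /flow_value /flowpolyR; split => [/rootP|/eqP]. Qed.

Lemma good_nonroot G x : well_signed x G -> flow_value x G <> 0.
Proof. by rewrite /well_signed => g F0; move: g; rewrite F0 mulr0 ltxx. Qed.

(** Dividing by x - 1 removes the simple zero at 1. The quotient has the right sign at 1 and not at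
    [x], and its zero in between is not 1. *)
Lemma bad_root G x : nonsep G -> bridgeless G -> (0 < #|E G|)%N -> 1 < x -> ~ well_signed x G ->
  exists r, [/\ 1 < r, r <= x & flow_value r G = 0].
Proof.
move=> nG bG E0 x1 bad; have [cG _] := nonsep_attachP _ nG.
have [g [Fg]] := flowpoly_beta cG bG E0; rewrite nG => g1.
pose h : {poly R} := map_poly (fun z : int => z%:~R) g.
have FxhE y : flow_value y G = (y - 1) * h.[y].
  by rewrite (flow_valueE y Fg) rmorphM hornerM X1E.
pose s : R := (-1) ^+ (#|E G| + #|V G|).
have h1 : 0 < s * h.[1].
  have -> : s * h.[1] = ((-1) ^+ (#|E G| + #|V G|) * g.[1])%:~R.
    by rewrite intrM intr_sign /h -[X in _.[X]](rmorph1 (intmul 1)) horner_map.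
  by rewrite ltr0z.
have hx : s * h.[x] <= 0.
  rewrite leNgt; apply/negP => hx; apply: bad.
  by rewrite /well_signed flow_sign_nonsep // FxhE mulrCA mulr_gt0 // subr_gt0.
have [||r] := @poly_ivt R (- s *: h) 1 x; first exact: ltW.
  by rewrite !hornerZ !mulNr !oppr_le0 oppr_ge0 hx ltW.
move=> /andP[r1 rx] /rootP; rewrite hornerZ => hr.
have s0 : - s != 0 by rewrite oppr_eq0 signr_eq0.
exists r; split=> //; last first.
  by rewrite FxhE; move/eqP: hr; rewrite mulf_eq0 (negbTE s0) => /eqP ->; rewrite mulr0.
rewrite lt_neqAle r1 andbT; apply: contraTneq h1 => ->.
by move/eqP: hr; rewrite mulf_eq0 (negbTE s0) => /eqP ->; rewrite mulr0 ltxx.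
Qed.

End Analysis.

(** * Thresholds *)

Section Final.
Variable R : realType.
Implicit Types (x u r : R).

Lemma inPhi_Psi k G : inPhi G -> (#|V G| <= k)%N -> Psi k G.
Proof.
move=> PG Vk; split; first exact: inPhi_bridgeless.
split; first exact: inPhi_connected.
exact: leq_trans (max_card _) Vk.
Qed.

(** Minimality is kept only through the deletions, which are what [ear_bad] uses. *)
Lemma minimal_bad k x : (0 < k)%N -> 1 < x -> x < 2 ->
  (exists2 G, Psi k G & ~ well_signed x G) ->
  exists M, [/\ inPhi M, (#|V M| <= k)%N, ~ well_signed x M & forall e : E M, well_signed x (delete e)].
Proof.
move=> k0 x1 x2 [G]; move En : #|E G| => n; elim/ltn_ind: n G En => n IH G En PG bad.
case: (pselect (exists H, [/\ Psi k H, (#|E H| < #|E G|)%N & ~ well_signed x H])).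
  by move=> [H [PH EH bH]]; apply: (IH #|E H| _ H erefl); rewrite -?En.
move=> no.
have mn H : Psi k H -> (#|E H| < #|E G|)%N -> well_signed x H.
  by move=> PH EH; apply: contrapT => bH; apply: no; exists H.
have [PhG VG E3] := reduction x1 x2 k0 PG mn bad.
exists G; split=> // e; have [_ _ a' _ _] := PhG.
apply: mn; last by rewrite (card_delete e).
by have := Psi_delete PG (a' e) E3.
Qed.

Definition allgood (k : nat) u := forall x, 1 < x -> x < u -> forall G, Psi k G -> well_signed x G.

Lemma Phi_root x M : inPhi M -> 1 < x -> ~ well_signed x M ->
  exists r, [/\ 1 < r, r <= x & flow_value r M = 0].
Proof.
move=> PM x1 bad; apply: bad_root => //.
- exact: inPhi_nonsep.
- exact: inPhi_bridgeless.
- exact: ltnW (inPhi_E PM).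
Qed.

(* Replacing an edge of a minimal badly signed graph by a doubled path keeps the wrong
   sign, now strictly, at the cost of one vertex; hence a root further left. *)
Lemma ear_bad k u M : inPhi M -> (#|V M| <= k)%N -> 1 < u -> u < 2 -> ~ well_signed u M ->
  (forall e : E M, well_signed u (delete e)) ->
  exists r H, [/\ 1 < r, r < u, Psi k.+1 H & ~ well_signed r H].
Proof.
move=> PM VM u1 u2 bad gd; have E2 := inPhi_E PM; have [nM V2 a' _ _] := PM.
have /card_gt0P[e _] : (0 < #|E M|)%N by exact: ltnW.
have nl := nonsep_loopless e nM E2.
have ED := card_delete e.
have E1 : (0 < #|E (delete e)|)%N by move: E2; rewrite ED.
have nH : nonsep (ear e) by apply: ear_nonsep => //; rewrite setT_nz.
have EH : #|E (ear e)| = (#|E M| + 3)%N.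
  by rewrite card_sum card_prod card_bool ED addSnnS.
have VH : #|V (ear e)| = #|V M|.+1 by rewrite card_option.
have EH1 : (1 < #|E (ear e)|)%N by rewrite EH addnC.
have bH := nonsep_bridgeless nH EH1.
have sgH : flow_sign R (ear e) = flow_sign R M.
  rewrite !flow_sign_nonsep // ?(ltnW E2) ?(ltnW EH1) //; apply: sgn_odd.
  by rewrite EH VH addnS addnAC -addnS [in LHS]oddD addbF.
have sgD : flow_sign R (delete e) = - flow_sign R M.
  rewrite !flow_sign_nonsep // ?(ltnW E2) //.
  by rewrite ED addSn exprS mulN1r opprK.
(* Three more edges and one more vertex leave the sign unchanged. In [flow_value_ear] the term of
   [M] is not positive relative to it, and the term of the well signed [delete e] is strictly
   negative. *)
have neg : flow_sign R (ear e) * flow_value u (ear e) < 0.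
  rewrite sgH flow_value_ear mulrDr; apply: ltr_wnDr.
    rewrite mulrCA; apply: mulr_ge0_le0; first by rewrite exprn_even_ge0.
    by rewrite leNgt; apply/negP.
  have := gd e; rewrite /well_signed sgD mulNr oppr_gt0 => g.
  by rewrite mulrCA pmulr_rlt0 // exprn_gt0 // subr_gt0.
have badH : ~ well_signed u (ear e) by rewrite /well_signed => g; have := lt_trans g neg; rewrite ltxx.
have [r [r1 ru Fr]] := bad_root nH bH (ltnW EH1) u1 badH.
exists r, (ear e); split=> //.
- rewrite lt_neqAle ru andbT; apply: contraTneq neg => <-; by rewrite Fr mulr0 ltxx.
- split=> //; split; first by have /nonsep_attachP[] := nH.
  by apply: leq_trans (max_card _) _; rewrite VH.
- by move=> /good_nonroot.
Qed.

Lemma Phi_roots_finite k : exists s : seq R, forall r, (exists2 M, PhiK k M & flow_value r M = 0) -> r \in s.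
Proof.
have [L HL] := flowpoly_finite (maxn 4 (2 * (k * k))).
have [s Hs] := polys_roots_in_seq [seq (map_poly (fun z : int => z%:~R) P : {poly R}) | P <- L].
exists s => r [M PM FM]; have [PM' _] := PM; have E2 := inPhi_E PM'.
have LM : flowpolyR R M \in [seq map_poly (fun z : int => z%:~R) P | P <- L].
  by apply: map_f; apply: HL; apply: PhiK_card_E.
(* A zero polynomial would make every number a root; the non-zero derivative at 1 excludes it. *)
have nz : flowpolyR R M != 0.
  have [g [Fg]] := flowpoly_beta (inPhi_connected PM') (inPhi_bridgeless PM') (ltnW E2).
  rewrite (inPhi_nonsep PM') => g1; have g0 : g != 0.
    by apply: contraTneq g1 => ->; rewrite horner0 mulr0 ltxx.
  have F0 : flowpoly M != 0 by rewrite Fg mulf_neq0 // monic_neq0 // monicXsubC.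
  by rewrite /flowpolyR map_poly_eq0_id0 // intr_eq0 lead_coef_eq0.
exact: (Hs _ LM nz r (introT eqP FM)).
Qed.

(** Such a [u] equals both sides of the theorem: the root at [u], or the cap 2, bounds them from
    above, and [allgood] excludes smaller roots in [Psi k]. *)
Definition threshold (k : nat) u :=
  [/\ 1 < u, u <= 2, (u = 2 \/ exists2 G, PhiK k G & flow_value u G = 0) & allgood k u].

Lemma threshold1 : threshold 1 2.
Proof.
split=> //; [lra|by left|move=> x x1 x2 G PG].
apply: contrapT => bad.
have [|M [PM VM _ _]] := @minimal_bad 1 x isT x1 x2; first by exists G.
by case: PM => _ V2; move: (leq_trans V2 VM).
Qed.

Lemma threshold_step k u : (0 < k)%N -> threshold k u -> exists u', threshold k.+1 u'.
Proof.
move=> k0 [u1 u2 ur gu].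
have claim x : 1 < x -> x < u -> (exists2 G, Psi k.+1 G & ~ well_signed x G) ->
    exists M r, [/\ PhiK k.+1 M, 1 < r, r <= x & flow_value r M = 0].
  move=> x1 xu bad; have x2 := lt_le_trans xu u2.
  have [M [PM VM bM _]] := minimal_bad (ltn0Sn k) x1 x2 bad.
  have [r [r1 rx Fr]] := Phi_root PM x1 bM.
  exists M, r; split=> //; split=> //.
  apply/eqP; rewrite eqn_leq VM ltnNge; apply/negP => VMk; apply: bM.
  by apply: gu => //; apply: inPhi_Psi.
(* If nothing in [Psi k.+1] is badly signed below [u], then [u = 2]: a smaller [u] is a root for a
   graph of [PhiK k], and [ear_bad] turns this into a badly signed graph to the left of [u]. *)
case: (pselect (exists z H, [/\ 1 < z, z < u, Psi k.+1 H & ~ well_signed z H])); last first.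
  move=> no; case: ur => [u2E|[G PG FG]].
    exists 2; split=> //; [lra|by left|move=> x x1 x2 G PG].
    by apply: contrapT => bad; apply: no; exists x, G; rewrite u2E.
  case: (ltP u 2) => [ult|uge]; last first.
    have u2E : u = 2 by apply/eqP; rewrite eq_le u2 uge.
    exists 2; split=> //; [lra|by left|move=> x x1 x2 H PH].
    by apply: contrapT => bad; apply: no; exists x, H; rewrite u2E.
  have bad : exists2 G, Psi k G & ~ well_signed u G.
    by exists G; [apply: inPhi_Psi; [case: PG|case: PG => _ ->]|move=> /good_nonroot].
  have [M [PM VM bM gM]] := minimal_bad k0 u1 ult bad.
  by case: no; apply: ear_bad PM VM u1 ult bM gM.
move=> [z [H [z1 zu PH bH]]].
have [s Hs] := Phi_roots_finite k.+1.
(* The new threshold is the smallest of the finitely many such roots; [claim] rules out badly signed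
   graphs below it. *)
pose P r := 1 < r /\ exists2 M, PhiK k.+1 M & flow_value r M = 0.
have [M [r [PM r1 rz Fr]]] := claim z z1 zu (ex_intro2 _ _ H PH bH).
have [||y [y1 [N PN Fy]] ymin] := @exists_min_seq R P s.
- by exists r; split=> //; exists M.
- by move=> t [_ Ht]; apply: Hs.
have yr : y <= r by apply: ymin; split=> //; exists M.
have yu : y < u by apply: le_lt_trans yr (le_lt_trans rz zu).
exists y; split=> //; [exact: le_trans (ltW yu) u2|by right; exists N|].
move=> x x1 xy G PG; apply: contrapT => bad.
have [M' [r' [PM' r'1 r'x Fr']]] := claim x x1 (lt_trans xy yu) (ex_intro2 _ _ G PG bad).
have : y <= r' by apply: ymin; split=> //; exists M'.
by rewrite leNgt (le_lt_trans r'x xy).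
Qed.

Lemma threshold_exists k : exists u, threshold k u.
Proof.
elim: k => [|[|k] [u IH]].
(* The reduction starts at [k = 1]; [Psi 0] is contained in [Psi 1], so the threshold 2 serves for
   both. *)
- exists 2; have [a b _ d] := threshold1; split=> //; first by left.
  by move=> x x1 x2 G [bG [cG WG]]; apply: d => //; split=> //; split=> //; apply: leq_trans WG _.
- by exists 2; exact: threshold1.
- exact: threshold_step (ltn0Sn k) IH.
Qed.

Local Open Scope classical_set_scope.

Lemma xi_threshold k u : threshold k u -> xi R k = u.
Proof.
move=> [u1 u2 ur gu]; rewrite /xi; set S := [set beta : R | _].
have Su : S u.
  split; first by rewrite u1.
  by move=> G PG x /andP[x1 xu] /flow_rootE; apply: good_nonroot; apply: gu.
have ub : ubound S u.
  move=> b [/andP[b1 b2] Hb]; rewrite leNgt; apply/negP => ub.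
  case: ur => [u2E|[G [PG VG] FG]]; first by move: b2; rewrite -u2E leNgt ub.
  apply: (Hb G _ u); [by apply: inPhi_Psi; rewrite ?VG|by rewrite u1|exact/flow_rootE].
apply/eqP; rewrite eq_le; apply/andP; split; first by apply: ge_sup ub; exists u.
by apply: ub_le_sup => //; exists u.
Qed.

Lemma eta_cases G : eta R G = 2 \/ (1 < eta R G <= 2 /\ flow_root G (eta R G)).
Proof.
rewrite /eta; case: xgetP => [y ->|no]; last by left.
by move=> [y12 [ry _]]; right.
Qed.

Lemma etaS_threshold k u : threshold k u -> etaS R (PhiK k) = u.
Proof.
move=> [u1 u2 ur gu]; rewrite /etaS; case: asboolP => [[G0 PG0]|no]; last first.
  (* An empty class leaves only [u = 2], the default value in [etaS]. *)
  by case: ur => // -[G PG _]; case: no; exists G.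
have eta_ge G : PhiK k G -> u <= eta R G.
  move=> [PG VG]; case: (eta_cases G) => [-> //|[/andP[e1 e2] /flow_rootE Fe]].
  rewrite leNgt; apply/negP => eu; apply: good_nonroot Fe; apply: gu => //.
  by apply: inPhi_Psi; rewrite ?VG.
have [G PG eG] : exists2 G, PhiK k G & eta R G = u.
  case: ur => [u2E|[G PG FG]].
    exists G0 => //; apply/eqP; rewrite eq_le eta_ge // andbT u2E.
    by case: (eta_cases G0) => [->//|[/andP[]]].
  exists G => //; apply: xget_unique.
    split; first by rewrite u1.
    split=> [|t /andP[t1 t2] /flow_rootE Ft]; first exact/flow_rootE.
    rewrite leNgt; apply/negP => tu; apply: good_nonroot Ft; apply: gu => //.
    by case: PG => PG VG; apply: inPhi_Psi; rewrite ?VG.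
  move=> t [/andP[t1 t2] [/flow_rootE Ft tmin]]; apply/eqP; rewrite eq_le tmin ?u1 //=; last exact/flow_rootE.
  rewrite leNgt; apply/negP => tu; apply: good_nonroot Ft; apply: gu => //.
  by case: PG => PG VG; apply: inPhi_Psi; rewrite ?VG.
set S := [set r : R | _].
have Su : S u by exists G.
have lb : lbound S u by move=> _ [H PH ->]; apply: eta_ge.
apply/eqP; rewrite eq_le; apply/andP; split; last by apply: lb_le_inf => //; exists u.
by apply: ge_inf => //; exists u.
Qed.

Lemma threshold_mono k u u' : threshold k u -> threshold k.+1 u' -> u' <= u.
Proof.
move=> [u1 u2 ur gu] [u1' u2' _ gu']; rewrite leNgt; apply/negP => uu.
case: ur => [u2E|[G [PG VG] FG]]; first by move: u2'; rewrite leNgt -u2E uu.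
apply: (@good_nonroot R G u) FG; apply: gu' => //.
by apply: inPhi_Psi; rewrite ?VG.
Qed.

End Final.

Theorem theorem4p7 (R : realType) :
  (forall k : nat, etaS R (PhiK k.+1) <= etaS R (PhiK k)) /\
  (forall k : nat, xi R k = etaS R (PhiK k)).
Proof.
split=> k; have [u tu] := threshold_exists R k.
  have [u' tu'] := threshold_exists R k.+1.
  by rewrite (etaS_threshold tu) (etaS_threshold tu'); apply: threshold_mono tu tu'.
by rewrite (etaS_threshold tu) (xi_threshold tu).
Qed.
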